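(* Let $k$ be an integer with $1\le k\le\frac D2$ and $x_0\in\mathcal L_k(\Omega)$. Then: (i) If $k<\frac D2$, the Terwilliger algebra $\mathbf T(x_0)$ is isomorphic to $(\lfloor k/2\rfloor+1)\cdot\mathbb C\ \oplus\bigoplus_{(h,i,j)\in\mathbf P(k)\setminus(\mathbf P^{(0)}_{\rm II}(k)\cup\mathbf P^{(0)}_{\rm III}(k))}\operatorname{End}\big(\mathbb C^{\min\{D-k-i,k-j\}-\max\{i,j\}-h+1}\big)$. (ii) If $k=\frac D2$, $\mathbf T(x_0)$ is isomorphic to $\bigoplus_{h=0}^{D/2}\bigoplus_{i=0}^{\lfloor (D-2h)/4\rfloor}(i+1)\cdot\operatorname{End}\big(\mathbb C^{D/2-h-2i+1}\big)$.
   Context: $\Omega$ is a $D$-dimensional vector space over a finite field $\mathbb F$, $q=\sqrt{|\mathbb F|}$, $[n]_q=\frac{q^n-q^{-n}}{q-q^{-1}}$. $\mathcal L_k(\Omega)$ is the set of $k$-dimensional subspaces of $\Omega$ and $\mathbb C^{\mathcal L_k(\Omega)}$ the complex vector space with that basis. For $1\le k\le D-1$, the Grassmann graph $J_q(D,k)$ has vertex set $\mathcal L_k(\Omega)$, with $x,y$ adjacent iff $\dim(x\cap y)=k-1$; its adjacency operator is $\mathbf Ax=\sum_{x'\in\mathcal L_k(\Omega),\ \dim(x\cap x')=k-1}x'$. For $x_0\in\mathcal L_k(\Omega)$, the dual adjacency operator $\mathbf A^*(x_0)$ is the diagonal operator $\mathbf A^*(x_0)x=\frac{[D-1]_q}{q-q^{-1}}\Big(\frac{[D]_q}{[k]_q[D-k]_q}q^{D+2(\dim(x\cap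 x_0)-k)}-\frac{q^k}{[D-k]_q}-\frac{q^{D-k}}{[k]_q}\Big)x$, and the Terwilliger algebra $\mathbf T(x_0)$ is the subalgebra of $\operatorname{End}(\mathbb C^{\mathcal L_k(\Omega)})$ generated by $\mathbf A$ and $\mathbf A^*(x_0)$. For a vector space $V$ and $m\ge1$, $m\cdot V$ is the direct sum of $m$ copies of $V$. $\mathbf P(k)$ is the set of $(h,i,j)\in\mathbb Z^3$ with $0\le h\le\min\{D-k,k\}$, $0\le i\le\frac{D-k-h}{2}$, $0\le j\le\min\{D-k-h-i,\,k-h-i,\,\frac{k-h}{2}\}$. $\mathbf P^{(0)}(k)$ is the set of $(h,i,j)\in\mathbf P(k)$ with $\min\{D-k-i,k-j\}=h+\max\{i,j\}$. $\mathbf P^{(0)}_{\rm II}(k)=\{(h,i,j)\in\mathbf P^{(0)}(k):0\le i-j\le D-2k\}$ and $\mathbf P^{(0)}_{\rm III}(k)=\{(h,i,j)\in\mathbf P^{(0)}(k):i-j>D-2k\}$. *)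

(* Defs.v *)
From HB Require Import structures.
From mathcomp Require Import all_boot all_order all_algebra.
Set Implicit Arguments. Unset Strict Implicit. Unset Printing Implicit Defensive.
Import Order.TTheory GRing.Theory Num.Theory.

(* Omega = 'rV[F]_D ; a subspace of Omega is represented by its
   canonical row-space matrix <<A>>%MS (so subspaces <-> matrices A with <<A>> = A). *)

Local Open Scope ring_scope.

Section Grassmann.
Variables (F : finFieldType) (D k : nat).

Definition Lk : {set 'M[F]_D} :=
  [set A : 'M[F]_D | (<<A>>%MS == A) && (\rank A == k)].

Definition dimI (x y : 'M[F]_D) : nat := \rank (x :&: y)%MS.

Definition nV := #|Lk|.

Definition vtx (i : 'I_nV) : 'M[F]_D := enum_val i.

Variable C : numClosedFieldType.

Definition qq : C := sqrtC (#|F|%:R).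

Definition qnum (n : nat) : C := (qq ^+ n - qq ^- n) / (qq - qq^-1).

Definition adjA : 'M[C]_nV :=
  \matrix_(i, j) (dimI (vtx i) (vtx j) == k.-1)%:R.

Definition dualval (d : nat) : C :=
  qnum D.-1 / (qq - qq^-1) *
  (qnum D / (qnum k * qnum (D - k)) * qq ^ (D%:Z + 2 * (d%:Z - k%:Z))
   - qq ^+ k / qnum (D - k) - qq ^+ (D - k) / qnum k).

Definition dualA (x0 : 'M[F]_D) : 'M[C]_nV :=
  \matrix_(i, j) ((i == j)%:R * dualval (dimI (vtx i) x0)).

Definition word (x0 : 'M[F]_D) (w : seq bool) : 'M[C]_nV :=
  foldr (fun b M => (if b then adjA else dualA x0) *m M) 1%:M w.

(* the Terwilliger algebra T(x0): the (unital) subalgebra of End(C^{L_k})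
   generated by A and A^*(x0), i.e. the C-span of all words in A, A^*(x0) *)
Definition Terw (x0 : 'M[F]_D) (M : 'M[C]_nV) : Prop :=
  exists (s : seq (seq bool)) (c : seq C),
    M = \sum_(i < size s) c`_i *: word x0 (nth [::] s i).

End Grassmann.

(* Block-diagonal algebra  (+)_{n in ns} End(C^n)  realized inside 'M_(sumn ns) *)
Fixpoint blk (ns : seq nat) (r : nat) : nat :=
  if ns is n :: ns' then (if r < n then 0 else (blk ns' (r - n)).+1)%N else 0%N.

Definition blockdiag (C : numClosedFieldType) (ns : seq nat) (M : 'M[C]_(sumn ns)) : Prop :=
  forall r c : 'I_(sumn ns), blk ns r != blk ns c -> M r c = 0.

Definition alg_iso (C : numClosedFieldType) (n m : nat)
    (S : 'M[C]_n -> Prop) (T : 'M[C]_m -> Prop) : Prop :=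
  exists f : 'M[C]_n -> 'M[C]_m,
    [/\ forall a x y, S x -> S y -> f (a *: x + y) = a *: f x + f y,
        forall x y, S x -> S y -> f (x *m y) = f x *m f y,
        f 1%:M = 1%:M
      & [/\ forall x, S x -> T (f x),
             forall x y, S x -> S y -> f x = f y -> x = y
           & forall z, T z -> (exists2 x, S x & f x = z)]].

Definition inP (D k h i j : nat) : bool :=
  [&& (h <= minn (D - k) k)%N,
      (2 * i%:Z <= D%:Z - k%:Z - h%:Z)%R,
      (j%:Z <= D%:Z - k%:Z - h%:Z - i%:Z)%R,
      (j%:Z <= k%:Z - h%:Z - i%:Z)%R &
      (2 * j%:Z <= k%:Z - h%:Z)%R].

Definition Pk (D k : nat) : seq (nat * nat * nat) :=
  [seq t <- flatten [seq [seq (h, i, j) | i <- iota 0 D.+1, j <- iota 0 D.+1]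
                    | h <- iota 0 D.+1]
     | inP D k t.1.1 t.1.2 t.2].

Definition minT (D k i j : nat) : int := Num.min (D%:Z - k%:Z - i%:Z) (k%:Z - j%:Z).

Definition inP0 (D k h i j : nat) : bool :=
  inP D k h i j && (minT D k i j == h%:Z + (maxn i j)%:Z).

Definition inP0II (D k h i j : nat) : bool :=
  inP0 D k h i j && ((0 <= i%:Z - j%:Z) && (i%:Z - j%:Z <= D%:Z - 2 * k%:Z))%R.

Definition inP0III (D k h i j : nat) : bool :=
  inP0 D k h i j && (D%:Z - 2 * k%:Z < i%:Z - j%:Z)%R.

(* the size  min{D-k-i,k-j} - max{i,j} - h + 1  (positive on P(k)) *)
Definition bsize (D k h i j : nat) : nat :=
  absz (minT D k i j - (maxn i j)%:Z - h%:Z + 1).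

Definition sizes_i (D k : nat) : seq nat :=
  nseq (k./2).+1 1%N ++
  [seq bsize D k t.1.1 t.1.2 t.2 | t <- Pk D k
     & ~~ (inP0II D k t.1.1 t.1.2 t.2 || inP0III D k t.1.1 t.1.2 t.2)].

Definition sizes_ii (D : nat) : seq nat :=
  flatten [seq flatten [seq nseq i.+1 (D./2 - h - 2 * i).+1
                        | i <- iota 0 ((D - 2 * h) %/ 4).+1]
          | h <- iota 0 (D./2).+1].

(* Main.v *)
(** Put [W = x_0] and let [Q] be the order of the field. The functions on the set of all subspaces
of the ambient space carry two raising operators, enlarging a subspace by one dimension inside
[W] or modulo [W], and their transposes. These satisfy q-commutation relations, and on [L_k] the
adjacency operator is a polynomial in them. A normalised commutator is central; on nonzero
vectors its eigenvalues are the [Q ^- h], and [0 <= h] because it is an l^1-contraction. A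
lowest-weight vector of type [(h, i, j)] generates a module on whose [L_k]-part [A] is
irreducible tridiagonal and [A^*] diagonal with distinct eigenvalues. Such modules span
everything, since the lowering operators are the transposes of the raising ones and all matrices
are real. Every type occurs: sum a function of a non-degenerate linear functional over the orbit
of a coordinate subspace under a unipotent group. Two modules are isomorphic iff they have the
same weights and the same diagonal of [A], which happens exactly for the one-dimensional modules
of types II and III when [2 k < D], and for [(h, i, j)], [(h, j, i)] when [2 k = D]. Finally,
tridiagonal/diagonal pairs that are pairwise non-isomorphic generate the full block-diagonal
algebra, because Lagrange interpolation in [A^*] isolates the weights and polynomials in the
diagonal entries of [A] then isolate the blocks. *)
Require Import Defs.
From HB Require Import structures.
From mathcomp Require Import all_boot all_order all_algebra.
From mathcomp Require Import fingroup perm mxabelem.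
From mathcomp Require Import zify ring.
From Stdlib Require Import Classical_Prop.
Import Order.TTheory GRing.Theory Num.Theory.
Local Open Scope ring_scope.
Set Implicit Arguments. Unset Strict Implicit. Unset Printing Implicit Defensive.

(** * Algebras generated by tridiagonal pairs of matrices *)

(** Multiplicities are never computed. The isomorphism is [M |-> G *m M *m pinvmx G], the rows of
    [G] spanning one module of each class; it is injective because a combination of words that
    vanishes on the model vanishes on every module of every listed class. All dimensions are used at
    once since the commutation relations link neighbouring ones; [A] itself is recovered by stepping
    down to a hyperplane and up again. The central element needs no spectral theorem: on
    lowest-weight vectors the string formulas yield a polynomial with distinct roots that kills it.
    The explicit vector of the existence part is not shown to be an eigenvector. It is of lowest
    weight and both its strings stop early enough; its eigencomponents inherit this, and the two
    bounds squeeze their type to exactly [(h, i, j)]. The separate [k./2 + 1] summands are the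
    classes of type II, one for each [j] with [2 * j <= k], represented by [(k - 2 * j, j, j)]. A
    module of type III is isomorphic to a one-dimensional one with [i < j], which has its own
    summand. *)

Fixpoint blk_off (ns : seq nat) (r : nat) : nat :=
  if ns is n :: ns' then (if r < n then r else blk_off ns' (r - n))%N else r.

Definition blk_idx (ns : seq nat) (b o : nat) : nat := (sumn (take b ns) + o)%N.

Lemma blk_bounds ns r : (r < sumn ns)%N ->
  [/\ (blk ns r < size ns)%N, (blk_off ns r < nth 0%N ns (blk ns r))%N
    & blk_idx ns (blk ns r) (blk_off ns r) = r].
Proof.
rewrite /blk_idx; elim: ns r => [|n ns IH] r //=; rewrite -/(sumn ns) => Hr.
case: (ltnP r n) => [lt_rn|le_nr] /=; first by split; lia.
have [|H1 H2 H3] := IH (r - n)%N; first lia.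
split=> //; lia.
Qed.

Lemma blk_idxK ns b o : (b < size ns)%N -> (o < nth 0%N ns b)%N ->
  [/\ (blk_idx ns b o < sumn ns)%N, blk ns (blk_idx ns b o) = b
    & blk_off ns (blk_idx ns b o) = o].
Proof.
rewrite /blk_idx; elim: ns b => [|n ns IH] [|b] //=; rewrite -/(sumn ns) => Hb Ho.
  by rewrite add0n Ho ltn_addr.
have [H1 H2 H3] := IH b Hb Ho.
rewrite -/(sumn (take b ns)).
have Hn : (n + sumn (take b ns) + o < n)%N = false by lia.
have Hm : (n + sumn (take b ns) + o - n = sumn (take b ns) + o)%N by lia.
rewrite Hn Hm H2 H3; split=> //; lia.
Qed.

Section Words.
Variables (C : fieldType) (n : nat).
Implicit Types (A B M : 'M[C]_n) (l : seq (C * seq bool)).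

Definition gword A B (w : seq bool) : 'M[C]_n :=
  foldr (fun b M => (if b then A else B) *m M) 1%:M w.

Definition wcomb A B l : 'M[C]_n := \sum_(p <- l) p.1 *: gword A B p.2.

(** Has the shape of [Terw], so that the Terwilliger algebra is an instance by conversion. [gspanP]
    turns the two lists into one list of pairs, where products are easy to write. *)
Definition gspan A B M : Prop :=
  exists (s : seq (seq bool)) (c : seq C),
    M = \sum_(i < size s) c`_i *: gword A B (nth [::] s i).

Lemma gspanP A B M : gspan A B M <-> exists l, M = wcomb A B l.
Proof.
split=> [[s [c ->]]|[l ->]].
  exists [seq (c`_i, nth [::] s i) | i <- iota 0 (size s)].
  by rewrite /wcomb big_map -(big_mkord xpredT (fun i => c`_i *: gword A B (nth [::] s i)))
    /index_iota subn0.
exists (map snd l), (map fst l); rewrite /wcomb (big_nth (0, [::])) big_mkord size_map.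
by apply: eq_bigr => i _; rewrite (nth_map (0, [::])) // (nth_map (0, [::])).
Qed.

Lemma gword_cat A B w1 w2 : gword A B (w1 ++ w2) = gword A B w1 *m gword A B w2.
Proof. by elim: w1 => [|b w IH] /=; rewrite ?mul1mx // IH mulmxA. Qed.

Lemma wcomb_add A B l1 l2 : wcomb A B (l1 ++ l2) = wcomb A B l1 + wcomb A B l2.
Proof. by rewrite /wcomb big_cat. Qed.

Lemma wcomb_scale A B a l :
  wcomb A B [seq (a * p.1, p.2) | p <- l] = a *: wcomb A B l.
Proof.
by rewrite /wcomb big_map scaler_sumr; apply: eq_bigr => p _; rewrite scalerA.
Qed.

Lemma wcomb_mul A B l1 l2 :
  wcomb A B [seq (p.1 * r.1, p.2 ++ r.2) | p <- l1, r <- l2]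
  = wcomb A B l1 *m wcomb A B l2.
Proof.
rewrite /wcomb big_allpairs_dep mulmx_suml; apply: eq_bigr => p _.
rewrite mulmx_sumr; apply: eq_bigr => r _ /=.
by rewrite gword_cat -scalemxAl -scalemxAr scalerA.
Qed.

Lemma wcomb_w A B w : wcomb A B [:: (1, w)] = gword A B w.
Proof. by rewrite /wcomb big_seq1 scale1r. Qed.

End Words.

Lemma wcomb_intertwine (C : fieldType) n m (G : 'M[C]_(m, n)) A B A' B' l :
  G *m A = A' *m G -> G *m B = B' *m G -> G *m wcomb A B l = wcomb A' B' l *m G.
Proof.
move=> HA HB; rewrite /wcomb mulmx_suml mulmx_sumr; apply: eq_bigr => p _.
rewrite -scalemxAl -scalemxAr; congr (_ *: _).
elim: p.2 => [|b w IH] /=; first by rewrite mul1mx mulmx1.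
by case: b; rewrite mulmxA ?HA ?HB -[LHS]mulmxA IH mulmxA.
Qed.

Section ChainAlgebra.

Variables (C : numClosedFieldType) (n kmax : nat) (A B : 'M[C]_n) (delta : nat -> C).
Variables (K : eqType) (klo klen : K -> nat) (kal kbe : K -> nat -> C).

(* [kal] and [kbe] are the diagonal and subdiagonal of the tridiagonal matrix of [A], indexed
   by the weight [klo t + m]; the superdiagonal is normalised to 1. *)
Definition chain (t : K) (e : nat -> 'rV[C]_n) : Prop :=
  forall m, (m < klen t)%N ->
    e m *m B = delta (klo t + m) *: e m /\
    e m *m A = (if (m.+1 < klen t)%N then e m.+1 else 0) + kal t (klo t + m) *: e m
               + (if m is m'.+1 then kbe t (klo t + m') *: e m' else 0).

Definition tri (t : K) (m m' : nat) : C :=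
  if m' == m.+1 then 1 else if m' == m then kal t (klo t + m)
  else if m'.+1 == m then kbe t (klo t + m') else 0.

Lemma tri_nxt t o : tri t o o.+1 = 1.
Proof. by rewrite /tri eqxx. Qed.

Lemma tri_diag t o : tri t o o = kal t (klo t + o).
Proof. by rewrite /tri eqxx (_ : (o == o.+1) = false) //; lia. Qed.

Lemma tri_prv t o : tri t o.+1 o = kbe t (klo t + o).
Proof.
have E2 : (o == o.+2) = false by apply/eqP; lia.
have E1 : (o == o.+1) = false by apply/eqP; lia.
by rewrite /tri E2 E1 eqxx.
Qed.

Variables (t0 : K) (ts : seq K).
Hypothesis uniq_ts : uniq ts.
Hypothesis ts_sep : forall t t', t \in ts -> t' \in ts -> klo t = klo t' -> klen t = klen t' ->
  (forall m, (m < klen t)%N -> kal t (klo t + m) = kal t' (klo t + m)) -> t = t'.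
Hypothesis kbe_neq0 : forall t m, t \in ts -> (m.+1 < klen t)%N -> kbe t (klo t + m) != 0.
Hypothesis kmaxP : forall t m, t \in ts -> (m < klen t)%N -> (klo t + m <= kmax)%N.
Hypothesis delta_inj : forall a b, (a <= kmax)%N -> (b <= kmax)%N -> delta a = delta b -> a = b.
Hypothesis chain_ex : forall t, t \in ts ->
  exists e, chain t e /\ forall m, (m < klen t)%N -> e m != 0.
(** Ranges over all chains of each listed type, not only one chosen chain per type; this is what
    absorbs the multiplicities. *)
Hypothesis chain_full : forall Z : 'M[C]_n,
  (forall t e m, t \in ts -> chain t e -> (m < klen t)%N -> e m *m Z = 0) -> Z = 0.

Let ns := map klen ts.
Let m := sumn ns.
Let bk (r : 'I_m) := blk ns r.
Let off (r : 'I_m) := blk_off ns r.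
Let kd (r : 'I_m) := nth t0 ts (bk r).
Let wgt (r : 'I_m) := (klo (kd r) + off r)%N.

Let bk_lt r : (bk r < size ts)%N.
Proof. by have [] := blk_bounds (ltn_ord r); rewrite size_map. Qed.

Let kd_in r : kd r \in ts.
Proof. exact: mem_nth. Qed.

Let off_lt r : (off r < klen (kd r))%N.
Proof. by have [_ + _] := blk_bounds (ltn_ord r); rewrite -/(bk r) (nth_map t0 0%N klen (bk_lt r)). Qed.

Let idx_inj r r' : bk r = bk r' -> off r = off r' -> r = r'.
Proof.
move=> Hb Ho; apply: val_inj => /=.
have [_ _ Hr] := blk_bounds (ltn_ord r); have [_ _ Hr'] := blk_bounds (ltn_ord r').
by rewrite -Hr -Hr' -/(bk r) -/(bk r') -/(off r) -/(off r') Hb Ho.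
Qed.

Let idxK b o : (b < size ts)%N -> (o < klen (nth t0 ts b))%N ->
  [/\ (blk_idx ns b o < m)%N, blk ns (blk_idx ns b o) = b & blk_off ns (blk_idx ns b o) = o].
Proof. by move=> Hb Ho; apply: blk_idxK; rewrite ?size_map // (nth_map t0). Qed.

Let idx_ex b o : (b < size ts)%N -> (o < klen (nth t0 ts b))%N ->
  exists r : 'I_m, bk r = b /\ off r = o.
Proof.
move=> Hb Ho.
have [H1 H2 H3] := idxK Hb Ho.
by exists (Ordinal H1).
Qed.

Let kd_inj r r' : kd r = kd r' -> bk r = bk r'.
Proof. by move/eqP; rewrite nth_uniq // => /eqP. Qed.

Let bigA : 'M[C]_m := \matrix_(r, c) (if bk r == bk c then tri (kd r) (off r) (off c) else 0).
Let bigB : 'M[C]_m := diag_mx (\row_r delta (wgt r)).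

Let rows (e : nat -> nat -> 'rV[C]_n) : 'M[C]_(m, n) := \matrix_r e (bk r) (off r).

(** The chains may vanish: [wcomb_inj] applies this with every block but one equal to zero. *)
Let rows_intertwine e : (forall b, (b < size ts)%N -> chain (nth t0 ts b) (e b)) ->
  rows e *m A = bigA *m rows e /\ rows e *m B = bigB *m rows e.
Proof.
move=> He; split; apply/row_matrixP => r; rewrite !row_mul rowK.
  have [_ ->] := He _ (bk_lt r) _ (off_lt r).
  rewrite mulmx_sum_row.
  pose F (o : nat) := tri (kd r) (off r) o *: e (bk r) o.
  have -> : \sum_i row r bigA 0 i *: row i (rows e) = \sum_(o < klen (kd r)) F o.
    rewrite (bigID (fun i => bk i == bk r)) /= [X in _ + X]big1 ?addr0; last first.
      by move=> i /negPf Hi; rewrite !mxE eq_sym Hi scale0r.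
    have h0 (o : 'I_(klen (kd r))) : (blk_idx ns (bk r) o < m)%N.
      by have [] := idxK (bk_lt r) (ltn_ord o).
    rewrite (reindex_omap (fun o => Ordinal (h0 o))
      (fun i => insub (off i) : option 'I_(klen (kd r)))) /=; last first.
      move=> i /eqP Hi; rewrite insubT /=; first by rewrite /kd -Hi; apply: off_lt.
      move=> Hlt; congr Some; apply: val_inj => /=; rewrite -Hi.
      by have [_ _] := blk_bounds (ltn_ord i).
    apply: eq_big => [o|o /andP[/eqP Ho _]].
      have [_ H2 H3] := idxK (bk_lt r) (ltn_ord o).
      rewrite /bk /off /= in H2 H3 *; rewrite H2 eqxx H3 /=; apply/eqP.
      exact: valK.
    have [_ H2 H3] := idxK (bk_lt r) (ltn_ord o).
    by rewrite !mxE Ho eqxx rowK Ho /F /off /= H3.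
  rewrite -(big_mkord xpredT F).
  have Hr := off_lt r; move: (off r) (klen (kd r)) @F Hr => o L F Hr.
  have HF o' : F o' = (if o' == o.+1 then e (bk r) o.+1 else 0)
     + (if o' == o then kal (kd r) (klo (kd r) + o) *: e (bk r) o else 0)
     + (if o'.+1 == o then kbe (kd r) (klo (kd r) + o') *: e (bk r) o' else 0).
    rewrite /F /tri; case: eqP => [->|_].
      have -> : (o.+1 == o) = false by lia.
      have -> : (o.+2 == o) = false by lia.
      by rewrite scale1r !addr0.
    case: eqP => [->|_]; last by case: ifP; rewrite ?scale0r ?add0r ?addr0.
    have -> : (o.+1 == o) = false by lia.
    by rewrite add0r addr0.
  under eq_bigr do rewrite HF.
  rewrite !big_split /= -!big_mkcond /=; congr (_ + _ + _).
  - case: ifP => Ho; last first.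
      by rewrite big_nat_cond big1 // => i /andP[/andP[_ Hi] /eqP Hi']; lia.
    by rewrite big_nat1_eq /= Ho.
  - by rewrite big_nat1_eq /= Hr.
  - case: o Hr {F HF} => [|o'] Hr; first by rewrite big_pred0.
    under eq_bigl do rewrite eqSS.
    by rewrite big_nat1_eq /= ltnW.
have [-> _] := He _ (bk_lt r) _ (off_lt r).
by rewrite row_diag_mx mxE -scalemxAl -rowE rowK.
Qed.


Let T (N : 'M[C]_m) : Prop := exists l, N = wcomb bigA bigB l.

Let TD N N' : T N -> T N' -> T (N + N').
Proof. by move=> [l ->] [l' ->]; exists (l ++ l'); rewrite wcomb_add. Qed.

Let TZ a N : T N -> T (a *: N).
Proof. by move=> [l ->]; exists [seq (a * p.1, p.2) | p <- l]; rewrite wcomb_scale. Qed.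

Let TM N N' : T N -> T N' -> T (N *m N').
Proof.
by move=> [l ->] [l' ->]; exists [seq (p.1 * r.1, p.2 ++ r.2) | p <- l, r <- l']; rewrite wcomb_mul.
Qed.

Let T1 : T 1%:M.
Proof. by exists [:: (1, [::])]; rewrite wcomb_w. Qed.

Let TA : T bigA.
Proof. by exists [:: (1, [:: true])]; rewrite wcomb_w /= mulmx1. Qed.

Let TB : T bigB.
Proof. by exists [:: (1, [:: false])]; rewrite wcomb_w /= mulmx1. Qed.

Let T0 : T 0.
Proof. by exists [::]; rewrite /wcomb big_nil. Qed.

Let Tsum I (r : seq I) (P : pred I) (F : I -> 'M[C]_m) :
  (forall i, P i -> T (F i)) -> T (\sum_(i <- r | P i) F i).
Proof. by move=> HF; elim/big_ind: _. Qed.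

Let dg (f : 'I_m -> C) : 'M[C]_m := diag_mx (\row_r f r).

(** The functions on the index set that the algebra realises as diagonal matrices. Once all
    indicator functions are reached, they cut matrix units out of [bigA]. *)
Let D (f : 'I_m -> C) : Prop := T (dg f).

Let D_ext f g : f =1 g -> D f -> D g.
Proof.
by move=> Hfg; rewrite /D /dg => Hf; congr (T (diag_mx _)) : Hf; apply/rowP => i; rewrite !mxE Hfg.
Qed.

Let DM f g : D f -> D g -> D (fun r => f r * g r).
Proof.
move=> Hf Hg; have := TM Hf Hg; rewrite /dg mulmx_diag /D /dg.
by congr (T (diag_mx _)); apply/rowP => i; rewrite !mxE.
Qed.

Let D_affine f a b : D f -> D (fun r => a * f r + b).
Proof.
move=> Hf; have := TD (TZ a Hf) (TZ b T1); rewrite /D.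
congr T; apply/matrixP => i j; rewrite !mxE; case: eqP => _ /=; rewrite ?mulr1n ?mulr0n //; ring.
Qed.

Let D1 : D (fun=> 1).
Proof.
have := T1; rewrite /D; congr T; apply/matrixP => i j; rewrite !mxE.
by case: eqP.
Qed.

Let Ddelta : D (fun r => delta (wgt r)).
Proof. exact: TB. Qed.

Let wgt_max r : (wgt r <= kmax)%N.
Proof. exact: kmaxP. Qed.

Let D_wgt w : (w <= kmax)%N -> D (fun r => (wgt r == w)%:R).
Proof.
move=> Hw.
have [f [Df f1 f0]] : exists f, [/\ D f, forall r, wgt r = w -> f r = 1 &
    forall r, wgt r \in [seq x <- iota 0 kmax.+1 | x != w] -> f r = 0].
  have : w \notin [seq x <- iota 0 kmax.+1 | x != w] by rewrite mem_filter eqxx.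
  have : all (leq^~ kmax) [seq x <- iota 0 kmax.+1 | x != w].
    by apply/allP => x; rewrite mem_filter mem_iota; lia.
  elim: [seq _ <- _ | _] => [|x s IH] /=; first by exists (fun=> 1); split.
  rewrite in_cons negb_or => /andP[Hx Hs] /andP[Hwx Hw'].
  have [f [Df f1 f0]] := IH Hs Hw'.
  have Hne : delta w - delta x != 0.
    by rewrite subr_eq0; apply: contra Hwx => /eqP /(delta_inj Hw Hx) ->.
  (* The Lagrange factor [(delta (wgt r) - delta x) / (delta w - delta x)], written in the affine
     form that [D_affine] accepts. *)
  exists (fun r => f r * ((delta w - delta x)^-1 * delta (wgt r) + (- (delta x / (delta w - delta x))))); split.
  - by apply: DM => //; apply: D_affine.
  - by move=> r Hr; rewrite f1 // Hr; field.
  - move=> r; rewrite in_cons => /orP[/eqP ->|/f0 ->]; last by rewrite mul0r.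
    by rewrite [_^-1 * _]mulrC subrr mulr0.
apply: D_ext Df => r /=; case: eqP => [/f1 -> //|/eqP Hr].
by apply: f0; rewrite mem_filter Hr mem_iota /= add0n ltnS.
Qed.

Let bigAE r c : bigA r c = if bk r == bk c then tri (kd r) (off r) (off c) else 0.
Proof. by rewrite mxE. Qed.

Let kd_bk r c : bk r = bk c -> kd r = kd c.
Proof. by rewrite /kd => ->. Qed.

Let nxt r c := (bk r == bk c) && (off c == (off r).+1).

Let nxt_ex r : ((off r).+1 < klen (kd r))%N -> exists c, nxt r c.
Proof.
by move=> H; have [c [H1 H2]] := idx_ex (bk_lt r) H; exists c; rewrite /nxt H1 H2 !eqxx.
Qed.

Let nxt_bd r c : nxt r c -> ((off r).+1 < klen (kd r))%N.
Proof. by move=> /andP[/eqP H1 /eqP <-]; rewrite (kd_bk H1) off_lt. Qed.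

Let prv_ex r : (0 < off r)%N -> exists c, nxt c r.
Proof.
move=> H; have H' : ((off r).-1 < klen (kd r))%N by have := off_lt r; lia.
by have [c [H1 H2]] := idx_ex (bk_lt r) H'; exists c; rewrite /nxt H1 H2 eqxx prednK ?eqxx.
Qed.

Let nxt_wgt r c : nxt r c -> wgt c = (wgt r).+1.
Proof. by move=> /andP[/eqP H1 /eqP H2]; rewrite /wgt (kd_bk H1) H2 addnS. Qed.

Let bigA_nxt r c : nxt r c -> bigA r c = 1.
Proof. by move=> /andP[H1 /eqP H2]; rewrite bigAE H1 H2 tri_nxt. Qed.

Let bigA_prv r c : nxt r c -> bigA c r = kbe (kd r) (wgt r).
Proof.
move=> /andP[/eqP H1 /eqP H2]; by rewrite bigAE H1 eqxx H2 -(kd_bk H1) tri_prv.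
Qed.

Let bigA_wgtS r c : wgt c = (wgt r).+1 -> ~~ nxt r c -> bigA r c = 0 /\ bigA c r = 0.
Proof.
move=> Hw; rewrite /nxt !bigAE [bk c == _]eq_sym; case: eqP => [H|] //= Hn.
have Ho : off c = (off r).+1 by move: Hw; rewrite /wgt (kd_bk H); lia.
by rewrite Ho eqxx in Hn.
Qed.

Let bigA_diag r c : wgt c = wgt r -> bigA r c = (r == c)%:R * kal (kd r) (wgt r).
Proof.
move=> Hw; rewrite bigAE; case: eqP => [H|H]; last first.
  by case: eqP => [E|_]; rewrite ?mul0r //; case: H; rewrite E.
have Ho : off c = off r by move: Hw; rewrite /wgt (kd_bk H); lia.
by rewrite (idx_inj H (esym Ho)) eqxx mul1r tri_diag.
Qed.

Let nxt_injl x y z : nxt x y -> nxt z y -> x = z.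
Proof.
move=> /andP[/eqP H1 /eqP H2] /andP[/eqP H3 /eqP H4]; apply: idx_inj; first by rewrite H1.
by apply: succn_inj; rewrite -H2.
Qed.

Let nxt_injr x y z : nxt x y -> nxt x z -> y = z.
Proof.
move=> /andP[/eqP H1 /eqP H2] /andP[/eqP H3 /eqP H4]; apply: idx_inj; first by rewrite -H1.
by rewrite H2.
Qed.

Let mx_dgl f (M : 'M[C]_m) i j : (dg f *m M) i j = f i * M i j.
Proof. by rewrite mul_diag_mx !mxE. Qed.

Let mx_dgr f (M : 'M[C]_m) i j : (M *m dg f) i j = M i j * f j.
Proof. by rewrite mul_mx_diag !mxE. Qed.

Let dgE f i j : dg f i j = f i *+ (i == j).
Proof. by rewrite !mxE. Qed.

(** Compress [bigA f bigA] to weight [w] with a stop at weight [w'] in between. By the hypothesis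
    such a walk can only return to its starting index, so the compression is again diagonal. *)
Let D_loop w w' f : (w <= kmax)%N -> (w' <= kmax)%N ->
  (forall x y z, wgt x = w -> wgt y = w' -> wgt z = w -> x != z -> bigA x y * bigA y z = 0) ->
  D f -> D (fun x => (wgt x == w)%:R * \sum_(y | wgt y == w') bigA x y * f y * bigA y x).
Proof.
move=> Hw Hw' Hz Df.
have H1 : T (bigA *m (dg f *m dg (fun r => (wgt r == w')%:R)) *m bigA).
  by apply: TM => //; apply: TM => //; apply: TM; [|apply: D_wgt].
have := TM (TM (D_wgt Hw) H1) (D_wgt Hw); rewrite /D; congr T.
apply/matrixP => x z; rewrite mx_dgr mx_dgl dgE mxE.
have E y : (bigA *m (dg f *m dg (fun r => (wgt r == w')%:R))) x y * bigA y z
    = (wgt y == w')%:R * (f y * (bigA x y * bigA y z)).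
  rewrite mulmxA !mx_dgr; ring.
under eq_bigr do rewrite E.
case: (eqVneq x z) => [<-|Hxz].
  rewrite mulr1n; case: eqP => _; last by rewrite !mul0r.
  rewrite mulr1 mul1r mul1r [RHS]big_mkcond; apply: eq_bigr => y _.
  by case: eqP => _; rewrite ?mul0r ?mul1r //; ring.
rewrite mulr0n; case: eqP => Hx; last by rewrite !mul0r.
case: eqP => Hz'; last by rewrite mulr0.
rewrite big1 ?mulr0 ?mul0r // => y _; case: eqP => Hy; rewrite ?mul0r //.
by rewrite Hz ?mulr0 // -?Hz'.
Qed.

Let D_up w f : (w.+1 <= kmax)%N -> D f ->
  D (fun x => (wgt x == w)%:R * \sum_(y | wgt y == w.+1) bigA x y * f y * bigA y x).
Proof.
move=> Hw; apply: D_loop => //; first exact: ltnW.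
move=> x y z Hx Hy Hz Hxz.
have [H|H] := boolP (nxt x y); last by have [-> _] := bigA_wgtS (etrans Hy (congr1 S (esym Hx))) H; rewrite mul0r.
have [H'|H'] := boolP (nxt z y); first by rewrite (nxt_injl H H') eqxx in Hxz.
by have [_ ->] := bigA_wgtS (etrans Hy (congr1 S (esym Hz))) H'; rewrite mulr0.
Qed.

Let D_down w f : (w.+1 <= kmax)%N -> D f ->
  D (fun x => (wgt x == w.+1)%:R * \sum_(y | wgt y == w) bigA x y * f y * bigA y x).
Proof.
move=> Hw; apply: D_loop => //; first exact: ltnW.
move=> x y z Hx Hy Hz Hxz.
have [H|H] := boolP (nxt y x); last by have [_ ->] := bigA_wgtS (etrans Hx (congr1 S (esym Hy))) H; rewrite mul0r.
have [H'|H'] := boolP (nxt y z); first by rewrite (nxt_injr H H') eqxx in Hxz.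
by have [-> _] := bigA_wgtS (etrans Hz (congr1 S (esym Hy))) H'; rewrite mulr0.
Qed.

Let D_diag w : (w <= kmax)%N -> D (fun x => (wgt x == w)%:R * kal (kd x) (wgt x)).
Proof.
move=> Hw; have := TM (TM (D_wgt Hw) TA) (D_wgt Hw); rewrite /D; congr T.
apply/matrixP => x z; rewrite mx_dgr mx_dgl dgE.
case: (eqVneq (wgt x) w) => Hx; last by rewrite !mul0r mul0rn.
case: (eqVneq (wgt z) w) => Hz.
  by rewrite bigA_diag ?Hx ?Hz // !mul1r mulr1 mulr_natl.
by case: eqP => [E|_]; rewrite ?mulr0 // -E Hx eqxx in Hz *.
Qed.

Let up_val w f r r' : wgt r = w -> nxt r r' ->
  (wgt r == w)%:R * (\sum_(y | wgt y == w.+1) bigA r y * f y * bigA y r) = kbe (kd r) w * f r'.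
Proof.
move=> Hr Hn; rewrite Hr eqxx mul1r (bigD1 r') /=; last by rewrite (nxt_wgt Hn) Hr.
rewrite big1 ?addr0; first by rewrite (bigA_nxt Hn) (bigA_prv Hn) Hr; ring.
move=> y /andP[/eqP Hy Hyr]; have H : ~~ nxt r y.
  by apply: contra Hyr => H; rewrite (nxt_injr H Hn).
by have [-> _] := bigA_wgtS (etrans Hy (congr1 S (esym Hr))) H; rewrite !mul0r.
Qed.

Let up_val0 w f r : wgt r = w -> (forall r', ~~ nxt r r') ->
  (wgt r == w)%:R * (\sum_(y | wgt y == w.+1) bigA r y * f y * bigA y r) = 0.
Proof.
move=> Hr Hn; rewrite big1 ?mulr0 // => y /eqP Hy.
by have [-> _] := bigA_wgtS (etrans Hy (congr1 S (esym Hr))) (Hn y); rewrite !mul0r.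
Qed.

Let down_val w f r r' : wgt r = w.+1 -> nxt r' r ->
  (wgt r == w.+1)%:R * (\sum_(y | wgt y == w) bigA r y * f y * bigA y r) = kbe (kd r') w * f r'.
Proof.
move=> Hr Hn; have Hw : wgt r' = w by apply: succn_inj; rewrite -Hr (nxt_wgt Hn).
rewrite Hr eqxx mul1r (bigD1 r') /= ?Hw //.
rewrite big1 ?addr0; first by rewrite (bigA_nxt Hn) (bigA_prv Hn) Hw; ring.
move=> y /andP[/eqP Hy Hyr]; have H : ~~ nxt y r.
  by apply: contra Hyr => H; rewrite (nxt_injl H Hn).
by have [_ ->] := bigA_wgtS (etrans Hr (congr1 S (esym Hy))) H; rewrite !mul0r.
Qed.

Let down_val0 w f r : wgt r = w.+1 -> (forall r', ~~ nxt r' r) ->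
  (wgt r == w.+1)%:R * (\sum_(y | wgt y == w) bigA r y * f y * bigA y r) = 0.
Proof.
move=> Hr Hn; rewrite big1 ?mulr0 // => y /eqP Hy.
by have [_ ->] := bigA_wgtS (etrans Hr (congr1 S (esym Hy))) (Hn y); rewrite !mul0r.
Qed.

Let kbe_nxt r r' : nxt r r' -> kbe (kd r) (wgt r) != 0.
Proof. by move=> H; apply: kbe_neq0 => //; apply: nxt_bd H. Qed.

(** Indices that the diagonal part of the algebra cannot tell apart. The relation spreads to
    neighbours in both directions, so two related blocks have equal weights and equal diagonals, and
    [ts_sep] identifies them. *)
Let sim r c := wgt r = wgt c /\ forall f, D f -> f r = f c.

Let sim_sym r c : sim r c -> sim c r.
Proof. by move=> [Hw H]; split=> [|f Df]; [|have := H f Df]. Qed.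

(** The loop of the constant function 1 compares the subdiagonal entries: the one at [r] is nonzero,
    so [c] must have a successor with the same entry. That common factor then cancels in the loop of
    an arbitrary [f]. *)
Let sim_up r c r' : sim r c -> nxt r r' -> exists2 c', nxt c c' & sim r' c'.
Proof.
move=> [Hw Hs] Hn.
have Hk : ((wgt r).+1 <= kmax)%N by rewrite -(nxt_wgt Hn).
have E1 := Hs _ (D_up Hk D1); rewrite (up_val _ _ Hn) // in E1.
have [c' Hc'|H0] := pickP (nxt c); last first.
  rewrite up_val0 // in E1; last by move=> x; rewrite H0.
  by have := kbe_nxt Hn; rewrite -[kbe _ _]mulr1 E1 eqxx.
rewrite (up_val _ _ Hc') // !mulr1 in E1.
exists c' => //; split; first by rewrite (nxt_wgt Hn) (nxt_wgt Hc') Hw.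
move=> f /(D_up Hk)/Hs; rewrite (up_val _ _ Hn) // (up_val _ _ Hc') // -E1.
by apply: mulfI; apply: kbe_nxt Hn.
Qed.

Let sim_down r c r' : sim r c -> nxt r' r -> exists2 c', nxt c' c & sim r' c'.
Proof.
move=> [Hw Hs] Hn.
have Hk : ((wgt r').+1 <= kmax)%N by rewrite -(nxt_wgt Hn).
have Hwr := nxt_wgt Hn; have Hwc : wgt c = (wgt r').+1 by rewrite -Hw.
have E1 := Hs _ (D_down Hk D1); rewrite (down_val _ _ Hn) // in E1.
have [c' Hc'|H0] := pickP (nxt^~ c); last first.
  rewrite down_val0 // in E1; last by move=> x; rewrite H0.
  by have := kbe_nxt Hn; rewrite -[kbe _ _]mulr1 E1 eqxx.
rewrite (down_val _ _ Hc') // !mulr1 in E1.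
exists c' => //; split; first by apply: succn_inj; rewrite -Hwr -(nxt_wgt Hc').
move=> f /(D_down Hk)/Hs; rewrite (down_val _ _ Hn) // (down_val _ _ Hc') // -E1.
by apply: mulfI; apply: kbe_nxt Hn.
Qed.

Let sim_kal r c : sim r c -> kal (kd r) (wgt r) = kal (kd c) (wgt r).
Proof.
move=> [Hw Hs]; have := Hs _ (D_diag (wgt_max r)).
by rewrite -Hw eqxx !mul1r.
Qed.

(** Each step down from [r] is matched by a step down from [c], so [c] is at least as far from the
    start of its block. *)
Let sim_off_le r c : sim r c -> (off r <= off c)%N.
Proof.
move: {2}(off r) (erefl (off r)) => p; elim: p r c => [|p IH] r c Hp Hs; first by rewrite Hp.
have [|r' Hr'] := @prv_ex r; first by rewrite Hp.
have [c' Hc' Hs'] := sim_down Hs Hr'.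
move: (Hr') (Hc') => /andP[_ /eqP E1] /andP[_ /eqP E2].
rewrite E1 E2 ltnS; apply: IH => //; lia.
Qed.

Let sim_len_le r c : sim r c -> (klen (kd r) - off r <= klen (kd c) - off c)%N.
Proof.
move: {2}(klen (kd r) - off r)%N (erefl (klen (kd r) - off r)%N) => p.
elim: p r c => [|p IH] r c Hp Hs; first by rewrite Hp.
have Hr := off_lt r; have Hc := off_lt c.
have [Hlt|Hge] := ltnP (off r).+1 (klen (kd r)); last by lia.
have [r' Hr'] := nxt_ex Hlt; have [c' Hc' Hs'] := sim_up Hs Hr'.
move: (Hr') (Hc') => /andP[/eqP E1 /eqP E2] /andP[/eqP E3 /eqP E4].
have := IH r' c'; rewrite -(kd_bk E1) -(kd_bk E3) E2 E4 => H.
have {}H := H _ Hs'; lia.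
Qed.

Let sim_kal_at r c : sim r c -> off r = off c -> forall r', bk r' = bk r ->
  kal (kd r) (wgt r') = kal (kd c) (wgt r').
Proof.
move=> Hs Ho r' Hb.
(* One of the two truncated differences is zero, so [d] is the distance between the offsets; the
   induction walks from [r] to [r'] and drags [c] along. *)
have [d Hd] : exists d, (d = off r - off r' + (off r' - off r))%N by exists (off r - off r' + (off r' - off r))%N.
elim: d r c Hd Hs Ho Hb => [|d IH] r c Hd Hs Ho Hb.
  have E : r = r' by apply: idx_inj => //; lia.
  by rewrite -E; apply: sim_kal.
have Hr := off_lt r'.
have [Hlt|Hge] := ltnP (off r) (off r').
  have [|r1 Hr1] := @nxt_ex r; first by rewrite -(kd_bk Hb); lia.
  have [c1 Hc1 Hs1] := sim_up Hs Hr1.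
  move: (Hr1) (Hc1) => /andP[/eqP E1 /eqP E2] /andP[/eqP E3 /eqP E4].
  by rewrite (kd_bk E1) (kd_bk E3); apply: IH => //; lia.
have [|r1 Hr1] := @prv_ex r; first by lia.
have [c1 Hc1 Hs1] := sim_down Hs Hr1.
move: (Hr1) (Hc1) => /andP[/eqP E1 /eqP E2] /andP[/eqP E3 /eqP E4].
by rewrite -(kd_bk E1) -(kd_bk E3); apply: IH => //; lia.
Qed.

Let sim_eq r c : sim r c -> r = c.
Proof.
move=> Hs; have Hs' := sim_sym Hs.
have Ho : off r = off c by apply/eqP; rewrite eqn_leq !sim_off_le.
have Hlo : klo (kd r) = klo (kd c) by case: Hs; rewrite /wgt Ho; lia.
have Hlen : klen (kd r) = klen (kd c).
  by have := sim_len_le Hs; have := sim_len_le Hs'; have := off_lt r; have := off_lt c; lia.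
apply: idx_inj => //; apply: kd_inj; apply: ts_sep => // p Hp.
have [r' [Hb Hr']] := idx_ex (bk_lt r) Hp.
have := sim_kal_at Hs Ho Hb; rewrite /wgt (kd_bk Hb) Hr' //.
Qed.

Let sep r c : r != c -> exists2 f, D f & f r != f c.
Proof.
move=> Hrc; case: (eqVneq (wgt r) (wgt c)) => Hw; last first.
  exists (fun x => delta (wgt x)) => //; apply: contra Hw => /eqP H; apply/eqP.
  exact: delta_inj.
(* Membership in the algebra is a mere [Prop], so a separating function is obtained classically from
   the failure of [sim]. *)
apply: NNPP => Hn; move/eqP: Hrc; apply; apply: sim_eq; split => // f Df.
by apply/eqP; apply: contra_notT Hn => H; exists f.
Qed.

Let D_delta r : D (fun x => (x == r)%:R).
Proof.
have [f [Df f1 f0]] : exists f, [/\ D f, f r = 1 & forall x, x \in [seq x <- enum 'I_m | x != r] -> f x = 0].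
  have : r \notin [seq x <- enum 'I_m | x != r] by rewrite mem_filter eqxx.
  elim: [seq _ <- _ | _] => [|x s IH] /=; first by exists (fun=> 1); split.
  rewrite in_cons negb_or => /andP[Hx /IH [f [Df f1 f0]]].
  have [g Dg Hg] := sep Hx; rewrite -subr_eq0 in Hg.
  exists (fun y => f y * ((g r - g x)^-1 * g y + (- (g x / (g r - g x))))); split.
  - by apply: DM => //; apply: D_affine.
  - by rewrite f1; field.
  - move=> y; rewrite in_cons => /orP[/eqP ->|/f0 ->]; last by rewrite mul0r.
    by rewrite [_^-1 * _]mulrC subrr mulr0.
apply: D_ext Df => x /=; case: eqP => [-> //|/eqP Hr].
by apply: f0; rewrite mem_filter Hr mem_enum.
Qed.

Let dg_delta r c (N : 'M[C]_m) : dg (fun x => (x == r)%:R) *m N *m dg (fun x => (x == c)%:R)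
  = N r c *: delta_mx r c.
Proof.
apply/matrixP => i j; rewrite mx_dgr mx_dgl !mxE.
by case: eqP => [->|_]; case: eqP => [->|_]; rewrite ?mul0r ?mulr0 ?mul1r ?mulr1.
Qed.

Let T_delta_nz r c (N : 'M[C]_m) : T N -> N r c != 0 -> T (delta_mx r c).
Proof.
move=> TN Hn; rewrite -[delta_mx _ _]scale1r -(mulVf Hn) -scalerA -dg_delta.
by apply: TZ; apply: TM; [apply: TM => //|]; apply: D_delta.
Qed.

Let T_delta r c : bk r = bk c -> T (delta_mx r c) /\ T (delta_mx c r).
Proof.
move=> Hb.
have [d Hd] : exists d, (d = off r - off c + (off c - off r))%N by exists (off r - off c + (off c - off r))%N.
have Tdd x : T (delta_mx x x).
  by apply: (T_delta_nz T1); rewrite mxE eqxx oner_eq0.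
have Tmul x y z : T (delta_mx x y) -> T (delta_mx y z) -> T (delta_mx x z).
  by move=> H1 H2; have := TM H1 H2; rewrite mul_delta_mx.
have Tn x y : nxt x y -> T (delta_mx x y) /\ T (delta_mx y x).
  move=> H; split; apply: (T_delta_nz TA); first by rewrite (bigA_nxt H) oner_eq0.
  by rewrite (bigA_prv H) (kbe_nxt H).
elim: d r Hd Hb => [|d IH] r Hd Hb.
  by have -> : r = c by apply: idx_inj => //; lia.
have [Hlt|Hge] := ltnP (off r) (off c).
  have [|r1 Hr1] := @nxt_ex r; first by rewrite (kd_bk Hb); have := off_lt c; lia.
  move: (Hr1) => /andP[/eqP E1 /eqP E2]; have [||H1 H2] := IH r1; [lia|by rewrite -E1|].
  by have [H3 H4] := Tn _ _ Hr1; split; [apply: Tmul H3 H1|apply: Tmul H2 H4].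
have [|r1 Hr1] := @prv_ex r; first lia.
move: (Hr1) => /andP[/eqP E1 /eqP E2]; have [||H1 H2] := IH r1; [lia|by rewrite E1|].
by have [H3 H4] := Tn _ _ Hr1; split; [apply: Tmul H4 H1|apply: Tmul H2 H3].
Qed.

Let T_blockdiag N : T N <-> @blockdiag C ns N.
Proof.
split=> [[l ->] r c Hrc|HN].
  rewrite /wcomb summxE big1 // => p _; rewrite mxE.
  suff -> : gword bigA bigB p.2 r c = 0 by rewrite mulr0.
  elim: p.2 r Hrc => [|b w IH] r Hrc /=.
    by rewrite mxE; case: eqP => // E; rewrite E eqxx in Hrc.
  rewrite mxE big1 // => x _; case: (eqVneq (blk ns r) (blk ns x)) => Hx.
    by rewrite IH ?mulr0 // -Hx.
  case: b; first by rewrite bigAE (negPf Hx) mul0r.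
  by rewrite mxE; case: eqP => [E|_]; rewrite ?mul0r // E eqxx in Hx *.
rewrite [N]matrix_sum_delta; apply: Tsum => r _; apply: Tsum => c _.
have [Hb|Hb] := eqVneq (bk r) (bk c); last by rewrite HN // scale0r.
by apply: TZ; have [] := T_delta Hb.
Qed.

Let chain0 t : chain t (fun=> 0).
Proof.
by move=> o _; rewrite !mul0mx !scaler0; split=> //; case: ifP; case: o => [|o]; rewrite ?scaler0 ?addr0.
Qed.

(** An arbitrary chain is put into the block of its type, with zero chains elsewhere. The resulting
    rows intertwine with the model, so both combinations act on them alike, and [chain_full]
    concludes. *)
Let wcomb_inj l l' : wcomb bigA bigB l = wcomb bigA bigB l' -> wcomb A B l = wcomb A B l'.
Proof.
move=> E; apply/eqP; rewrite -subr_eq0; apply/eqP; apply: chain_full => t e o Ht He Ho.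
pose b := index t ts.
pose eb (b' : nat) := if b' == b then e else (fun=> 0).
have Hb : (b < size ts)%N by rewrite index_mem.
have Htb : nth t0 ts b = t by rewrite nth_index.
have Heb b' : (b' < size ts)%N -> chain (nth t0 ts b') (eb b').
  by move=> _; rewrite /eb; case: eqP => [->|_]; [rewrite Htb|apply: chain0].
have [HA HB] := rows_intertwine Heb.
have [|r [Hr1 Hr2]] := @idx_ex b o Hb; first by rewrite Htb.
have -> : e o = row r (rows eb) by rewrite rowK Hr1 Hr2 /eb eqxx.
rewrite -row_mul mulmxBr !(wcomb_intertwine _ HA HB) E subrr.
by apply/rowP => x; rewrite !mxE.
Qed.

Theorem chain_alg_iso : alg_iso (gspan A B) (@blockdiag C ns).
Proof.
have /fin_all_exists [e He] : forall b : 'I_(size ts), exists e, chain (nth t0 ts b) e /\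
    forall o, (o < klen (nth t0 ts b))%N -> e o != 0.
  by move=> b; apply: chain_ex; apply: mem_nth.
pose e' (b : nat) := if insub b is Some b' then e b' else fun=> 0.
have He' b : (b < size ts)%N -> chain (nth t0 ts b) (e' b) /\
    forall o, (o < klen (nth t0 ts b))%N -> e' b o != 0.
  by rewrite /e'; case: insubP => [b' _ <- _|/negPf -> //]; apply: He.
have [HA HB] := rows_intertwine (fun b Hb => proj1 (He' b Hb)).
set G := rows e' in HA HB.
have HG l : G *m wcomb A B l = wcomb bigA bigB l *m G by exact: wcomb_intertwine.
(* The matrix unit at [r] is a combination of words and can be moved across [G]; a relation
   [x *m G = 0] therefore yields [x 0 r *: row r G = 0] for each single [r]. *)
have Gfree : row_free G.
  apply/inj_row_free => x Hx; apply/rowP => r; rewrite [RHS]mxE.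
  have [l Hl] : T (delta_mx r r) by have [] := T_delta (erefl (bk r)).
  have : x *m delta_mx r r *m G = 0.
    by rewrite Hl -mulmxA -HG mulmxA Hx mul0mx.
  have -> : x *m delta_mx r r *m G = x 0 r *: row r G.
    have -> : x *m delta_mx r r = x 0 r *: delta_mx 0 r.
      apply/rowP => c; rewrite !mxE (bigD1 r) //= big1 ?addr0; first by rewrite !mxE eqxx.
      by move=> y /negPf Hy; rewrite !mxE Hy mulr0.
    by rewrite -scalemxAl -rowE.
  move/eqP; rewrite scaler_eq0 rowK => /orP[/eqP -> //|/eqP H0].
  by have [_ /(_ (off r) (off_lt r))] := He' _ (bk_lt r); rewrite H0 eqxx.
have Hf l : G *m wcomb A B l *m pinvmx G = wcomb bigA bigB l.
  by rewrite HG -mulmxA mulmxVp // mulmx1.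
exists (fun M => G *m M *m pinvmx G); split.
- by move=> a x y _ _; rewrite mulmxDr mulmxDl -scalemxAr -scalemxAl.
- move=> x y /gspanP[l ->] /gspanP[l' ->].
  by rewrite -wcomb_mul !Hf wcomb_mul.
- by rewrite mulmx1 mulmxVp.
split.
- by move=> x /gspanP[l ->]; rewrite Hf; apply/T_blockdiag; exists l.
- by move=> x y /gspanP[l ->] /gspanP[l' ->]; rewrite !Hf; apply: wcomb_inj.
- move=> z /T_blockdiag [l ->]; exists (wcomb A B l); last exact: Hf.
  by apply/gspanP; exists l.
Qed.

End ChainAlgebra.

(** * Counting covers in the lattice of subspaces *)

Lemma card_unique (T : finType) (P : pred T) (t0 : T) : (forall t, P t -> t = t0) -> #|P| = P t0.
Proof.
move=> H; case E: (P t0).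
  rewrite /= -(card1 t0); apply: eq_card => t; rewrite !inE; apply/idP/eqP => [/H //|->//].
by apply: eq_card0 => t; apply/negP => Pt; have := H _ Pt => Et; rewrite Et unfold_in E in Pt.
Qed.

Section Subspaces.
Variables (F : finFieldType) (D : nat).

Definition subsp := {A : 'M[F]_D | <<A>>%MS == A}.

Lemma subsp_proof m (A : 'M[F]_(m, D)) : <<(<<A>>%MS)>>%MS == <<A>>%MS.
Proof. by rewrite genmx_id. Qed.

Definition mksub m (A : 'M[F]_(m, D)) : subsp := exist _ <<A>>%MS (subsp_proof A).

Lemma mksubE m (A : 'M[F]_(m, D)) : (val (mksub A) :=: A)%MS.
Proof. exact: genmxE. Qed.

Lemma subsp_eqmx (x y : subsp) : (val x :=: val y)%MS -> x = y.
Proof.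
move=> H; apply: val_inj; have /eqP <- := valP x; have /eqP <- := valP y.
exact: eq_genmx.
Qed.

Lemma subsp_eqP (x y : subsp) : (val x <= val y)%MS -> (val y <= val x)%MS -> x = y.
Proof. by move=> H1 H2; apply: subsp_eqmx; apply/eqmxP; rewrite H1 H2. Qed.

Definition dn (x : subsp) : nat := \rank (val x).

Lemma dn_mksub m (A : 'M[F]_(m, D)) : dn (mksub A) = \rank A.
Proof. by rewrite /dn mksubE. Qed.

Lemma subsp_eq_rank (x y : subsp) : (val x <= val y)%MS -> (dn y <= dn x)%N -> x = y.
Proof.
move=> H1 H2; apply: subsp_eqP => //.
by have := mxrank_leqif_sup H1; case=> _ <-; rewrite eqn_leq mxrankS.
Qed.

Definition cov (z x : subsp) := (val z <= val x)%MS && (dn x == (dn z).+1).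

Lemma card_submx (A : 'M[F]_D) : #|[pred u : 'rV[F]_D | (u <= A)%MS]| = (#|F| ^ \rank A)%N.
Proof. by rewrite -card_rowg; apply: eq_card => u; rewrite !inE. Qed.

Lemma rank_add_row (z : 'M[F]_D) (u : 'rV[F]_D) : ~~ (u <= z)%MS -> \rank (z + u)%MS = (\rank z).+1.
Proof.
move=> Hu; have H0 : u != 0 by apply: contraNneq Hu => ->; rewrite sub0mx.
have := mxrank_sum_cap z u; rewrite rank_rV H0.
suff -> : \rank (z :&: u)%MS = 0%N by lia.
apply/eqP; rewrite mxrank_eq0; apply: contraNT Hu => Hc.
have : \rank (z :&: u)%MS == \rank u.
  by rewrite eqn_leq mxrankS ?capmxSr // rank_rV H0 lt0n mxrank_eq0.
have [_ ->] := mxrank_leqif_sup (capmxSr z u).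
by rewrite sub_capmx => /andP[].
Qed.

(** Sort the vectors of [t] outside [z] by the subspace that they span together with [z]; each [y]
    collects [q ^ (dn z).+1 - q ^ dn z] of them. *)
Lemma card_atoms (z t : subsp) : (val z <= val t)%MS ->
  (#|[pred y | cov z y && (val y <= val t)%MS]| * (#|F| - 1) = #|F| ^ (dn t - dn z) - 1)%N.
Proof.
move=> Hzt; set q := #|F|; have q1 : (1 < q)%N by exact: card_finRing_gt1.
have Hr : (dn z <= dn t)%N by exact: mxrankS.
have q0 r : (0 < q ^ r)%N by rewrite expn_gt0 ltnW.
pose X := [pred u : 'rV[F]_D | (u <= val t)%MS && ~~ (u <= val z)%MS].
have HX : #|X| = (q ^ dn t - q ^ dn z)%N.
  rewrite -!card_submx -(@cardID _ [pred u | (u <= val z)%MS] [pred u | (u <= val t)%MS]).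
  have -> : #|[predI [pred u : 'rV_D | (u <= val t)%MS] & [pred u | (u <= val z)%MS]]|
      = #|[pred u : 'rV_D | (u <= val z)%MS]|.
    by apply: eq_card => u; rewrite !inE andb_idl // => /submx_trans; apply.
  by rewrite addKn; apply: eq_card => u; rewrite !inE andbC.
pose Y := [pred y | cov z y && (val y <= val t)%MS].
have HXY : #|X| = (#|Y| * (q ^ (dn z).+1 - q ^ dn z))%N.
  rewrite -sum1_card (partition_big (fun u => mksub (val z + u)%MS) Y) /=; last first.
    move=> u /andP[H1 H2]; rewrite /cov /dn !mksubE rank_add_row // eqxx.
    by rewrite addsmxSl addsmx_sub Hzt.
  rewrite -sum_nat_const; apply: eq_bigr => y /andP[/andP[Hy1 /eqP Hy2] Hy3].
  rewrite -Hy2 -!card_submx sum1_card.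
  rewrite -(@cardID _ [pred u | (u <= val z)%MS] [pred u | (u <= val y)%MS]).
  have -> : #|[predI [pred u : 'rV_D | (u <= val y)%MS] & [pred u | (u <= val z)%MS]]|
      = #|[pred u : 'rV_D | (u <= val z)%MS]|.
    by apply: eq_card => u; rewrite !inE andb_idl // => /submx_trans; apply.
  rewrite addKn; apply: eq_card => u; rewrite !inE.
  apply/idP/idP.
    move=> /andP[/andP[_ ->] /eqP <-]; rewrite mksubE; exact: addsmxSr.
  move=> /andP[Hu1 Hu2]; rewrite unfold_in /= inE Hu1 (submx_trans Hu2 Hy3) /=; apply/eqP.
  apply: subsp_eq_rank; first by rewrite mksubE addsmx_sub Hy1.
  by rewrite /dn mksubE rank_add_row // -Hy2.
have E : (#|Y| * (q - 1) * q ^ dn z = (q ^ (dn t - dn z) - 1) * q ^ dn z)%N.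
  rewrite -mulnA !mulnBl -expnS -expnD subnK // !mul1n -HXY HX //.
by apply/eqP; rewrite -(eqn_pmul2r (q0 (dn z))); apply/eqP.
Qed.

(** The orthogonal complement for the standard bilinear form, an inclusion-reversing involution; it
    turns counts of covers into counts of hyperplanes. *)
Definition dualsp (x : subsp) : subsp := mksub (kermx (val x)^T).

Lemma sub_dualsp m (A : 'M_(m, D)) x : (A <= val (dualsp x))%MS = (A *m (val x)^T == 0).
Proof. by rewrite mksubE; apply/sub_kermxP/eqP. Qed.

Lemma dualspS x y : (val x <= val y)%MS -> (val (dualsp y) <= val (dualsp x))%MS.
Proof.
move=> /submxP[M HM]; rewrite sub_dualsp HM trmx_mul mulmxA.
by have := sub_dualsp (val (dualsp y)) y; rewrite submx_refl => /esym/eqP ->; rewrite mul0mx.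
Qed.

Lemma dn_dual x : dn (dualsp x) = (D - dn x)%N.
Proof. by rewrite /dn mksubE mxrank_ker mxrank_tr. Qed.

Lemma dn_le x : (dn x <= D)%N.
Proof. exact: rank_leq_row. Qed.

Lemma dualspK : involutive dualsp.
Proof.
move=> x; apply/esym/subsp_eq_rank; last by rewrite !dn_dual subKn // dn_le.
rewrite sub_dualsp -[val x *m _]trmxK trmx_mul trmxK trmx_eq0 -sub_dualsp; exact: submx_refl.
Qed.

Lemma dualspSE x y : (val (dualsp y) <= val (dualsp x))%MS = (val x <= val y)%MS.
Proof. by apply/idP/idP => [/dualspS|/dualspS //]; rewrite !dualspK. Qed.

Lemma cov_dual x y : cov (dualsp y) (dualsp x) = cov x y.
Proof.
rewrite /cov dualspSE !dn_dual; case: (boolP (_ <= _)%MS) => //= H.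
by have := dn_le y; have := dn_le x; have : (dn x <= dn y)%N := mxrankS H; lia.
Qed.

Lemma card_coatoms (s x : subsp) : (val s <= val x)%MS ->
  (#|[pred y | cov y x && (val s <= val y)%MS]| * (#|F| - 1) = #|F| ^ (dn x - dn s) - 1)%N.
Proof.
move=> Hsx; have := card_atoms (dualspS Hsx).
rewrite !dn_dual (_ : (D - dn s - (D - dn x)) = dn x - dn s)%N; last first.
  by have := dn_le x; have : (dn s <= dn x)%N := mxrankS Hsx; lia.
move<-; congr (_ * _)%N; rewrite -(card_image (can_inj dualspK)).
apply: eq_card => y; rewrite !inE; apply/imageP/idP => [[y']|].
  by rewrite !inE => /andP[H1 H2] ->; rewrite cov_dual H1 dualspSE.
move=> /andP[H1 H2]; exists (dualsp y); rewrite ?dualspK // !inE.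
by rewrite -cov_dual dualspK H1 -dualspSE dualspK.
Qed.

End Subspaces.

(** * Covers relative to the fixed subspace [W] *)

Section Incidence.
Variables (F : finFieldType) (D : nat) (W : subsp F D).
Local Notation subsp := (subsp F D).
Local Notation q := #|F|.
Local Notation k := (dn W).
Implicit Types x y z : subsp.

Definition da x : nat := \rank (val x :&: val W)%MS.

Definition upA z x := cov z x && (da x == (da z).+1).
Definition upB z x := cov z x && (da x == da z).

Lemma q_gt1 : (1 < q)%N.
Proof. exact: card_finRing_gt1. Qed.

Lemma rank_addW x : (\rank (val x + val W)%MS + da x = dn x + k)%N.
Proof. exact: mxrank_sum_cap. Qed.

Lemma da_le_dn x : (da x <= dn x)%N.
Proof. by rewrite mxrankS // capmxSl. Qed.

Lemma da_le_k x : (da x <= k)%N.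
Proof. by rewrite mxrankS // capmxSr. Qed.

Lemma dn_addW x : (dn x + k <= D + da x)%N.
Proof. by rewrite -rank_addW leq_add2r rank_leq_col. Qed.

Lemma cov_sub z x : cov z x -> (val z <= val x)%MS.
Proof. by case/andP. Qed.

Lemma cov_dn z x : cov z x -> dn x = (dn z).+1.
Proof. by case/andP => _ /eqP. Qed.

Lemma cov_daB z x : cov z x -> (da x == da z) = (val x :&: val W <= val z)%MS.
Proof.
move=> /cov_sub Hzx.
have H : (val z :&: val W <= val x :&: val W)%MS by rewrite capmxS.
rewrite eq_sym; have [_ ->] := mxrank_leqif_sup H.
by rewrite sub_capmx capmxSr andbT.
Qed.

Lemma cov_daA z x : cov z x -> (da x == (da z).+1) = (val x <= val z + val W)%MS.
Proof.
move=> Hc; have Hzx := cov_sub Hc.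
have H : (val z + val W <= val x + val W)%MS by rewrite addsmxS.
have := mxrank_leqif_sup H; case=> _; rewrite addsmx_sub addsmxSr andbT => <-.
by have := rank_addW x; have := rank_addW z; rewrite (cov_dn Hc); lia.
Qed.

Lemma cov_da z x : cov z x -> da x = da z \/ da x = (da z).+1.
Proof.
move=> Hc; have Hzx := cov_sub Hc.
have H1 : (da z <= da x)%N by rewrite mxrankS // capmxS.
have H2 : (\rank (val z + val W)%MS <= \rank (val x + val W)%MS)%N by rewrite mxrankS // addsmxS.
by have := rank_addW x; have := rank_addW z; rewrite (cov_dn Hc); lia.
Qed.

Lemma upAE z x : upA z x = cov z x && ~~ upB z x.
Proof.
rewrite /upA /upB; case Hc: (cov z x) => //=.
by have [->|->] := cov_da Hc; rewrite ?eqxx; lia.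
Qed.

Lemma upAP z x : upA z x -> [/\ cov z x, (val z <= val x)%MS, dn x = (dn z).+1 & da x = (da z).+1].
Proof. by move=> /andP[H /eqP E]; split=> //; [apply: cov_sub|apply: cov_dn]. Qed.

Lemma upBP z x : upB z x -> [/\ cov z x, (val z <= val x)%MS, dn x = (dn z).+1 & da x = da z].
Proof. by move=> /andP[H /eqP E]; split=> //; [apply: cov_sub|apply: cov_dn]. Qed.

Lemma card_up_split (P : pred subsp) x :
  #|[pred y | cov x y & P y]| = (#|[pred y | upA x y & P y]| + #|[pred y | upB x y & P y]|)%N.
Proof.
rewrite -(@cardID _ [pred y | upB x y] [pred y | cov x y & P y]) addnC; congr (_ + _)%N.
  by apply: eq_card => y; rewrite !inE upAE andbA [_ && cov x y]andbC.
by apply: eq_card => y; rewrite !inE /upB; case: (cov x y); rewrite //= andbC.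
Qed.

Lemma card_dn_split (P : pred subsp) x :
  #|[pred y | cov y x & P y]| = (#|[pred y | upA y x & P y]| + #|[pred y | upB y x & P y]|)%N.
Proof.
rewrite -(@cardID _ [pred y | upB y x] [pred y | cov y x & P y]) addnC; congr (_ + _)%N.
  by apply: eq_card => y; rewrite !inE upAE andbA [_ && cov y x]andbC.
by apply: eq_card => y; rewrite !inE /upB; case: (cov y x); rewrite //= andbC.
Qed.

Lemma card_up x : (#|[pred y | cov x y]| * (q - 1) = q ^ (D - dn x) - 1)%N.
Proof.
have := @card_atoms F D x (mksub 1%:M); rewrite dn_mksub !mksubE submx1 mxrank1 => <- //.
by congr (_ * _)%N; apply: eq_card => y; rewrite !inE mksubE submx1 andbT.
Qed.

Lemma card_dn x : (#|[pred y | cov y x]| * (q - 1) = q ^ (dn x) - 1)%N.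
Proof.
have := @card_coatoms F D (mksub (0 : 'M_D)) x; rewrite dn_mksub !mksubE sub0mx mxrank0 subn0 => <- //.
by congr (_ * _)%N; apply: eq_card => y; rewrite !inE mksubE sub0mx andbT.
Qed.

Lemma card_upA x : (#|[pred y | upA x y]| * (q - 1) = q ^ (k - da x) - 1)%N.
Proof.
have := @card_atoms F D x (mksub (val x + val W)%MS); rewrite mksubE addsmxSl.
rewrite dn_mksub (_ : _ - dn x = k - da x)%N; last by have := rank_addW x; lia.
move=> <- //; congr (_ * _)%N; apply: eq_card => y; rewrite !inE mksubE /upA.
by case Hc: (cov x y) => //=; rewrite cov_daA.
Qed.

Lemma card_dnB x : (#|[pred y | upB y x]| * (q - 1) = q ^ (dn x - da x) - 1)%N.
Proof.
have := @card_coatoms F D (mksub (val x :&: val W)%MS) x; rewrite mksubE capmxSl.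
rewrite dn_mksub => <- //; congr (_ * _)%N; apply: eq_card => y; rewrite !inE mksubE /upB.
by case Hc: (cov y x) => //=; rewrite cov_daB.
Qed.

(** All hyperplanes of [x] less those that contain [x :&: W]. *)
Lemma card_dnA x : (#|[pred y | upA y x]| * (q - 1) + q ^ (dn x - da x) = q ^ (dn x))%N.
Proof.
have := card_dn x; have := card_dnB x; have := card_dn_split predT x.
rewrite (eq_card (B := [pred y | cov y x])); last by move=> y; rewrite !inE andbT.
rewrite (eq_card (A := [pred y | upA y x & predT y]) (B := [pred y | upA y x])); last by move=> y; rewrite !inE andbT.
rewrite (eq_card (A := [pred y | upB y x & predT y]) (B := [pred y | upB y x])); last by move=> y; rewrite !inE andbT.
move=> ->; rewrite mulnDl => -> H.
have q0 r : (0 < q ^ r)%N by rewrite expn_gt0 ltnW // q_gt1.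
move: (q0 (dn x)) (q0 (dn x - da x)%N) H; set X := (_ * _)%N; lia.
Qed.

Lemma common_below x z y : x <> z -> cov y x -> cov y z -> y = mksub (val x :&: val z)%MS.
Proof.
move=> Hxz /andP[H1 /eqP H2] /andP[H3 /eqP H4].
apply: subsp_eq_rank; first by rewrite mksubE sub_capmx H1.
rewrite /dn mksubE leqNgt; apply/negP => H.
apply: Hxz; apply: subsp_eq_rank; last by rewrite H2 H4.
have E : (\rank (val x :&: val z)%MS == \rank (val x)).
  by rewrite eqn_leq mxrankS ?capmxSl //= -/(dn x) H2.
move: E; have [_ ->] := mxrank_leqif_sup (capmxSl (val x) (val z)).
by rewrite sub_capmx => /andP[].
Qed.

Lemma common_above x z y : x <> z -> cov x y -> cov z y -> y = mksub (val x + val z)%MS.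
Proof.
move=> Hxz /andP[H1 /eqP H2] /andP[H3 /eqP H4]; apply/esym.
apply: subsp_eq_rank; first by rewrite mksubE addsmx_sub H1.
rewrite H2 ltnNge; apply/negP => H.
apply: Hxz; apply: subsp_eq_rank; last by move: H4; rewrite H2 => -[->].
have E : (\rank (val z) == \rank (val x + val z)%MS).
  rewrite eqn_leq mxrankS ?addsmxSr //= -/(dn z).
  by move: H4; rewrite H2 => -[<-]; move: H; rewrite /dn mksubE.
move: E; have [_ ->] := mxrank_leqif_sup (addsmxSr (val x) (val z)).
by rewrite addsmx_sub => /andP[].
Qed.

Definition adj x z := (dn x == dn z) && (\rank (val x + val z)%MS == (dn x).+1).

Lemma below_adj x z : x <> z ->
  cov (mksub (val x :&: val z)%MS) x && cov (mksub (val x :&: val z)%MS) z = adj x z.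
Proof.
move=> Hxz; rewrite /cov /adj !mksubE capmxSl capmxSr !andTb !dn_mksub.
by have := mxrank_sum_cap (val x) (val z); rewrite -/(dn x) -/(dn z); lia.
Qed.

Lemma above_adj x z : x <> z ->
  cov x (mksub (val x + val z)%MS) && cov z (mksub (val x + val z)%MS) = adj x z.
Proof.
move=> Hxz; rewrite /cov /adj !mksubE addsmxSl addsmxSr !andTb !dn_mksub.
by lia.
Qed.

Lemma card_below x z : x <> z -> #|[pred y | cov y x && cov y z]| = adj x z.
Proof.
move=> H; rewrite (@card_unique _ _ (mksub (val x :&: val z)%MS)) /= ?below_adj //.
by move=> y /andP[]; apply: common_below.
Qed.

Lemma card_above x z : x <> z -> #|[pred y | cov x y && cov z y]| = adj x z.
Proof.
move=> H; rewrite (@card_unique _ _ (mksub (val x + val z)%MS)) /= ?above_adj //.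
by move=> y /andP[]; apply: common_above.
Qed.

(** Unless [da z = (da x).+1] both counts vanish. In that case [x] and [z] differ, the only
    candidates are [x :&: z] and [x + z], which exist together, and the values of [da] at the two
    ends force the types of both steps. *)
Lemma card_BA_swap x z :
  #|[pred y | upB y x && upA y z]| = #|[pred y | upA x y && upB z y]|.
Proof.
have [Hd|Hd] := eqVneq (da z) (da x).+1; last first.
  rewrite !eq_card0 // => y; rewrite !inE; apply/negP => /andP[/andP[_ /eqP H1] /andP[_ /eqP H2]];
  move: Hd; lia.
have Hxz : x <> z by move=> E; move: Hd; rewrite E; lia.
have -> : #|[pred y | upB y x && upA y z]| = #|[pred y | cov y x && cov y z]|.
  apply: eq_card => y; rewrite !inE /upA /upB.
  case H1: (cov y x) => //=; case H2: (cov y z); rewrite ?andbF //=.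
  by have := cov_da H1; have := cov_da H2; lia.
rewrite card_below // -card_above //; apply: eq_card => y; rewrite !inE /upA /upB.
case H1: (cov x y) => //=; case H2: (cov z y); rewrite ?andbF //=.
by have := cov_da H1; have := cov_da H2; lia.
Qed.

Lemma card_offdiag x z : x <> z ->
  (#|[pred y | upA x y && upA z y]| + #|[pred y | upB x y && upB z y]|
   = #|[pred y | upA y x && upA y z]| + #|[pred y | upB y x && upB y z]|)%N.
Proof.
move=> Hxz.
have [Hd|Hd] := eqVneq (da z) (da x); last first.
  rewrite !eq_card0 // => y; rewrite !inE; apply/negP => /andP[/andP[_ /eqP H1] /andP[_ /eqP H2]];
  move: Hd; lia.
transitivity #|[pred y | cov x y & cov z y]|.
  rewrite card_up_split; congr (_ + _)%N; apply: eq_card => y; rewrite !inE /upA /upB.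
    case H1: (cov x y) => //=; case H2: (cov z y); rewrite ?andbF //=; lia.
  case H1: (cov x y) => //=; case H2: (cov z y); rewrite ?andbF //=; lia.
rewrite card_above // -card_below //.
rewrite card_dn_split; congr (_ + _)%N; apply: eq_card => y; rewrite !inE /upA /upB.
  case H1: (cov y x) => //=; case H2: (cov y z); rewrite ?andbF //=; lia.
case H1: (cov y x) => //=; case H2: (cov y z); rewrite ?andbF //=; lia.
Qed.

(** If [x :&: z] lies one [upA] step below both, then [x + z] lies one such step above both:
    otherwise [(x + z) :&: W] would lie in [x] and in [z], hence [x :&: W] in [x :&: z]. This makes
    the off-diagonal entries of the central element nonnegative. *)
Lemma card_upA_ge x z : x <> z ->
  (#|[pred y | upA y x && upA y z]| <= #|[pred y | upA x y && upA z y]|)%N.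
Proof.
move=> Hxz; rewrite (@card_unique _ _ (mksub (val x :&: val z)%MS)); last first.
  by move=> y /= /andP[/upAP[H1 _ _ _] /upAP[H2 _ _ _]]; apply: common_below.
case: (boolP ([pred y | upA y x && upA y z] _)) => //= /andP[H1 H2].
set y := mksub _ in H1 H2; set w := mksub (val x + val z)%MS.
have [c1 _ _ d1] := upAP H1; have [c2 _ _ d2] := upAP H2.
have /andP[c3 c4] : cov x w && cov z w by rewrite above_adj // -below_adj // c1 c2.
apply/card_gt0P; exists w; rewrite inE /upA c3 c4 /= d1 d2 andbb.
have [E|->] := cov_da c3; last by rewrite d1.
have E' : da w == da z by rewrite E d1 d2.
have Hx : (val w :&: val W <= val x)%MS by rewrite -cov_daB // E.
have Hz : (val w :&: val W <= val z)%MS by rewrite -cov_daB.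
have : da x == da y.
  rewrite cov_daB // /y mksubE sub_capmx capmxSl /=.
  by apply: submx_trans Hz; rewrite capmxS // cov_sub.
by rewrite d1 -[X in _ == X]addn0 -addn1 eqn_add2l.
Qed.

(** In an interval of length two along which [da] grows by one there are [q + 1] intermediate
    spaces. Exactly one of them, [z + (x :&: W)], is entered from [z] by an [upA] step; the other
    [q] are entered by an [upB] step. *)
Lemma card_AB_swap x z :
  #|[pred y | upA y x && upB z y]| = (q * #|[pred y | upB y x && upA z y]|)%N.
Proof.
have [/and3P[Hzx /eqP Hn /eqP Ha]|Hno] :=
  boolP [&& (val z <= val x)%MS, dn x == (dn z).+2 & da x == (da z).+1]; last first.
  rewrite (eq_card0 (A := [pred y | upB y x && upA z y])) ?muln0; last first.
    move=> y; rewrite !inE; apply/negP => /andP[].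
    move=> /upBP[_ s1 n1 a1] /upAP[_ s2 n2 a2]; move/negP: Hno; apply.
    by rewrite (submx_trans s2 s1) n1 n2 a1 a2 !eqxx.
  apply: eq_card0 => y; rewrite !inE; apply/negP => /andP[].
  move=> /upAP[_ s1 n1 a1] /upBP[_ s2 n2 a2]; move/negP: Hno; apply.
  by rewrite (submx_trans s2 s1) n1 n2 a1 a2 !eqxx.
have Hcov y : cov z y && (val y <= val x)%MS = cov z y && cov y x.
  by rewrite /cov Hn; case: (_ <= _)%MS; case: eqP => //= ->; rewrite eqxx andbT.
pose w := mksub (val z + (val x :&: val W))%MS.
have Hcap : (val z :&: (val x :&: val W) :=: val z :&: val W)%MS.
  apply/eqmxP; rewrite !sub_capmx capmxSl capmxSl capmxSr /=.
  rewrite (submx_trans (capmxSr _ _) (capmxSr _ _)) (submx_trans (capmxSl _ _) Hzx) //.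
have Hw : dn w = (dn z).+1.
  have := mxrank_sum_cap (val z) (val x :&: val W)%MS.
  by rewrite Hcap /w /dn mksubE -/(da z) -/(da x) Ha -/(dn z); lia.
have Hw1 : cov z w && cov w x.
  by rewrite -Hcov /cov Hw eqxx !mksubE addsmxSl addsmx_sub Hzx capmxSl.
have E1 : #|[pred y | upB y x && upA z y]| = 1%N.
  rewrite (@card_unique _ _ w) /=.
    move: Hw1 => /andP[c1 c2].
    have E : da x == da w by rewrite cov_daB // mksubE addsmxSr.
    by rewrite /upB /upA c1 c2 E -(eqP E) Ha eqxx.
  move=> y /andP[/andP[c2 e2] /upAP[c1 _ n1 _]]; apply/esym.
  apply: subsp_eq_rank; last by rewrite n1 Hw.
  by rewrite mksubE addsmx_sub cov_sub //= -cov_daB.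
have := card_atoms Hzx; rewrite Hn (_ : (dn z).+2 - dn z = 2)%N; last by lia.
have -> : #|[pred y | cov z y & (val y <= val x)%MS]|
    = (#|[pred y | upA y x && upB z y]| + #|[pred y | upB y x && upA z y]|)%N.
  rewrite (eq_card (B := [pred y | cov z y & cov y x])); last by move=> y; rewrite !inE Hcov.
  rewrite card_up_split addnC; congr (_ + _)%N; apply: eq_card => y; rewrite !inE /upA /upB.
    case c1: (cov z y) => //=; case c2: (cov y x); rewrite ?andbF //=.
    by have := cov_da c1; have := cov_da c2; lia.
  case c1: (cov z y) => //=; case c2: (cov y x); rewrite ?andbF //=.
  by have := cov_da c1; have := cov_da c2; lia.
rewrite E1 muln1 -[2%N]/(1.+1) expnS expn1.
have := q_gt1; nia.
Qed.

End Incidence.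

(** * Raising and lowering operators *)

Section Operators.
Variables (F : finFieldType) (D : nat) (W : subsp F D) (C : numClosedFieldType).
Local Notation subsp := (subsp F D).
Local Notation q := #|F|.
Local Notation k := (dn W).
Local Notation N := #|{: subsp}|.
Local Notation da := (da W).
Local Notation Q := (#|F|%:R : C).

Definition sv (i : 'I_N) : subsp := enum_val i.

(* Operators act on row vectors from the right. *)
Definition incmx (P : rel subsp) : 'M[C]_N := \matrix_(i, j) (P (sv i) (sv j))%:R.

Definition RA := incmx (upA W).
Definition LA := incmx (fun x z => upA W z x).
Definition RB := incmx (upB W).
Definition LB := incmx (fun x z => upB W z x).

Lemma sv_inj : injective sv. Proof. exact: enum_val_inj. Qed.

Lemma incmx_tr P : (incmx P)^T = incmx (fun x y => P y x).
Proof. by apply/matrixP => i j; rewrite !mxE. Qed.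

Lemma incmx_mul P R i j :
  (incmx P *m incmx R) i j = #|[pred y | P (sv i) y && R y (sv j)]|%:R.
Proof.
rewrite mxE -[in RHS]sum1_card natr_sum [in RHS]big_mkcond /=.
rewrite [in RHS](reindex (@enum_val subsp xpredT)) /=; last by apply: onW_bij; apply: enum_val_bij.
apply: eq_bigr => l _; rewrite !mxE -natrM mulnb /sv.
by rewrite inE; case: (_ && _).
Qed.

Lemma Q_gt1 : 1 < Q.
Proof. by rewrite ltr1n q_gt1. Qed.

Lemma Q_gt0 : 0 < Q.
Proof. exact: lt_trans Q_gt1. Qed.

Lemma Q_neq0 : Q != 0.
Proof. by rewrite gt_eqF // Q_gt0. Qed.

Lemma Q1_neq0 : Q - 1 != 0.
Proof. by rewrite subr_eq0 gt_eqF // Q_gt1. Qed.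

Lemma QX_neq0 n : Q ^+ n != 0.
Proof. by rewrite expf_neq0 // Q_neq0. Qed.

Lemma QX_inj m n : Q ^+ m = Q ^+ n -> m = n.
Proof.
rewrite -!natrX => /eqP; rewrite eqr_nat => /eqP E.
by apply/eqP; rewrite -(eqn_exp2l _ _ (q_gt1 F)) E.
Qed.

Lemma QX1_neq0 n : Q ^+ n.+1 - 1 != 0.
Proof. by rewrite subr_eq0; apply/negP => /eqP /(@QX_inj _ 0). Qed.

Lemma LALB : LA *m LB = Q *: (LB *m LA).
Proof.
apply/matrixP => i j; rewrite [RHS]mxE !incmx_mul -natrM; congr _%:R.
exact: card_AB_swap.
Qed.

Lemma LA_tr : LA^T = RA. Proof. exact: incmx_tr. Qed.
Lemma LB_tr : LB^T = RB. Proof. exact: incmx_tr. Qed.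
Lemma RA_tr : RA^T = LA. Proof. exact: incmx_tr. Qed.
Lemma RB_tr : RB^T = LB. Proof. exact: incmx_tr. Qed.

Lemma RBRA : RB *m RA = Q *: (RA *m RB).
Proof. by rewrite -LA_tr -LB_tr -!trmx_mul LALB linearZ. Qed.

Lemma LBRA : LB *m RA = RA *m LB.
Proof. by apply/matrixP => i j; rewrite !incmx_mul; congr _%:R; apply: card_BA_swap. Qed.

Lemma LARB : LA *m RB = RB *m LA.
Proof. by rewrite -RA_tr -LB_tr -!trmx_mul LBRA. Qed.

Lemma natr_geom (n m : nat) : (n * (q - 1) = q ^ m - 1)%N -> (Q - 1) * n%:R = Q ^+ m - 1.
Proof.
have q1 := q_gt1 F.
move=> H; have : ((n * (q - 1))%N%:R : C) = (q ^ m - 1)%N%:R by rewrite H.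
rewrite natrM !natrB ?natrX ?(ltnW q1) ?expn_gt0 ?(ltnW q1) // => <-; ring.
Qed.

Lemma natr_geom_sub (n m1 m2 : nat) : (n * (q - 1) + q ^ m1 = q ^ m2)%N ->
  (Q - 1) * n%:R = Q ^+ m2 - Q ^+ m1.
Proof.
have q1 := q_gt1 F.
move=> H; have : ((n * (q - 1) + q ^ m1)%N%:R : C) = (q ^ m2)%N%:R by rewrite H.
rewrite natrD natrM natrB ?(ltnW q1) // !natrX => <-; ring.
Qed.

Lemma comm_total : (Q - 1) *: (RA *m LA + RB *m LB - LA *m RA - LB *m RB)
  = diag_mx (\row_i (Q ^+ (D - dn (sv i)) - Q ^+ dn (sv i))).
Proof.
apply/matrixP => i j; rewrite [LHS]mxE.
have E (A B E' F' : 'M[C]_N) : (A + B - E' - F') i j = A i j + B i j - (E' i j + F' i j).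
  by rewrite !mxE opprD addrA.
rewrite E !incmx_mul -!natrD !mxE.
case: (eqVneq i j) => [<-|Hij]; last first.
  rewrite card_offdiag ?subrr ?mulr0 ?mulr0n // => /sv_inj H.
  by rewrite H eqxx in Hij.
rewrite mulr1n mulrBr.
have -> : (#|[pred y | upA W (sv i) y & upA W (sv i) y]| +
   #|[pred y | upB W (sv i) y & upB W (sv i) y]|)%N = #|[pred y | cov (sv i) y]|.
  rewrite (eq_card (A := [pred y | cov (sv i) y]) (B := [pred y | cov (sv i) y & predT y])); last by move=> y; rewrite !inE andbT.
  by rewrite (card_up_split W); congr (_ + _)%N; apply: eq_card => y; rewrite !inE andbb ?andbT.
have -> : (#|[pred y | upA W y (sv i) & upA W y (sv i)]| +
   #|[pred y | upB W y (sv i) & upB W y (sv i)]|)%N = #|[pred y | cov y (sv i)]|.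
  rewrite (eq_card (A := [pred y | cov y (sv i)]) (B := [pred y | cov y (sv i) & predT y])); last by move=> y; rewrite !inE andbT.
  by rewrite (card_dn_split W); congr (_ + _)%N; apply: eq_card => y; rewrite !inE andbb ?andbT.
have H1 := natr_geom (card_up (sv i)); have H2 := natr_geom (card_dn (sv i)).
by rewrite H1 H2 opprB addrA subrK.
Qed.

(** [a] is the dimension inside [W] and [b] the dimension modulo [W]; the zero vector has every
    weight. *)
Definition wt a b (u : 'rV[C]_N) : Prop :=
  forall i, u 0 i != 0 -> da (sv i) = a /\ dn (sv i) = (a + b)%N.

Lemma wt0 a b : wt a b 0.
Proof. by move=> i; rewrite mxE eqxx. Qed.

Lemma wtD a b u v : wt a b u -> wt a b v -> wt a b (u + v).
Proof.
move=> Hu Hv i; rewrite mxE => H; case: (eqVneq (u 0 i) 0) => [E|/Hu //].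
by apply: Hv; rewrite E add0r in H.
Qed.

Lemma wtZ a b c u : wt a b u -> wt a b (c *: u).
Proof. by move=> Hu i; rewrite mxE mulf_eq0 negb_or => /andP[_ /Hu]. Qed.

Lemma wt_mul a b u a' b' (M : 'M[C]_N) :
  wt a b u -> (forall i j, da (sv i) = a -> dn (sv i) = (a + b)%N -> M i j != 0 ->
    da (sv j) = a' /\ dn (sv j) = (a' + b')%N) -> wt a' b' (u *m M).
Proof.
move=> Hu HM j; rewrite mxE => Hs.
case: (pickP (fun i => (u 0 i != 0) && (M i j != 0))) => [i /andP[/Hu[H1 H2] H3]|H0].
  exact: HM H3.
case/eqP: Hs; apply: big1 => i _; have := H0 i.
by rewrite -negb_or -mulf_eq0 => /negbFE/eqP.
Qed.

Lemma pnatr_b (b : bool) : (b%:R != 0 :> C) = b.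
Proof. by case: b; rewrite ?oner_eq0 ?eqxx. Qed.

Lemma wtRA a b u : wt a b u -> wt a.+1 b (u *m RA).
Proof.
move=> /wt_mul; apply=> i j E1 E2; rewrite mxE pnatr_b => /upAP[_ _ -> ->].
by rewrite E1 E2.
Qed.

Lemma wtRB a b u : wt a b u -> wt a b.+1 (u *m RB).
Proof.
move=> /wt_mul; apply=> i j E1 E2; rewrite mxE pnatr_b => /upBP[_ _ -> ->].
by rewrite E1 E2 addnS.
Qed.

Lemma wtLA a b u : wt a.+1 b u -> wt a b (u *m LA).
Proof.
move=> /wt_mul; apply=> i j E1 E2; rewrite mxE pnatr_b => /upAP[_ _ H1 H2].
by rewrite E1 E2 in H1 H2; case: H1 => <-; case: H2 => <-.
Qed.

Lemma wtLA0 b u : wt 0 b u -> u *m LA = 0.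
Proof.
move=> Hu; apply/rowP => j; rewrite !mxE big1 // => i _.
case: (eqVneq (u 0 i) 0) => [->|/Hu[E1 E2]]; first by rewrite mul0r.
rewrite !mxE; case: (boolP (upA _ _ _)) => [/upAP[_ _ _]|]; first by rewrite E1.
by rewrite mulr0.
Qed.

Lemma wt_le a b u : wt a b u -> u != 0 -> (a <= k)%N /\ (b + k <= D)%N.
Proof.
move=> Hu /eqP Hu0.
case: (pickP (fun i => u 0 i != 0)) => [i /Hu[E1 E2]|H]; last first.
  by case: Hu0; apply/rowP => i; rewrite mxE; apply/eqP/negPn; rewrite H.
have := da_le_k W (sv i); have := dn_addW W (sv i); rewrite E1 E2; lia.
Qed.

Lemma wt_big a b u : wt a b u -> (k < a)%N || (D < b + k)%N -> u = 0.
Proof. by move=> H1 H2; apply/eqP; apply/negP => /negP/(wt_le H1); lia. Qed.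

Lemma wt_comm a b u : wt a b u ->
  (Q - 1) *: (u *m RA *m LA - u *m LA *m RA) =
  (Q - 1) *: (u *m LB *m RB - u *m RB *m LB) + (Q ^+ (D - (a + b)) - Q ^+ (a + b)) *: u.
Proof.
move=> Hu; apply/eqP; rewrite -subr_eq0 opprD addrA -scalerBr; apply/eqP.
have -> : u *m RA *m LA - u *m LA *m RA - (u *m LB *m RB - u *m RB *m LB)
   = u *m (RA *m LA + RB *m LB - LA *m RA - LB *m RB).
  by rewrite !mulmxBr mulmxDr !mulmxA opprB !addrA; congr (_ - _); rewrite addrAC.
rewrite scalemxAr comm_total; apply/rowP => i; rewrite mxE mul_mx_diag !mxE.
have [->|/Hu[_ ->]] := eqVneq (u 0 i) 0; first by rewrite mulr0 mul0r subr0.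
by rewrite mulrC subrr.
Qed.

End Operators.

(** * The central element and the string formulas *)

Section Weights.
Variables (F : finFieldType) (D : nat) (W : subsp F D) (C : numClosedFieldType).
Local Notation q := #|F|.
Local Notation k := (dn W).
Local Notation N := #|{: subsp F D}|.
Local Notation da := (da W).
Local Notation Q := (#|F|%:R : C).
Local Notation RA := (RA W C).
Local Notation LA := (LA W C).
Local Notation RB := (RB W C).
Local Notation LB := (LB W C).
Local Notation Q0 := (QX_neq0 F C).
Implicit Types u v w : 'rV[C]_N.

Lemma vRBRA u : u *m RB *m RA = Q *: (u *m RA *m RB).
Proof. by rewrite -mulmxA RBRA -scalemxAr mulmxA. Qed.

Lemma vLALB u : u *m LA *m LB = Q *: (u *m LB *m LA).
Proof. by rewrite -mulmxA LALB -scalemxAr mulmxA. Qed.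

Lemma vLBRA u : u *m LB *m RA = u *m RA *m LB.
Proof. by rewrite -mulmxA LBRA mulmxA. Qed.

Lemma vLARB u : u *m LA *m RB = u *m RB *m LA.
Proof. by rewrite -mulmxA LARB mulmxA. Qed.

(* The central element: it commutes past the four operators with [a], [b] shifted accordingly, its
   rows form a stochastic matrix, and on the module of type [(h, i, j)] it is [Q ^- h]. *)
Definition cM a b : 'M[C]_N :=
  (Q ^+ a / Q ^+ (b + k)) *: ((Q - 1) *: (RA *m LA - LA *m RA) + (Q ^+ (a + b))%:M).

Lemma mul_cM a b u : u *m cM a b =
  (Q ^+ a / Q ^+ (b + k)) *: ((Q - 1) *: (u *m RA *m LA - u *m LA *m RA) + Q ^+ (a + b) *: u).
Proof. by rewrite -scalemxAr mulmxDr -scalemxAr mulmxBr !mulmxA mul_mx_scalar. Qed.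

Lemma wtLB0 a u : wt W a 0 u -> u *m LB = 0.
Proof.
move=> Hu; apply/rowP => j; rewrite !mxE big1 // => i _.
case: (eqVneq (u 0 i) 0) => [->|/Hu[E1 E2]]; first by rewrite mul0r.
rewrite !mxE; case: (boolP (upB _ _ _)) => [/upBP[_ _]|]; last by rewrite mulr0.
by have := da_le_dn W (sv j); rewrite E1 E2; lia.
Qed.

Lemma wt_RALA a b u : wt W a b u -> wt W a b (u *m RA *m LA).
Proof. by move=> Hu; apply: wtLA; apply: wtRA. Qed.

Lemma wt_LARA a b u : wt W a b u -> wt W a b (u *m LA *m RA).
Proof.
case: a => [|a] Hu; first by rewrite (wtLA0 Hu) mul0mx; apply: wt0.
by apply: wtRA; apply: wtLA.
Qed.

Lemma wtB a b u v : wt W a b u -> wt W a b v -> wt W a b (u - v).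
Proof. by move=> Hu Hv; rewrite -scaleN1r; apply: wtD => //; apply: wtZ. Qed.

Lemma wt_cM a b u : wt W a b u -> wt W a b (u *m cM a b).
Proof.
move=> Hu; rewrite mul_cM; apply: wtZ; apply: wtD; last exact: wtZ.
by apply: wtZ; apply: wtB; [apply: wt_RALA|apply: wt_LARA].
Qed.

Lemma cM_RB a b u : u *m RB *m cM a b.+1 = u *m cM a b *m RB.
Proof.
rewrite !mul_cM -scalemxAl mulmxDl -!scalemxAl mulmxBl.
have -> : u *m RB *m RA *m LA = Q *: (u *m RA *m LA *m RB).
  by rewrite vRBRA -scalemxAl -vLARB.
have -> : u *m RB *m LA *m RA = Q *: (u *m LA *m RA *m RB).
  by rewrite -vLARB vRBRA.
move: (u *m RA *m LA *m RB) (u *m LA *m RA *m RB) (u *m RB) => X Y Z.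
apply/rowP => i; rewrite !mxE addSn addnS !exprS; have := Q_neq0 F C; have := Q0 (b + k).
by move=> *; field; apply/andP.
Qed.

Lemma cM_LB a b u : u *m LB *m cM a b = u *m cM a b.+1 *m LB.
Proof.
rewrite !mul_cM -scalemxAl mulmxDl -!scalemxAl mulmxBl.
have -> : u *m RA *m LA *m LB = Q *: (u *m LB *m RA *m LA).
  by rewrite vLALB -vLBRA.
have -> : u *m LA *m RA *m LB = Q *: (u *m LB *m LA *m RA).
  by rewrite -vLBRA vLALB -scalemxAl.
move: (u *m LB *m RA *m LA) (u *m LB *m LA *m RA) (u *m LB) => X Y Z.
apply/rowP => i; rewrite !mxE addSn addnS !exprS; have := Q_neq0 F C; have := Q0 (b + k).
by move=> *; field; apply/andP.
Qed.

(** [comm_total] trades the commutator of [RA] and [LA] for that of [RB] and [LB]. The definition is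
    suited to moving [cM] past [RB] and [LB], this form to moving it past [RA] and [LA]. *)
Lemma cM_alt a b u : wt W a b u -> u *m cM a b = (Q ^+ a / Q ^+ (b + k)) *:
  ((Q - 1) *: (u *m LB *m RB - u *m RB *m LB) + Q ^+ (D - (a + b)) *: u).
Proof.
move=> Hu; rewrite mul_cM (wt_comm Hu); congr (_ *: _).
by rewrite -addrA -scalerDl subrK.
Qed.

Lemma cM_RA a b u : wt W a b u -> u *m RA *m cM a.+1 b = u *m cM a b *m RA.
Proof.
(* Outside the range of possible weights both sides vanish; inside it the exponent [D - (a + b)]
   does not truncate. *)
move=> Hu; have [Hbig|] := boolP ((k < a.+1) || (D < b + k))%N.
  by rewrite (wt_big (wtRA Hu) Hbig) mul0mx (wt_big (wtRA (wt_cM Hu)) Hbig).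
rewrite negb_or -!leqNgt => /andP[Ha Hb].
rewrite (cM_alt Hu) (cM_alt (wtRA Hu)) -scalemxAl mulmxDl -!scalemxAl mulmxBl.
have -> : u *m RB *m LB *m RA = Q *: (u *m RA *m RB *m LB).
  by rewrite vLBRA vRBRA -scalemxAl.
have -> : u *m LB *m RB *m RA = Q *: (u *m RA *m LB *m RB).
  by rewrite vRBRA vLBRA.
move: (u *m RA *m LB *m RB) (u *m RA *m RB *m LB) (u *m RA) => X Y Z.
have -> : (D - (a + b) = (D - (a.+1 + b)).+1)%N by lia.
apply/rowP => i; rewrite !mxE !exprS; have := Q_neq0 F C; have := Q0 (b + k).
by move=> *; field.
Qed.

Lemma cM_LA a b u : wt W a.+1 b u -> u *m LA *m cM a b = u *m cM a.+1 b *m LA.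
Proof.
move=> Hu; have [Hbig|] := boolP ((k < a.+1) || (D < b + k))%N.
  by rewrite (wt_big Hu Hbig) !mul0mx.
rewrite negb_or -!leqNgt => /andP[Ha Hb].
rewrite (cM_alt Hu) (cM_alt (wtLA Hu)) -scalemxAl mulmxDl -!scalemxAl mulmxBl.
have -> : u *m LA *m LB *m RB = Q *: (u *m LB *m RB *m LA).
  by rewrite vLALB -scalemxAl vLARB.
have -> : u *m LA *m RB *m LB = Q *: (u *m RB *m LB *m LA).
  by rewrite vLARB vLALB.
move: (u *m LB *m RB *m LA) (u *m RB *m LB *m LA) (u *m LA) => X Y Z.
have -> : (D - (a + b) = (D - (a.+1 + b)).+1)%N by lia.
apply/rowP => i; rewrite !mxE !exprS; have := Q_neq0 F C; have := Q0 (b + k).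
by move=> *; field.
Qed.

Definition iter_act (R : 'M[C]_N) s u : 'rV[C]_N := iter s (mulmx^~ R) u.

Lemma actS R s u : iter_act R s.+1 u = iter_act R s u *m R. Proof. by []. Qed.

Lemma actSr R s u : iter_act R s.+1 u = iter_act R s (u *m R). Proof. exact: iterSr. Qed.

Lemma actD R s u v : iter_act R s (u + v) = iter_act R s u + iter_act R s v.
Proof. by elim: s => //= s ->; rewrite mulmxDl. Qed.

Lemma actZ R s a u : iter_act R s (a *: u) = a *: iter_act R s u.
Proof. by elim: s => //= s ->; rewrite scalemxAl. Qed.

Lemma actB R s u v : iter_act R s (u - v) = iter_act R s u - iter_act R s v.
Proof. by rewrite actD -scaleN1r actZ scaleN1r. Qed.

Lemma act0 R s : iter_act R s 0 = 0.
Proof. by elim: s => //= s ->; rewrite mul0mx. Qed.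

Lemma act_comm R M s u : R *m M = M *m R -> iter_act R s u *m M = iter_act R s (u *m M).
Proof. by move=> H; elim: s => //= s IH; rewrite -mulmxA H mulmxA IH. Qed.

Lemma wt_actRA a b s u : wt W a b u -> wt W (a + s) b (iter_act RA s u).
Proof. by move=> Hu; elim: s => [|s IH]; rewrite ?addn0 // addnS; apply: wtRA. Qed.

Lemma wt_actRB a b s u : wt W a b u -> wt W a (b + s) (iter_act RB s u).
Proof. by move=> Hu; elim: s => [|s IH]; rewrite ?addn0 // addnS; apply: wtRB. Qed.

Lemma act_RB_RA t u : iter_act RB t u *m RA = Q ^+ t *: iter_act RB t (u *m RA).
Proof.
elim: t u => [|t IH] u; first by rewrite scale1r.
by rewrite !actSr IH vRBRA actZ scalerA -exprSr.
Qed.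

Lemma act_RA_cM a b s u : wt W a b u -> iter_act RA s u *m cM (a + s) b = iter_act RA s (u *m cM a b).
Proof.
move=> Hu; elim: s => [|s IH]; first by rewrite addn0.
by rewrite addnS !actS cM_RA ?IH //; apply: wt_actRA.
Qed.

Lemma act_RB_cM a b t u : iter_act RB t u *m cM a (b + t) = iter_act RB t (u *m cM a b).
Proof.
elim: t => [|t IH]; first by rewrite addn0.
by rewrite addnS !actS cM_RB IH.
Qed.

Lemma RALA_cM a b u : (a <= k)%N -> (Q - 1) *: (u *m RA *m LA) =
  (Q - 1) *: (u *m LA *m RA) + (Q ^+ b * Q ^+ (k - a)) *: (u *m cM a b) - Q ^+ (a + b) *: u.
Proof.
move=> Ha; rewrite mul_cM.
have -> : Q ^+ (b + k) = Q ^+ b * Q ^+ (k - a) * Q ^+ a by rewrite -!exprD; congr (_ ^+ _); lia.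
move: (u *m RA *m LA) (u *m LA *m RA) => X Y.
apply/rowP => i; rewrite !mxE; have := Q0 a; have := Q0 b; have := Q0 (k - a).
by move=> *; field; rewrite ?andbT; do ?[apply/andP; split].
Qed.

Lemma RBLB_cM a b u : wt W a b u -> (a <= k)%N -> (Q - 1) *: (u *m RB *m LB) =
  (Q - 1) *: (u *m LB *m RB) + Q ^+ (D - (a + b)) *: u - (Q ^+ b * Q ^+ (k - a)) *: (u *m cM a b).
Proof.
move=> Hu Ha; rewrite (cM_alt Hu).
have -> : Q ^+ (b + k) = Q ^+ b * Q ^+ (k - a) * Q ^+ a by rewrite -!exprD; congr (_ ^+ _); lia.
move: (u *m RB *m LB) (u *m LB *m RB) => X Y.
apply/rowP => i; rewrite !mxE; have := Q0 a; have := Q0 b; have := Q0 (k - a).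
by move=> *; field; rewrite ?andbT; do ?[apply/andP; split].
Qed.

(** Induction on [s]: [RALA_cM] swaps the last [RA] with [LA] at the cost of scalars and of [cM],
    and [cM] slides down the string to [u]. On an eigenvector the right-hand side is a scalar
    multiple of the string, whose zero marks the end of the string. *)
Lemma stringA j b s u : wt W j b u -> u *m LA = 0 -> (j + s <= k)%N ->
  (Q - 1) ^+ 2 *: (iter_act RA s.+1 u *m LA) = (Q ^+ b * (Q ^+ s.+1 - 1)) *:
    (Q ^+ (k - j - s) *: iter_act RA s (u *m cM j b) - Q ^+ j *: iter_act RA s u).
Proof.
move=> Hu HL; elim: s => [|s IH] Hs.
  rewrite /= -[_ ^+ 2]/(_ * _) -scalerA (@RALA_cM j b) ?HL ?mul0mx; last by lia.
  rewrite subn0; move: (u *m cM j b) => X; apply/rowP => i; rewrite !mxE exprD; ring.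
have {}IH : _ := IH (leq_trans (leq_add (leqnn j) (leqnSn s)) Hs).
rewrite actS -[_ ^+ 2]/(_ * _) -scalerA (@RALA_cM (j + s.+1) b) //.
rewrite act_RA_cM // scalerBr scalerDr !scalerA -/(_ ^+ 2) scalemxAl IH -scalemxAl mulmxBl -!scalemxAl -!actS.
have -> : (k - j - s = (k - j - s.+1).+1)%N by lia.
have -> : (k - (j + s.+1) = k - j - s.+1)%N by lia.
move: (iter_act RA s.+1 (u *m cM j b)) (iter_act RA s.+1 u) => X Y.
apply/rowP => i; rewrite !mxE !exprD !exprS; ring.
Qed.


Lemma stringB a b t u : wt W a b u -> u *m LB = 0 -> (a <= k)%N -> (b + t + k <= D)%N ->
  (Q - 1) ^+ 2 *: (iter_act RB t.+1 u *m LB) = (Q ^+ (k - a) * (Q ^+ t.+1 - 1)) *: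
    (Q ^+ (D - k - b - t) *: iter_act RB t u - Q ^+ b *: iter_act RB t (u *m cM a b)).
Proof.
move=> Hu HL Ha; elim: t => [|t IH] Ht.
  rewrite /= -[_ ^+ 2]/(_ * _) -scalerA (@RBLB_cM a b) ?HL ?mul0mx //.
  have -> : Q ^+ (D - (a + b)) = Q ^+ (k - a) * Q ^+ (D - k - b - 0).
    by rewrite -exprD; congr (_ ^+ _); lia.
  move: (u *m cM a b) => X; apply/rowP => i; rewrite !mxE; ring.
have {}IH : _ := IH (leq_trans (leq_add (leq_add (leqnn b) (leqnSn t)) (leqnn k)) Ht).
rewrite actS -[_ ^+ 2]/(_ * _) -scalerA (@RBLB_cM a (b + t.+1)) //; last exact: wt_actRB.
rewrite act_RB_cM scalerBr scalerDr !scalerA -/(_ ^+ 2) scalemxAl IH -scalemxAl mulmxBl -!scalemxAl -!actS.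
have -> : (D - k - b - t = (D - k - b - t.+1).+1)%N by lia.
have -> : Q ^+ (D - (a + (b + t.+1))) = Q ^+ (k - a) * Q ^+ (D - k - b - t.+1).
  by rewrite -exprD; congr (_ ^+ _); lia.
move: (iter_act RB t.+1 (u *m cM a b)) (iter_act RB t.+1 u) => X Y.
apply/rowP => i; rewrite !mxE !exprD !exprS; ring.
Qed.

Definition low j b u := [/\ wt W j b u, u *m LA = 0 & u *m LB = 0].

Lemma low_cM j b u : low j b u -> low j b (u *m cM j b).
Proof.
move=> [Hw HA HB]; split; first exact: wt_cM.
  case: j Hw => [|j] Hw; first exact: wtLA0 (wt_cM Hw).
  by rewrite -cM_LA // HA mul0mx.
case: b Hw => [|b] Hw; first exact: wtLB0 (wt_cM Hw).
by rewrite -cM_LB HB mul0mx.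
Qed.

Lemma lowD j b u v : low j b u -> low j b v -> low j b (u + v).
Proof.
by move=> [? A B] [? A' B']; split; [apply: wtD|rewrite mulmxDl A A' addr0|rewrite mulmxDl B B' addr0].
Qed.

Lemma lowZ j b c u : low j b u -> low j b (c *: u).
Proof. by move=> [? A B]; split; [apply: wtZ|rewrite -scalemxAl A scaler0|rewrite -scalemxAl B scaler0]. Qed.

Definition ones : 'cV[C]_N := const_mx 1.

Lemma incmx_ones P i : (incmx C P *m ones) i 0 = #|[pred y | P (sv i) y]|%:R.
Proof.
rewrite mxE -[in RHS]sum1_card natr_sum [in RHS]big_mkcond /=.
rewrite [in RHS](reindex (@enum_val (subsp F D) xpredT)) /=; last by apply: onW_bij; apply: enum_val_bij.
by apply: eq_bigr => l _; rewrite !mxE mulr1 inE /sv; case: (P _ _).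
Qed.

Lemma RA_ones i : (Q - 1) * (RA *m ones) i 0 = Q ^+ (k - da (sv i)) - 1.
Proof. by rewrite incmx_ones; have H := natr_geom C (card_upA W (sv i)); rewrite H. Qed.

Lemma LA_ones i : (Q - 1) * (LA *m ones) i 0 = Q ^+ (dn (sv i)) - Q ^+ (dn (sv i) - da (sv i)).
Proof.
by rewrite incmx_ones; have H := natr_geom_sub C (card_dnA W (sv i)); rewrite H.
Qed.

Lemma mulmx_ones (M : 'M[C]_N) i : (M *m ones) i 0 = \sum_j M i j.
Proof. by rewrite mxE; apply: eq_bigr => j _; rewrite mxE mulr1. Qed.

Lemma RALA_ones i : (Q - 1) ^+ 2 * (RA *m LA *m ones) i 0
  = (Q ^+ (k - da (sv i)) - 1) * (Q ^+ (dn (sv i)).+1 - Q ^+ (dn (sv i) - da (sv i))).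
Proof.
rewrite -mulmxA mxE -[_ ^+ 2]/(_ * _) -mulrA mulr_sumr mulr_sumr.
rewrite -(RA_ones i) [(_ *m ones) i 0]mxE mulr_sumr mulr_suml; apply: eq_bigr => j _.
rewrite [ones j 0]mxE mulr1 -mulrA; congr (_ * _); rewrite mulrCA LA_ones.
rewrite mxE; case: (boolP (upA _ _ _)) => [/upAP[_ _ -> ->]|_]; last by rewrite !mul0r.
by rewrite subSS.
Qed.

Lemma LARA_ones i : (0 < da (sv i))%N -> (Q - 1) ^+ 2 * (LA *m RA *m ones) i 0
  = (Q ^+ (dn (sv i)) - Q ^+ (dn (sv i) - da (sv i))) * (Q ^+ (k - da (sv i)).+1 - 1).
Proof.
move=> Hd; rewrite -mulmxA mxE -[_ ^+ 2]/(_ * _) -mulrA mulr_sumr mulr_sumr.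
rewrite -(LA_ones i) [(LA *m ones) i 0]mxE mulr_sumr mulr_suml; apply: eq_bigr => j _.
rewrite [ones j 0]mxE mulr1 -mulrA; congr (_ * _); rewrite mulrCA RA_ones.
rewrite mxE; case: (boolP (upA _ _ _)) => [/upAP[_ _ _ H]|_]; last by rewrite !mul0r.
by rewrite (_ : (k - da (sv j) = (k - da (sv i)).+1)%N) //; have := da_le_k W (sv i); rewrite H; lia.
Qed.

Lemma LARA_ones0 i : da (sv i) = 0%N -> (LA *m RA *m ones) i 0 = 0.
Proof.
move=> Hd; rewrite -mulmxA mxE big1 // => j _; rewrite mxE.
by case: (boolP (upA _ _ _)) => [/upAP[_ _ _]|_]; rewrite ?mul0r // Hd.
Qed.

Lemma mxBE (A B : 'M[C]_N) i j : (A - B) i j = A i j - B i j.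
Proof. by rewrite !mxE. Qed.

Lemma cM_entry a b i j : cM a b i j = Q ^+ a / Q ^+ (b + k) *
  ((Q - 1) * ((RA *m LA) i j - (LA *m RA) i j) + Q ^+ (a + b) *+ (i == j)).
Proof.
rewrite /cM; move: (RA *m LA) (LA *m RA) => X Y.
by rewrite !mxE.
Qed.

(** Each row is taken with the weight of its own index: when [cM a b] acts on a vector of weight
    [(a, b)], only rows of that weight contribute. *)
Lemma cM_row_sum i : \sum_j cM (da (sv i)) (dn (sv i) - da (sv i)) i j = 1.
Proof.
set a := da _; set b := (_ - _)%N.
have Hn : dn (sv i) = (a + b)%N by rewrite /b subnKC // da_le_dn.
have Ha : (a <= k)%N by exact: da_le_k.
under eq_bigr do rewrite cM_entry.
rewrite -mulr_sumr big_split /= -mulr_sumr sumrB -!mulmx_ones.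
have -> : \sum_(j < N) Q ^+ (a + b) *+ (i == j) = Q ^+ (a + b).
  rewrite (bigD1 i) //= eqxx mulr1n big1 ?addr0 // => j /negPf Hj.
  by rewrite eq_sym Hj mulr0n.
have E1 : (Q - 1) * (RA *m LA *m ones) i 0 = (Q ^+ (k - a) - 1) * (Q ^+ (a + b).+1 - Q ^+ b) / (Q - 1).
  rewrite -[b]/(dn (sv i) - da (sv i))%N -Hn -RALA_ones; have := Q1_neq0 F C => *; by field.
have E2 : (Q - 1) * (LA *m RA *m ones) i 0 = (Q ^+ (a + b) - Q ^+ b) * (Q ^+ (k - a).+1 - 1) / (Q - 1).
  have [Ha0|Ha0] := posnP a; first by rewrite LARA_ones0 // Ha0 add0n subrr !(mul0r,mulr0).
  rewrite -[b]/(dn (sv i) - da (sv i))%N -Hn -LARA_ones //; have := Q1_neq0 F C => *; by field.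
rewrite mulrBr E1 E2.
have -> : Q ^+ (b + k) = Q ^+ b * Q ^+ (k - a) * Q ^+ a by rewrite -!exprD; congr (_ ^+ _); lia.
rewrite !exprS !exprD; move: (Q1_neq0 F C) (Q0 a) (Q0 b) (Q0 (k - a)).
move: (Q ^+ a) (Q ^+ b) (Q ^+ (k - a)) => x y z; move: Q => r H1 H2 H3 H4.
by field; rewrite H1 H2 H3 H4.
Qed.

Lemma cM_ge0 i j : 0 <= cM (da (sv i)) (dn (sv i) - da (sv i)) i j.
Proof.
set a := da _; set b := (_ - _)%N.
have QX0 n : 0 <= Q ^+ n by rewrite exprn_ge0 // ltW // Q_gt0.
have Q10 : 0 <= Q - 1 by rewrite subr_ge0 ltW // Q_gt1.
rewrite cM_entry mulr_ge0 // ?divr_ge0 //.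
have [<-|Hij] := eqVneq i j; last first.
  rewrite mulr0n addr0 mulr_ge0 // !incmx_mul subr_ge0 ler_nat card_upA_ge //.
  by move=> /(@sv_inj F D) H; rewrite H eqxx in Hij.
rewrite mulr1n !incmx_mul.
have -> : #|[pred y | upA W (sv i) y & upA W (sv i) y]| = #|[pred y | upA W (sv i) y]|.
  by apply: eq_card => y; rewrite !inE andbb.
have -> : #|[pred y | upA W y (sv i) & upA W y (sv i)]| = #|[pred y | upA W y (sv i)]|.
  by apply: eq_card => y; rewrite !inE andbb.
have H1 := natr_geom C (card_upA W (sv i)).
have H2 : (Q - 1) * #|[pred y | upA W y (sv i)]|%:R = Q ^+ dn (sv i) - Q ^+ (dn (sv i) - da (sv i)).
  by rewrite -LA_ones incmx_ones.
rewrite mulrBr H1 H2 /b subnKC ?da_le_dn // opprB addrA subrK.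
by rewrite addr_ge0 // subr_ge0 exprn_ege1 // ltW // Q_gt1.
Qed.

Lemma perron a b u mu : wt W a b u -> u != 0 -> u *m cM a b = mu *: u -> `|mu| <= 1.
Proof.
move=> Hw Hu Hm.
have Hsum : `|mu| * (\sum_j `|u 0 j|) <= \sum_i `|u 0 i|.
  rewrite mulr_sumr.
  have H1 j : `|mu| * `|u 0 j| <= \sum_i `|u 0 i| * cM a b i j * (u 0 i != 0)%:R.
    rewrite -normrM; have -> : mu * u 0 j = (u *m cM a b) 0 j by rewrite Hm [RHS]mxE.
    rewrite [X in `|X|]mxE; apply: le_trans (ler_norm_sum _ _ _) _.
    apply: ler_sum => i _; rewrite normrM.
    have [->|Hi] := eqVneq (u 0 i) 0; first by rewrite normr0 !mul0r.
    rewrite mulr1 ler_wpM2l // ger0_norm //.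
    have [E1 E2] := Hw _ Hi.
    by have := cM_ge0 i j; rewrite E1 E2 addKn.
  apply: le_trans (ler_sum _ (fun j _ => H1 j)) _.
  rewrite exchange_big /=; apply: ler_sum => i _.
  have [->|Hi] := eqVneq (u 0 i) 0; first by rewrite normr0 big1 // => j _; rewrite !mul0r.
  have [E1 E2] := Hw _ Hi.
  under eq_bigr do rewrite mulr1.
  by rewrite -mulr_sumr; have := cM_row_sum i; rewrite E1 E2 addKn => ->; rewrite mulr1.
have Hpos : 0 < \sum_j `|u 0 j|.
  rewrite lt0r sumr_ge0 // andbT psumr_neq0 //.
  apply: contraR Hu => /hasPn H; apply/eqP/rowP => i; rewrite mxE; apply/eqP.
  by have := H i (mem_index_enum _); rewrite normr_gt0 negbK.
by rewrite -(ler_pM2r Hpos) mul1r.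
Qed.

Lemma act_vanish R n u : u != 0 -> iter_act R n u = 0 ->
  exists s, [/\ (s < n)%N, iter_act R s u != 0 & iter_act R s.+1 u = 0].
Proof.
move=> Hu; elim: n => [|n IH] H; first by rewrite /= in H; rewrite H eqxx in Hu.
have [H0|H0] := eqVneq (iter_act R n u) 0; last by exists n.
by have [s [? ? ?]] := IH H0; exists s; split=> //; apply: leqW.
Qed.

Lemma act_zero_ge R m n u : (m <= n)%N -> iter_act R m u = 0 -> iter_act R n u = 0.
Proof. by move=> H; rewrite -(subnK H) /iter_act iterD => ->; apply: act0. Qed.

Lemma eig_params j b u mu : low j b u -> u != 0 -> u *m cM j b = mu *: u ->
  exists h i, [/\ mu = (Q ^+ h)^-1, b = (h + i)%N, (2 * j + h <= k)%N & (2 * i + h + k <= D)%N] /\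
   [/\ forall s, iter_act RA s u = 0 -> (k < s + 2 * j + h)%N, iter_act RA (k - 2 * j - h).+1 u = 0,
       forall t, iter_act RB t u = 0 -> (D < t + 2 * i + h + k)%N &
       iter_act RB (D - k - h - 2 * i).+1 u = 0].
Proof.
move=> [Hw HA HB] Hu Hm; have [Hj Hb] := wt_le Hw Hu.
have [s [Hs Hs1 Hs2]] : exists s, [/\ (s < (k - j).+1)%N, iter_act RA s u != 0 & iter_act RA s.+1 u = 0].
  by apply: act_vanish => //; have H := wt_actRA (s := (k - j).+1) Hw; apply: (wt_big H); lia.
have [t [Ht Ht1 Ht2]] : exists t, [/\ (t < (D - k - b).+1)%N, iter_act RB t u != 0 & iter_act RB t.+1 u = 0].
  by apply: act_vanish => //; have H := wt_actRB (s := (D - k - b).+1) Hw; apply: (wt_big H); lia.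
have Es : Q ^+ (k - j - s) * mu = Q ^+ j.
  have := @stringA j b s u Hw HA; rewrite Hs2 mul0mx scaler0 Hm actZ scalerA -scalerBl scalerA.
  move=> /(_ ltac:(lia))/esym/eqP; rewrite scaler_eq0 (negPf Hs1) orbF !mulf_eq0.
  by rewrite (negPf (Q0 b)) (negPf (QX1_neq0 F C s)) subr_eq0 => /eqP.
have Et : Q ^+ (D - k - b - t) = Q ^+ b * mu.
  have := @stringB j b t u Hw HB Hj; rewrite Ht2 mul0mx scaler0 Hm actZ scalerA -scalerBl scalerA.
  move=> /(_ ltac:(lia))/esym/eqP; rewrite scaler_eq0 (negPf Ht1) orbF !mulf_eq0.
  by rewrite (negPf (Q0 _)) (negPf (QX1_neq0 F C t)) subr_eq0 => /eqP.
have Hle : (j <= k - j - s)%N.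
  have H1 : Q ^+ j <= Q ^+ (k - j - s).
    have := perron Hw Hu Hm; have Q0' n : 0 <= Q ^+ n by rewrite exprn_ge0 // ltW // Q_gt0.
    by move=> /(ler_wpM2l (Q0' (k - j - s)%N)); rewrite mulr1 -{1}(ger0_norm (Q0' _)) -normrM Es ger0_norm.
  by move: H1; rewrite -!natrX ler_nat leq_exp2l // q_gt1.
have Emu : mu = (Q ^+ (k - j - s - j))^-1.
  apply: (mulfI (Q0 (k - j - s))); rewrite Es; apply: (mulIf (Q0 (k - j - s - j))).
  by rewrite mulfVK ?Q0 // -exprD; congr (_ ^+ _); lia.
set h := (k - j - s - j)%N in Emu.
have Eb : (D - k - b - t + h = b)%N.
  by apply: (@QX_inj F C); rewrite exprD Et Emu mulfVK ?Q0.
exists h, (D - k - b - t)%N; split; first by split=> //; lia.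
split=> [s' Hs'||t' Ht'|].
- rewrite ltnNge; apply/negP => Hc; move/eqP: Hs1; apply; apply: act_zero_ge Hs'; lia.
- by rewrite (_ : (k - 2 * j - h).+1 = s.+1)%N //; lia.
- rewrite ltnNge; apply/negP => Hc; move/eqP: Ht1; apply; apply: act_zero_ge Ht'; lia.
by rewrite (_ : (D - k - h - 2 * _).+1 = t.+1)%N //; lia.
Qed.

End Weights.

(** The row space of [G] and the kernel of [G^T] are complementary. The bilinear form is not
    definite over [C], so a common vector is paired with its own conjugate, which lies in the same
    row space because [G] is real. *)
Lemma real_split (C : numClosedFieldType) m n (G : 'M[C]_(m, n)) (u : 'rV_n) :
  (forall i j, (G i j)^* = G i j) -> exists x y, u = x *m G + y /\ y *m G^T = 0.
Proof.
move=> HG.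
have Hcap : (G :&: kermx G^T)%MS = 0.
  apply/eqP/rowV0P => v; rewrite sub_capmx => /andP[/submxP[x Hx] /sub_kermxP Hv].
  have H0 : \sum_j `|v 0 j| ^+ 2 = 0.
    transitivity ((v *m G^T *m (map_mx Num.conj x)^T) 0 0); last by rewrite Hv mul0mx mxE.
    rewrite -mulmxA -trmx_mul mxE; apply: eq_bigr => j _; rewrite normCK; congr (_ * _).
    rewrite !mxE {1}Hx mxE rmorph_sum; apply: eq_bigr => l _.
    by rewrite rmorphM /= HG mxE.
  apply/rowP => j; rewrite mxE; apply/eqP; rewrite -normr_eq0 -sqrf_eq0; apply/eqP.
  by move/psumr_eq0P: H0 => -> // i _; rewrite exprn_ge0.
have : row_full (G + kermx G^T)%MS.
  rewrite /row_full; have := mxrank_sum_cap G (kermx G^T); rewrite Hcap mxrank0 addn0 => ->.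
  by rewrite mxrank_ker mxrank_tr subnKC // rank_leq_col.
move=> /(submx_full u) /sub_addsmxP[[x y] /= Hu].
by exists x, (y *m kermx G^T); split=> //; rewrite -mulmxA mulmx_ker mulmx0.
Qed.

Section EigSplit.
Variables (C : fieldType) (N : nat) (M : 'M[C]_N) (Kp S : 'rV[C]_N -> Prop).
Hypothesis Kp_lin : forall c u v, Kp u -> Kp v -> Kp (c *: u + v).
Hypothesis Kp_M : forall u, Kp u -> Kp (u *m M).
Hypothesis S_lin : forall c u v, S u -> S v -> S (c *: u + v).
Hypothesis S0 : S 0.

Let f (u : 'rV[C]_N) r := u *m M - r *: u.

Let fC u r r' : f (f u r) r' = f (f u r') r.
Proof.
rewrite /f !mulmxBl -!scalemxAl; move: (u *m M *m M) (u *m M) => X Y.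
by apply/rowP => i; rewrite !mxE; ring.
Qed.

(** For distinct roots [r1] and [r2], the vectors [f u r1] and [f u r2] are each killed by a product
    that is one factor shorter, and [u] is a multiple of their difference. *)
Lemma eig_split rs u : uniq rs ->
  (forall u r, r \in rs -> Kp u -> u *m M = r *: u -> S u) ->
  Kp u -> foldl f u rs = 0 -> S u.
Proof.
move: {2}(size rs) (erefl (size rs)) => n.
have Kf v r : Kp v -> Kp (f v r).
  by move=> Kv; rewrite /f addrC -scaleNr; apply: Kp_lin => //; apply: Kp_M.
elim: n rs u => [|n IH] [|r1 [|r2 rs]] u //= Hn.
- by move=> _ _ _ ->.
- by move=> _ H Ku /eqP; rewrite subr_eq0 => /eqP; apply: H; rewrite ?mem_head.
rewrite in_cons negb_or -andbA => /and4P[Hr12 Hr1 Hr2 Hu] HS Ku H0.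
have S1 : S (f u r1).
  apply: (IH (r2 :: rs)) => //=; [by case: Hn => ->|by rewrite Hr2| |exact: Kf].
  by move=> v r Hr; apply: HS; rewrite in_cons Hr orbT.
have S2 : S (f u r2).
  apply: (IH (r1 :: rs)) => //=; [by case: Hn => ->|by rewrite Hr1| |exact: Kf|by rewrite fC].
  move=> v r; rewrite in_cons => Hr; apply: HS.
  by rewrite !in_cons; case/orP: Hr => ->; rewrite ?orbT.
have -> : u = (r2 - r1)^-1 *: f u r1 + (- (r2 - r1)^-1 *: f u r2 + 0).
  have Hne : r2 - r1 != 0 by rewrite subr_eq0 eq_sym.
  have E : f u r1 - f u r2 = (r2 - r1) *: u.
    by rewrite /f; move: (u *m M) => X; apply/rowP => i; rewrite !mxE; ring.
  by rewrite addr0 scaleNr -scalerBr E scalerA mulVf ?scale1r.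
by apply: S_lin => //; apply: S_lin.
Qed.

End EigSplit.

(** * Generation of all functions by lowest-weight vectors *)

Section Generation.
Variables (F : finFieldType) (D : nat) (W : subsp F D) (C : numClosedFieldType).
Local Notation k := (dn W).
Local Notation N := #|{: subsp F D}|.
Local Notation da := (da W).
Local Notation Q := (#|F|%:R : C).
Local Notation RA := (RA W C).
Local Notation LA := (LA W C).
Local Notation RB := (RB W C).
Local Notation LB := (LB W C).
Local Notation Q0 := (QX_neq0 F C).
Implicit Types u v w : 'rV[C]_N.

(** The eigenvalue that [stringA] forces on an eigenvector whose [RA]-string has its last nonzero
    term at [s]. *)
Let root j s : C := Q ^+ j / Q ^+ (k - j - s).

(** One factor shortens the string by one: by [stringA], the image of [u] under [cM] minus the root
    has an [RA]-power proportional to [LA] applied to the next power of [u], which is zero. The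
    roots are distinct, so [cM] is diagonalisable on lowest-weight vectors. *)
Lemma low_kill j b s u : low W j b u -> (j <= k)%N -> (s <= (k - j).+1)%N -> iter_act RA s u = 0 ->
  foldl (fun v r => v *m cM W C j b - r *: v) u [seq root j s' | s' <- rev (iota 0 s)] = 0.
Proof.
move=> Hl Hj; elim: s u Hl => [|s IH] u Hl Hs H0 //=.
have -> : rev (iota 0 s.+1) = s :: rev (iota 0 s).
  by rewrite -[s.+1]addn1 iotaD rev_cat /= add0n.
apply: IH; last 1 first.
- have [Hw HA HB] := Hl.
  have := @stringA F D W C j b s u Hw HA; rewrite H0 mul0mx scaler0 -!actZ -actB.
  move=> /(_ ltac:(lia))/esym/eqP; rewrite scaler_eq0 mulf_eq0 (negPf (Q0 b)) (negPf (QX1_neq0 F C s)) /=.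
  move=> /eqP H; apply: (scalerI (Q0 (k - j - s))); rewrite scaler0 -H -actZ; congr (iter_act _ _ _).
  by rewrite scalerBr scalerA /root mulrCA mulfV ?mulr1 ?Q0.
- by rewrite addrC -scaleNr; apply: lowD; [apply: lowZ|apply: low_cM].
- exact: ltnW.
Qed.

(** [Kp] is any [cM]-stable space of lowest-weight vectors: all of them in [generation], those with
    truncated strings in [lowest_exists]. *)
Lemma low_ind j b (Kp S : 'rV[C]_N -> Prop) :
  (forall u, Kp u -> low W j b u) ->
  (forall c u v, Kp u -> Kp v -> Kp (c *: u + v)) ->
  (forall u, Kp u -> Kp (u *m cM W C j b)) ->
  (forall c u v, S u -> S v -> S (c *: u + v)) -> S 0 ->
  (forall u mu, Kp u -> u != 0 -> u *m cM W C j b = mu *: u -> S u) ->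
  forall u, Kp u -> S u.
Proof.
move=> Kl Klin KM Slin S0 SE u Ku.
have [->|Hu] := eqVneq u 0; first exact: S0.
have [Hw _ _] := Kl _ Ku; have [Hj Hb] := wt_le Hw Hu.
have HR : iter_act RA (k - j).+1 u = 0.
  by have H := wt_actRA (s := (k - j).+1) Hw; apply: (wt_big H); lia.
apply: (eig_split Klin KM Slin S0 _ _ Ku (low_kill (Kl _ Ku) Hj (leqnn _) HR)).
  rewrite map_inj_in_uniq ?rev_uniq ?iota_uniq // => s s'; rewrite !mem_rev !mem_iota /root => H1 H2 E.
  have : Q ^+ (k - j - s) = Q ^+ (k - j - s').
    by apply: invr_inj; apply: (mulfI (Q0 j)).
  by move/(@QX_inj F C); lia.
move=> v r _ Kv Hv; have [->|Hv0] := eqVneq v 0; first exact: S0.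
exact: SE Kv Hv0 Hv.
Qed.

Definition proj a n u : 'rV[C]_N := \row_i (u 0 i *+ ((da (sv i) == a) && (dn (sv i) == n))).

Lemma proj_wt a n u : wt W a (n - a) (proj a n u).
Proof.
move=> i; rewrite mxE; case: andP => [[/eqP H1 /eqP H2] _|_]; last by rewrite mulr0n eqxx.
by rewrite H1 H2 subnKC // -H1 -H2 da_le_dn.
Qed.

(** If all nonzero entries of a column sit in rows of one weight, no cancellation between different
    weights can occur. *)
Lemma proj_kill a n u (M : 'M[C]_N) :
  (forall i i' j, M i j != 0 -> M i' j != 0 -> da (sv i) = da (sv i') /\ dn (sv i) = dn (sv i')) ->
  u *m M = 0 -> proj a n u *m M = 0.
Proof.
move=> HM Hu; apply/rowP => j; rewrite [RHS]mxE.
case: (pickP (fun i => [&& M i j != 0, da (sv i) == a & dn (sv i) == n])) => [i /and3P[Hi /eqP H1 /eqP H2]|H0].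
  have /rowP/(_ j) := Hu; rewrite [RHS]mxE mxE => E.
  rewrite mxE -[RHS]E; apply: eq_bigr => i' _; rewrite mxE.
  have [->|Hi'] := eqVneq (M i' j) 0; first by rewrite !mulr0.
  by have [<- <-] := HM _ _ _ Hi Hi'; rewrite H1 H2 !eqxx.
rewrite mxE big1 // => i _; rewrite mxE; have := H0 i; have [->|_] := eqVneq (M i j) 0; first by rewrite mulr0.
by move=> /= ->; rewrite mulr0n mul0r.
Qed.

Lemma proj_sum u : u = \sum_(a < D.+1) \sum_(n < D.+1) proj a n u.
Proof.
apply/rowP => i; rewrite summxE.
have Hn : (dn (sv i) < D.+1)%N by rewrite ltnS dn_le.
have Ha : (da (sv i) < D.+1)%N by apply: leq_ltn_trans Hn; apply: da_le_dn.
rewrite (bigD1 (Ordinal Ha)) //= summxE (bigD1 (Ordinal Hn)) //= mxE !eqxx mulr1n.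
rewrite !big1 ?addr0 // => [a Ha'|n Hn'].
  rewrite summxE big1 // => n _; rewrite mxE.
  have -> : (da (sv i) == a) = false by apply: contraNF Ha' => /eqP E; apply/eqP/val_inj.
  by rewrite mulr0n.
rewrite mxE; have -> : (dn (sv i) == n) = false by apply: contraNF Hn' => /eqP E; apply/eqP/val_inj.
by rewrite andbF mulr0n.
Qed.

Lemma generation (S : 'rV[C]_N -> Prop) :
  (forall c u v, S u -> S v -> S (c *: u + v)) ->
  (forall u, S u -> S (u *m RA)) -> (forall u, S u -> S (u *m RB)) ->
  (forall j b u mu, low W j b u -> u != 0 -> u *m cM W C j b = mu *: u -> S u) ->
  S 0 -> forall u, S u.
Proof.
move=> Slin SA SB SE S0.
have Sadd u v : S u -> S v -> S (u + v) by move=> Hu Hv; rewrite -[u]scale1r; apply: Slin.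
have Slow j b u : low W j b u -> S u.
  move=> Hl; apply: (@low_ind j b (low W j b) S) Hl => //; first last.
  - by move=> v mu; apply: SE.
  - by move=> v; apply: low_cM.
  by move=> c v w Hv Hw; apply: lowD => //; apply: lowZ.
have Sker u : u *m LA = 0 -> u *m LB = 0 -> S u.
  move=> HA HB; rewrite [u]proj_sum.
  elim/big_ind: _ => // a _; elim/big_ind: _ => // n _.
  apply: (Slow a (n - a)%N); split; first exact: proj_wt.
    apply: proj_kill HA => i i' j; rewrite !mxE !pnatr_b => /upAP[_ _ -> ->] /upAP[_ _ -> ->].
    by [].
  by apply: proj_kill HB => i i' j; rewrite !mxE !pnatr_b => /upBP[_ _ -> ->] /upBP[_ _ -> ->].
have Hdec u : exists x y z : 'rV[C]_N, u = x *m RA + y *m RB + z /\ z *m LA = 0 /\ z *m LB = 0.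
  have [|x [z [Hu]]] := @real_split C _ _ (col_mx RA RB) u.
    move=> i j; rewrite mxE; case: split => l; rewrite mxE; exact: conjC_nat.
  rewrite tr_col_mx RA_tr RB_tr mul_mx_row -row_mx0 => /eq_row_mx[HA HB].
  by exists (lsubmx x), (rsubmx x), z; split=> //; rewrite Hu -{1}[x]hsubmxK mul_row_col.
pose I m u := forall i, u 0 i != 0 -> (m <= dn (sv i))%N.
have IM m (M : 'M[C]_N) u : (forall i j, M i j != 0 -> dn (sv j) = (dn (sv i)).+1) ->
    I m u -> I m.+1 (u *m M).
  move=> HM Hu j; rewrite mxE => Hs.
  case: (pickP (fun i => (u 0 i != 0) && (M i j != 0))) => [i /andP[/Hu H1 /HM ->]|H0] //.
  case/eqP: Hs; apply: big1 => i _; have := H0 i.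
  by rewrite -negb_or -mulf_eq0 => /negbFE/eqP.
(* The raised part of a decomposition is decomposed again. After [m] rounds what is not yet in [S]
   has been raised [m] times and lives in dimension at least [m]; nothing is left at [D.+1]. *)
have HI m u : exists v w, [/\ u = v + w, I m v & S w].
  elim: m u => [|m IH] u; first by exists u, 0; rewrite addr0; split.
  have [x [y [z [Hu [HA HB]]]]] := Hdec u.
  have [x1 [x2 [Ex Ix Sx]]] := IH x; have [y1 [y2 [Ey Iy Sy]]] := IH y.
  exists (x1 *m RA + y1 *m RB), (x2 *m RA + y2 *m RB + z); split.
  - by rewrite Hu Ex Ey !mulmxDl; rewrite !addrA; congr (_ + _ + _); rewrite addrAC.
  - move=> i; rewrite mxE => H; have [H0|H0] := eqVneq ((x1 *m RA) 0 i) 0.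
      rewrite H0 add0r in H; apply: (IM m RB y1) H => // a b; rewrite mxE pnatr_b.
      by case/upBP.
    by apply: (IM m RA x1) H0 => // a b; rewrite mxE pnatr_b; case/upAP.
  - by apply: (Sadd); [apply: (Sadd); [apply: SA|apply: SB]|apply: Sker].
move=> u; have [v [w [-> Hv Sw]]] := HI D.+1 u.
have -> : v = 0.
  apply/rowP => i; rewrite mxE; apply/eqP; apply/negPn/negP => /Hv.
  by have := dn_le (sv i); lia.
by rewrite add0r.
Qed.

End Generation.

(** * Modules generated by lowest-weight vectors *)

(* [(h, i, j)] parses as [((h, i), j)]: its components are [t.1.1], [t.1.2] and [t.2]. *)
Definition kind : Type := (nat * nat * nat)%type.

Section KindData.
Variables (C : fieldType) (Q : C) (D k : nat).
Implicit Type t : kind.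

(* The lowest value of dim(x :&: x_0) on the module: max(j, i - (D - 2k)), where the truncated
   subtraction does no harm because [j >= 0]. *)
Definition klo t := maxn t.2 (t.1.2 - (D - 2 * k))%N.
(** The highest weight is [k - h - max(i, j)]: the bound [k - h - i] comes from a nonnegative number
    of [RB] steps, and [k - h - j] from the end of the [RA]-string. *)
Definition klen t := ((k - t.1.1 - maxn t.1.2 t.2).+1 - klo t)%N.

(** In each of the two pairs the sum of the exponents depends on [h] only, so for given [h] the
    first pair determines [j] and the second determines [i], see [pow_sum_inj]. *)
Definition kS t : C := Q ^+ (k - t.1.1 - t.2).+1 + Q ^+ t.2
  + Q ^+ (D - k - t.1.1 - t.1.2).+1 + Q ^+ t.1.2.

(** The contributions of [LA] followed by [RA] and of [LB] followed by [RB], less the scalar of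
    [Atot], arranged so that the type enters only through [kS] and [h]; see [kal_cXY]. *)
Definition kal t a : C :=
  (Q ^+ (k - a) * (kS t - Q ^+ a - Q ^+ (D - 2 * k + a).+1) - (Q + 1) * Q ^+ (2 * (k - a) - t.1.1))
    / (Q - 1) ^+ 2 - (Q ^+ k - 1) / (Q - 1).

(** The coefficient of the step down times that of the step up, since the normalisation moves the
    latter below the diagonal; see [kbe_cXY]. *)
Definition kbe t a : C := Q ^+ (2 * (k - a)).-1 * (Q ^+ (a.+1 - t.2) - 1) *
  (Q ^+ (k - t.1.1 - a) - Q ^+ t.2) * (Q ^+ (k - a - t.1.1) - Q ^+ t.1.2) *
  (Q ^+ ((D - 2 * k + a).+1 - t.1.2) - 1) / (Q - 1) ^+ 4.

Definition kvalid t := [&& (2 * t.2 + t.1.1 <= k)%N, (2 * t.1.2 + t.1.1 + k <= D)%N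
  & (t.1.1 + t.1.2 + t.2 <= k)%N].

End KindData.

Section Modules.
Variables (F : finFieldType) (D : nat) (W : subsp F D) (C : numClosedFieldType).
Local Notation k := (dn W).
Local Notation N := #|{: subsp F D}|.
Local Notation da := (da W).
Local Notation Q := (#|F|%:R : C).
Local Notation RA := (RA W C).
Local Notation LA := (LA W C).
Local Notation RB := (RB W C).
Local Notation LB := (LB W C).
Local Notation Q0 := (QX_neq0 F C).

Definition vst u s t := iter_act RB t (iter_act RA s u).

(** The scalar by which [LA] steps down the [RA]-string. It does not depend on [t] because [LA]
    commutes with [RB]. *)
Definition cX h i j s : C :=
  Q ^+ (h + i) * (Q ^+ s - 1) * (Q ^+ (k - j - s - h).+1 - Q ^+ j) / (Q - 1) ^+ 2.

Definition cY h i j s t : C :=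
  Q ^+ (k - j - s) * (Q ^+ t - 1) * (Q ^+ (D - k - h - i - t).+1 - Q ^+ i) / (Q - 1) ^+ 2.

(* The last four conditions fix the lengths of the strings generated by [RA] and [RB]. *)
Definition lowest h i j u := [/\ low W j (h + i) u,
  u *m cM W C j (h + i) = (Q ^+ h)^-1 *: u, u != 0 &
  [/\ iter_act RA (k - 2 * j - h).+1 u = 0, iter_act RB (D - k - h - 2 * i).+1 u = 0,
     (2 * j + h <= k)%N & (2 * i + h + k <= D)%N]].

Section Fixed.
Variables (h i j : nat) (u : 'rV[C]_N).
Hypothesis Hu : lowest h i j u.
Local Notation v := (vst u).

Let Q12 : (Q - 1) ^+ 2 != 0. Proof. by rewrite expf_neq0 // Q1_neq0. Qed.

Lemma vst_wt s t : wt W (j + s) (h + i + t) (v s t).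
Proof. by have [[Hw _ _] _ _ _] := Hu; apply: wt_actRB; apply: wt_actRA. Qed.

Lemma vst_top_s s t : (k - 2 * j - h < s)%N -> v s t = 0.
Proof.
have [_ _ _ [Hs _ _ _]] := Hu.
by move=> H; rewrite /vst (act_zero_ge H Hs) act0.
Qed.

Lemma vst_top_t s t : (D - k - h - 2 * i < t)%N -> v s t = 0.
Proof.
have [_ _ _ [_ Ht _ _]] := Hu.
move=> H; rewrite /vst; elim: s => [|s IH]; first exact: act_zero_ge H Ht.
(* [RA] moves past the power of [RB] at the cost of a power of [Q], so the end of the [RB]-string at
   [s = 0] carries over to every [s]. *)
apply: (scalerI (Q0 t)); rewrite scaler0 actS -act_RB_RA.
by rewrite IH mul0mx.
Qed.

Lemma vst_LA0 t : v 0 t *m LA = 0.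
Proof. by have [[_ HA _] _ _ _] := Hu; rewrite /vst act_comm ?LARB // HA act0. Qed.

Lemma vst_LA s t : (s.+1 <= k - 2 * j - h)%N -> v s.+1 t *m LA = cX h i j s.+1 *: v s t.
Proof.
have [[Hw HA _] Hm _ [_ _ Hj Hi]] := Hu => Hs.
rewrite /vst act_comm ?LARB //.
apply: (scalerI Q12); rewrite -[LHS]actZ (stringA Hw HA); last by lia.
rewrite Hm [iter_act RA s (_ *: u)]actZ scalerA -scalerBl scalerA actZ scalerA; congr (_ *: _); rewrite /cX.
have -> : (k - j - s.+1 - h).+1 = (k - j - s - h)%N by lia.
have -> : Q ^+ (k - j - s) / Q ^+ h = Q ^+ (k - j - s - h).
  by apply: (mulIf (Q0 h)); rewrite mulfVK ?Q0 // -exprD; congr (_ ^+ _); lia.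
by rewrite [RHS]mulrC mulfVK.
Qed.

Let vLB_act s : iter_act RA s u *m LB = 0.
Proof. by have [[_ _ HB] _ _ _] := Hu; rewrite act_comm ?HB ?act0 // LBRA. Qed.

Lemma vst_LB0 s : v s 0 *m LB = 0.
Proof. exact: vLB_act. Qed.

Lemma vst_LB s t : (s <= k - 2 * j - h)%N -> (t.+1 <= D - k - h - 2 * i)%N ->
  v s t.+1 *m LB = cY h i j s t.+1 *: v s t.
Proof.
have [[Hw HA HB] Hm _ [_ _ Hj Hi]] := Hu => Hs Ht.
apply: (scalerI Q12); rewrite (stringB (wt_actRA (s := s) Hw) (vLB_act s)); [|lia|lia].
rewrite act_RA_cM // Hm [iter_act RA s (_ *: u)]actZ actZ scalerA -scalerBl !scalerA; congr (_ *: _); rewrite /cY.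
have -> : (D - k - h - i - t.+1).+1 = (D - k - (h + i) - t)%N by lia.
have -> : Q ^+ (h + i) / Q ^+ h = Q ^+ i by rewrite exprD mulrAC mulfV ?mul1r ?Q0.
rewrite (_ : (k - (j + s) = k - j - s)%N); last by lia.
by rewrite [RHS]mulrC mulfVK.
Qed.

Lemma vst_RA s t : v s t *m RA = Q ^+ t *: v s.+1 t.
Proof. by rewrite /vst act_RB_RA. Qed.

Lemma vst_RB s t : v s t *m RB = v s t.+1.
Proof. by []. Qed.

Lemma vst_LARA s t : (s <= k - 2 * j - h)%N -> v s t *m LA *m RA = (cX h i j s * Q ^+ t) *: v s t.
Proof.
case: s => [|s] Hs; first by rewrite vst_LA0 mul0mx /cX expr0 subrr mulr0 !mul0r scale0r.
by rewrite vst_LA // -scalemxAl vst_RA scalerA.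
Qed.

Lemma vst_LBRB s t : (s <= k - 2 * j - h)%N -> (t <= D - k - h - 2 * i)%N ->
  v s t *m LB *m RB = cY h i j s t *: v s t.
Proof.
case: t => [|t] Hs Ht; first by rewrite vst_LB0 mul0mx /cY expr0 subrr mulr0 !mul0r scale0r.
by rewrite vst_LB // -scalemxAl vst_RB.
Qed.

Lemma cY_neq0 s t : (t.+1 <= D - k - h - 2 * i)%N -> (2 * i + h + k <= D)%N -> cY h i j s t.+1 != 0.
Proof.
move=> Ht Hi; rewrite /cY !mulf_neq0 ?Q0 ?invr_eq0 ?QX1_neq0 //.
by rewrite subr_eq0; apply/eqP => /(@QX_inj F C); lia.
Qed.

Lemma vst_neq0 s t : (forall s', iter_act RA s' u = 0 -> (k < s' + 2 * j + h)%N) ->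
  (s <= k - 2 * j - h)%N -> (t <= D - k - h - 2 * i)%N -> v s t != 0.
Proof.
have [_ _ _ [_ _ Hj Hi]] := Hu.
move=> H Hs; elim: t => [|t IH] Ht; first by apply/eqP => /H; lia.
apply: contraNneq (IH (ltnW Ht)) => H0; move: (vst_LB Hs Ht); rewrite H0 mul0mx.
by move=> /esym/eqP; rewrite scaler_eq0 (negPf (cY_neq0 s Ht Hi)).
Qed.

Local Notation t0 := (h, i, j).
Local Notation lo := (klo D k t0).
Local Notation len := (klen D k t0).
Hypothesis Hv : kvalid D k t0.
Hypothesis HkD : (2 * k <= D)%N.

Definition ev_s m := (lo + m - j)%N.
Definition ev_t m := (k - h - i - (lo + m))%N.

(** The product of the coefficients of [LB] followed by [RA]; scaling by it turns the superdiagonal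
    of [Atot] into ones, as [chain] requires. *)
Fixpoint ev_c m : C :=
  if m is m'.+1 then ev_c m' * (cY h i j (ev_s m') (ev_t m') * Q ^+ (ev_t m').-1) else 1.

Definition ev m := ev_c m *: v (ev_s m) (ev_t m).

(* Going down and up again, a k-space returns to itself through each of its (Q^k - 1) / (Q - 1)
   hyperplanes and otherwise reaches its neighbours. *)
Definition Atot : 'M[C]_N := (LA + LB) *m (RA + RB) - ((Q ^+ k - 1) / (Q - 1))%:M.

Lemma kal_cXY a : (lo <= a)%N -> (a <= k - h - maxn i j)%N ->
  kal Q D k t0 a = cX h i j (a - j) * Q ^+ (k - h - i - a) + cY h i j (a - j) (k - h - i - a)
    - (Q ^+ k - 1) / (Q - 1).
Proof.
clear Hu; move: Hv; rewrite /kvalid /klo /= => /and3P[H1 H2 H3] Hlo Hhi.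
rewrite /kal /cX /cY /kS /=; congr (_ - _); rewrite mulrAC -mulrDl; congr (_ / _).
have [s Es] : exists s, a = (j + s)%N by exists (a - j)%N; lia.
have [t Et] : exists t, k = (h + i + a + t)%N by exists (k - h - i - a)%N; lia.
have [r Er] : exists r, (k = h + j + a + r)%N by exists (k - h - j - a)%N; lia.
have [p Ep] : exists p, (D = k + h + 2 * i + t + p)%N by exists (D - (k + h + 2 * i + t))%N; lia.
have -> : (k - h - j).+1 = (a + r).+1 by lia.
have -> : (D - k - h - i).+1 = (i + t + p).+1 by lia.
have -> : (k - a = h + i + t)%N by lia.
have -> : (D - 2 * k + a).+1 = (i + p).+1 by lia.
have -> : (2 * (h + i + t) - h = h + (i + t) + (j + r))%N by lia.
have -> : (k - j - (a - j) - h).+1 = (j + r).+1 by lia.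
have -> : (a - j = s)%N by lia.
have -> : (k - h - i - a = t)%N by lia.
have -> : (k - j - s = h + i + t)%N by lia.
have -> : (D - k - h - i - t).+1 = (i + p).+1 by lia.
(* Both exponents equal [k - h - a]; this is the one relation between the powers that the identity
   needs. *)
have Eht : Q ^+ i * Q ^+ t = Q ^+ j * Q ^+ r by rewrite -!exprD; congr (_ ^+ _); lia.
rewrite Es !exprS !exprD.
move: (Q ^+ i) (Q ^+ t) (Q ^+ j) (Q ^+ r) (Q ^+ h) (Q ^+ s) (Q ^+ p) Eht => qi qt qj qr qh qs qp E.
move: Q => q.
ring: E.
Qed.


Lemma kbe_cXY a : (lo <= a)%N -> (a < k - h - maxn i j)%N ->
  kbe Q D k t0 a = cX h i j (a - j).+1 *
    (cY h i j (a - j) (k - h - i - a) * Q ^+ (k - h - i - a).-1).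
Proof.
clear Hu; move: Hv; rewrite /kvalid /klo /= => /and3P[H1 H2 H3] Hlo Hhi.
rewrite /kbe /cX /cY /=.
have [s Es] : exists s, a = (j + s)%N by exists (a - j)%N; lia.
have [t Et] : exists t, k = (h + i + a + t.+1)%N by exists (k - h - i - a).-1; lia.
have [r Er] : exists r, (k = h + j + a + r)%N by exists (k - h - j - a)%N; lia.
have [p Ep] : exists p, (D + a.+1 = 2 * k + i + p)%N by exists (D + a.+1 - 2 * k - i)%N; lia.
have -> : (k - h - a = j + r)%N by lia.
have -> : (k - a - h = i + t.+1)%N by lia.
have -> : (a.+1 - j = s.+1)%N by lia.
have -> : ((D - 2 * k + a).+1 - i = p)%N by lia.
have -> : (a - j = s)%N by lia.
have -> : (k - h - i - a = t.+1)%N by lia.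
have -> : (D - k - h - i - t.+1).+1 = (i + p)%N by lia.
have -> : (k - j - s.+1 - h).+1 = (j + r)%N by lia.
have -> : (k - j - s = h + i + t.+1)%N by lia.
have -> : ((2 * (k - a)).-1 = h + i + t + (h + i + t.+1))%N by lia.
rewrite /= !exprD; have := Q1_neq0 F C.
move: (Q ^+ i) (Q ^+ t.+1) (Q ^+ t) (Q ^+ j) (Q ^+ r) (Q ^+ h) (Q ^+ s.+1) (Q ^+ p) => qi qt1 qt qj qr qh qs qp.
by move: Q => q Hq; field.
Qed.

Lemma lenP m : (m < len)%N ->
  [/\ (ev_s m <= k - 2 * j - h)%N, (ev_t m <= D - k - h - 2 * i)%N,
      (lo + m <= k - h - maxn i j)%N, (j + ev_s m = lo + m)%N & (h + i + ev_t m = k - (lo + m))%N].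
Proof.
move: Hv; rewrite /kvalid /ev_s /ev_t /klen /klo /= => /and3P[H1 H2 H3] Hm.
by clear Hu; split; lia.
Qed.

Lemma ev_wt m : (m < len)%N -> wt W (lo + m) (k - (lo + m)) (ev m).
Proof. by move=> /lenP[_ _ _ H1 H2]; rewrite -H2 -H1; apply: wtZ; apply: vst_wt. Qed.

Lemma ev_tS m : (m.+1 < len)%N -> ev_t m = (ev_t m.+1).+1.
Proof. by move=> /lenP[_ _]; rewrite /ev_t; lia. Qed.

Lemma ev_sS m : ev_s m.+1 = (ev_s m).+1.
Proof. by rewrite /ev_s /klo /=; lia. Qed.

Lemma ev_cS m : ev_c m.+1 = ev_c m * (cY h i j (ev_s m) (ev_t m) * Q ^+ (ev_t m).-1).
Proof. by []. Qed.

Lemma ev_c_neq0 m : (m < len)%N -> ev_c m != 0.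
Proof.
elim: m => [|m IH] Hm; first exact: oner_neq0.
have Hm' := ltnW Hm; have [Hs Ht _ _ _] := lenP Hm'.
have [_ _ _ [_ _ _ Hi]] := Hu.
by rewrite (ev_tS Hm) in Ht; rewrite ev_cS (ev_tS Hm); apply: mulf_neq0; [exact: IH|apply: mulf_neq0; [exact: cY_neq0|exact: Q0]].
Qed.

Lemma ev_neq0 m : (forall s', iter_act RA s' u = 0 -> (k < s' + 2 * j + h)%N) -> (m < len)%N -> ev m != 0.
Proof.
move=> H Hm; have [Hs Ht _ _ _] := lenP Hm.
by rewrite scaler_eq0 negb_or ev_c_neq0 //= vst_neq0.
Qed.

(** At the last [m] either no [RB] step is left and [LB] kills the vector, or the [RA]-string is
    exhausted. The lower end in [ev_down] is reached in the two mirrored ways. *)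
Lemma ev_up m : (m < len)%N -> ev m *m LB *m RA = if (m.+1 < len)%N then ev m.+1 else 0.
Proof.
move=> Hm; have [Hs Ht _ E1 E2] := lenP Hm; rewrite /ev -!scalemxAl.
case: ifP => Hm1.
  have E := ev_tS Hm1; rewrite E in Ht.
  rewrite ev_cS ev_sS {1}E vst_LB // -scalemxAl vst_RA !scalerA.
  by rewrite E /= mulrA.
case Et: (ev_t m) => [|t]; first by rewrite vst_LB0 mul0mx scaler0.
rewrite Et in Ht E2; rewrite vst_LB // -scalemxAl vst_RA vst_top_s ?scaler0 //.
by move: Hv Hm Hm1 E1 E2; clear; rewrite /kvalid /klen /klo /=; lia.
Qed.

Lemma ev_down m : (m < len)%N ->
  ev m *m LA *m RB = if m is m'.+1 then kbe Q D k t0 (lo + m') *: ev m' else 0.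
Proof.
move=> Hm; have [Hs Ht _ E1 E2] := lenP Hm; rewrite /ev -!scalemxAl.
case: m Hm Hs Ht E1 E2 => [|m] Hm Hs Ht E1 E2; last first.
  have [_ _ Hhi _ _] := lenP Hm.
  rewrite ev_sS vst_LA -?ev_sS // -scalemxAl vst_RB -ev_tS // !scalerA; congr (_ *: _).
  rewrite kbe_cXY ?leq_addr //; last by lia.
  by rewrite ev_cS -/(ev_s m) -/(ev_t m) ev_sS; ring.
case Es: (ev_s 0) => [|s]; first by rewrite vst_LA0 mul0mx scaler0.
rewrite Es in Hs E1; rewrite vst_LA // -scalemxAl vst_RB vst_top_t ?scaler0 //.
by move: Hv Hm E1; clear; rewrite /ev_t /kvalid /klen /klo /=; lia.
Qed.

Lemma ev_Atot m : (m < len)%N -> ev m *m Atot = (if (m.+1 < len)%N then ev m.+1 else 0)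
  + kal Q D k t0 (lo + m) *: ev m + (if m is m'.+1 then kbe Q D k t0 (lo + m') *: ev m' else 0).
Proof.
move=> Hm; have [Hs Ht Hhi E1 E2] := lenP Hm.
rewrite /Atot mulmxBr mulmxA !(mulmxDr, mulmxDl) ev_up // ev_down // mul_mx_scalar.
rewrite kal_cXY ?leq_addr //.
have -> : ev m *m LA *m RA = (cX h i j (lo + m - j) * Q ^+ (k - h - i - (lo + m))) *: ev m.
  by rewrite /ev -!scalemxAl vst_LARA // !scalerA mulrC.
have -> : ev m *m LB *m RB = cY h i j (lo + m - j) (k - h - i - (lo + m)) *: ev m.
  by rewrite /ev -!scalemxAl vst_LBRB // !scalerA mulrC.
move: (cX _ _ _ _ * _) (cY _ _ _ _ _) (if _ then _ else _) (match m with 0 => _ | _ => _ end) => x y z w.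
move: (ev m) => e; apply/rowP => l; rewrite !mxE; ring.
Qed.

End Fixed.
End Modules.

(** * Restriction to the [k]-dimensional subspaces *)

Section Vertices.
Variables (F : finFieldType) (D : nat) (W : subsp F D) (C : numClosedFieldType).
Local Notation k := (dn W).
Local Notation N := #|{: subsp F D}|.
Local Notation n := (nV F D k).
Local Notation da := (da W).
Local Notation Q := (#|F|%:R : C).
Local Notation RA := (RA W C).
Local Notation LA := (LA W C).
Local Notation RB := (RB W C).
Local Notation LB := (LB W C).
Local Notation Q0 := (QX_neq0 F C).
Local Notation Atot := (Atot W C).

Lemma vtxP (i : 'I_n) : (<<vtx i>>%MS == vtx i) && (\rank (vtx i) == k).
Proof. by have := enum_valP i; rewrite inE. Qed.

Definition lv (i : 'I_n) : 'I_N := enum_rank (exist _ (vtx i) (proj1 (andP (vtxP i))) : subsp F D).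

Lemma sv_lv i : val (sv (lv i)) = vtx i.
Proof. by rewrite /sv /lv enum_rankK. Qed.

Lemma dn_lv i : dn (sv (lv i)) = k.
Proof. by rewrite /dn sv_lv; have /andP[_ /eqP] := vtxP i. Qed.

Lemma da_lv i : da (sv (lv i)) = dimI (vtx i) (val W).
Proof. by rewrite /dimI -sv_lv. Qed.

Lemma lv_inj : injective lv.
Proof. by move=> i i' E; apply: enum_val_inj; rewrite -[enum_val i]sv_lv -[enum_val i']sv_lv E. Qed.

Lemma lv_ex l : dn (sv l) = k -> exists i, l = lv i.
Proof.
move=> Hl; have H : val (sv l) \in Lk F D k by rewrite inE (valP (sv l)) -Hl eqxx.
exists (enum_rank_in H (val (sv l))); apply: (@sv_inj F D); apply: val_inj.
by rewrite sv_lv /vtx enum_rankK_in.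
Qed.

(** Right multiplication restricts a function on all subspaces to the vertices; its transpose
    extends by zero. *)
Definition vtx_mx : 'M[C]_(N, n) := \matrix_(l, i) (l == lv i)%:R.

Lemma mulJ m (M : 'M[C]_(m, N)) r i : (M *m vtx_mx) r i = M r (lv i).
Proof.
rewrite mxE (bigD1 (lv i)) //= big1 ?addr0; first by rewrite mxE eqxx mulr1.
by move=> l /negPf Hl; rewrite mxE Hl mulr0.
Qed.

Lemma mulJt m (M : 'M[C]_(N, m)) r i : (vtx_mx^T *m M) i r = M (lv i) r.
Proof.
rewrite mxE (bigD1 (lv i)) //= big1 ?addr0; first by rewrite !mxE eqxx mul1r.
by move=> l /negPf Hl; rewrite !mxE Hl mul0r.
Qed.

Lemma JJt (u : 'rV[C]_N) : (forall l, u 0 l != 0 -> dn (sv l) = k) -> u *m vtx_mx *m vtx_mx^T = u.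
Proof.
move=> Hu; apply/rowP => l; rewrite mxE.
under eq_bigr do rewrite mulJ !mxE.
have [H0|/Hu/lv_ex [i Hi]] := eqVneq (u 0 l) 0.
  rewrite H0 big1 // => i _; case: eqP => [E|_]; last by rewrite mulr0.
  by rewrite -E H0 mul0r.
rewrite (bigD1 i) //= Hi eqxx mulr1 big1 ?addr0 // => i' Hi'.
by case: eqP => [/lv_inj E|]; rewrite ?mulr0 // E eqxx in Hi' *.
Qed.

Lemma JtJ : vtx_mx^T *m vtx_mx = 1%:M.
Proof.
apply/matrixP => i i'; rewrite !mxE (bigD1 (lv i)) //= !mxE eqxx mul1r big1 ?addr0.
  by rewrite (inj_eq lv_inj).
by move=> l /negPf Hl; rewrite !mxE Hl mul0r.
Qed.

Lemma wtJJt a b (u : 'rV[C]_N) : wt W a b u -> (a + b)%N = k -> u *m vtx_mx *m vtx_mx^T = u.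
Proof. by move=> Hu Hk; apply: JJt => l /Hu[_ ->]. Qed.

Lemma wtJ0 a b (u : 'rV[C]_N) : wt W a b u -> (a + b)%N <> k -> u *m vtx_mx = 0.
Proof.
move=> Hu Hk; apply/rowP => i; rewrite mulJ mxE; apply/eqP/negPn/negP => /Hu[_].
by rewrite dn_lv => E; apply: Hk.
Qed.

Lemma LRE : (LA + LB) *m (RA + RB) = incmx C (fun x z => cov z x) *m incmx C (@cov F D).
Proof.
have H x z : (upA W z x)%:R + (upB W z x)%:R = (cov z x)%:R :> C.
  rewrite upAE /upB; case: (boolP (cov z x)) => _ /=; last by rewrite addr0.
  by case: (_ == _); rewrite ?addr0 ?add0r.
have -> : LA + LB = incmx C (fun x z => cov z x) by apply/matrixP => i j; rewrite !mxE H.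
by have -> : RA + RB = incmx C (@cov F D) by apply/matrixP => i j; rewrite !mxE H.
Qed.

Lemma Atot_adj : (0 < k)%N -> vtx_mx^T *m Atot *m vtx_mx = adjA F D k C.
Proof.
move=> Hk0; apply/matrixP => i i'; rewrite mulJ mulJt /Atot LRE mxBE incmx_mul.
rewrite [X in _ - X]mxE [RHS]mxE (inj_eq lv_inj).
have [<-|Hii] := eqVneq i i'.
  have -> : #|[pred y | cov y (sv (lv i)) & cov y (sv (lv i))]| = #|[pred y | cov y (sv (lv i))]|.
    by apply: eq_card => y; rewrite !inE andbb.
  have H := natr_geom C (card_dn (sv (lv i))); rewrite dn_lv in H.
  rewrite -H mulr1n mulrC mulKf ?Q1_neq0 // subrr /dimI.
  have /andP[_ /eqP Hr] := vtxP i.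
  have -> : \rank (vtx i :&: vtx i)%MS = k.
    by apply: etrans Hr; apply/eqP; rewrite eqn_leq !mxrankS ?capmxSl // sub_capmx submx_refl.
  by have -> : (k == k.-1) = false by apply/eqP; move: Hk0; clear; lia.
have Hne : sv (lv i) <> sv (lv i').
  by move=> /(@sv_inj F D)/lv_inj E; rewrite E eqxx in Hii.
rewrite mulr0n subr0 card_below // /adj !dn_lv eqxx /= /dimI !sv_lv; congr _%:R.
have /andP[_ /eqP H1] := vtxP i; have /andP[_ /eqP H2] := vtxP i'.
have := mxrank_sum_cap (vtx i) (vtx i'); rewrite H1 H2.
by move: (\rank _) (\rank _) Hk0 => x y; clear; lia.
Qed.

Lemma wt_adj a b (u : 'rV[C]_N) : (0 < k)%N -> wt W a b u -> (a + b)%N = k ->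
  u *m vtx_mx *m adjA F D k C = u *m Atot *m vtx_mx.
Proof. by move=> Hk0 Hu Hk; rewrite -Atot_adj // !mulmxA (wtJJt Hu Hk). Qed.

Lemma wt_dual a b (u : 'rV[C]_N) : wt W a b u ->
  u *m vtx_mx *m dualA k C (val W) = dualval F D k C a *: (u *m vtx_mx).
Proof.
move=> Hu; apply/rowP => i; rewrite [RHS]mxE mxE (bigD1 i) //= big1 ?addr0.
  rewrite mulJ mxE eqxx mul1r; have [->|/Hu[<- _]] := eqVneq (u 0 (lv i)) 0.
    by rewrite mul0r mulr0.
  by rewrite da_lv mulrC.
by move=> i' /negPf Hi'; rewrite [dualA _ _ _ _ _]mxE Hi' mul0r mulr0.
Qed.

Local Notation lo := (klo D k).
Local Notation len := (klen D k).
Local Notation kchain := (chain (adjA F D k C) (dualA k C (val W)) (dualval F D k C)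
  lo len (kal Q D k) (kbe Q D k)).

Lemma ev_chain h i j u : (0 < k)%N -> (2 * k <= D)%N -> kvalid D k (h, i, j) ->
  lowest W h i j u -> kchain (h, i, j) (fun m => ev W h i j u m *m vtx_mx).
Proof.
move=> Hk0 HkD Hv Hu m Hm; have Hw := ev_wt Hu Hv HkD Hm.
have Hsum : (lo (h, i, j) + m + (k - (lo (h, i, j) + m)) = k)%N.
  by have [_ _ H _ _] := lenP C Hv HkD Hm; lia.
split; first exact: wt_dual Hw.
rewrite (wt_adj Hk0 Hw Hsum) (ev_Atot Hu Hv HkD Hm) !mulmxDl -scalemxAl.
congr (_ + _ + _); first by case: ifP; rewrite ?mul0mx.
by case: (m) => [|m']; rewrite ?mul0mx // -scalemxAl.
Qed.

Lemma evJ_neq0 h i j u m : (2 * k <= D)%N -> kvalid D k (h, i, j) -> lowest W h i j u ->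
  (forall s', iter_act RA s' u = 0 -> (k < s' + 2 * j + h)%N) ->
  (m < len (h, i, j))%N -> ev W h i j u m *m vtx_mx != 0.
Proof.
move=> HkD Hv Hu Hs Hm; have Hw := ev_wt Hu Hv HkD Hm.
have Hsum : (lo (h, i, j) + m + (k - (lo (h, i, j) + m)) = k)%N.
  by have [_ _ H _ _] := lenP C Hv HkD Hm; lia.
apply: contraNneq (ev_neq0 Hu Hv HkD Hs Hm) => H0.
by rewrite -(wtJJt Hw Hsum) H0 mul0mx.
Qed.

Lemma act_RA_RB s (u : 'rV[C]_N) : iter_act RA s (u *m RB) = Q ^+ s *: (iter_act RA s u *m RB).
Proof.
elim: s u => [|s IH] u; first by rewrite scale1r.
by rewrite !actSr vRBRA actZ IH scalerA -exprS.
Qed.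

Lemma eig_lowest j b (u : 'rV[C]_N) mu : low W j b u -> u != 0 -> u *m cM W C j b = mu *: u ->
  exists h i, [/\ b = (h + i)%N, lowest W h i j u,
    forall s, iter_act RA s u = 0 -> (k < s + 2 * j + h)%N &
    forall t, iter_act RB t u = 0 -> (D < t + 2 * i + h + k)%N].
Proof.
move=> Hl Hu0 Hm; have [h [i [[Emu Eb H1 H2] [H3 H4 H5 H6]]]] := eig_params Hl Hu0 Hm.
by exists h, i; split=> //; rewrite Eb Emu in Hl Hm *; split=> //; split=> //.
Qed.

(** Quantifying over both exponents makes [S] stable under the raising operators. For a lowest
    vector, the [vst] of total dimension [k] are up to nonzero scalars the members of its chain; all
    others vanish or are killed by [vtx_mx]. *)
Lemma kchain_full (Z : 'M[C]_n) : (0 < k)%N -> (2 * k <= D)%N ->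
  (forall t e m, kvalid D k t -> kchain t e -> (m < len t)%N -> e m *m Z = 0) -> Z = 0.
Proof.
move=> Hk0 HkD HZ.
pose S (u : 'rV[C]_N) := forall s t, iter_act RB t (iter_act RA s u) *m vtx_mx *m Z = 0.
have HS : forall u, S u.
  apply: (@generation F D W C).
  - by move=> c u v Hu Hv s t; rewrite !actD !actZ !mulmxDl -!scalemxAl Hu Hv scaler0 addr0.
  - by move=> u Hu s t; rewrite -actSr.
  - by move=> u Hu s t; rewrite act_RA_RB actZ -actSr -!scalemxAl Hu scaler0.
  - move=> j b u mu Hl Hu0 Hm; have [h [i [Eb Hlow _ _]]] := eig_lowest Hl Hu0 Hm.
    have [_ _ _ [_ _ Hj Hi]] := Hlow.
    move=> s t; rewrite -/(vst W u s t).
    have [Hs|Hs] := leqP s (k - 2 * j - h); last by rewrite (vst_top_s Hlow) // !mul0mx.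
    have [Ht|Ht] := leqP t (D - k - h - 2 * i); last by rewrite (vst_top_t Hlow) // !mul0mx.
    have [Hk|Hk] := eqVneq (j + s + (h + i + t))%N k; last first.
      by rewrite (wtJ0 (vst_wt Hlow (s := s) (t := t))) ?mul0mx //; apply/eqP.
    have Hv : kvalid D k (h, i, j) by rewrite /kvalid /=; lia.
    have Elo : (lo (h, i, j) <= j + s)%N by rewrite /klo /=; lia.
    have Hm' : (j + s - lo (h, i, j) < len (h, i, j))%N.
      have Hhi : (j + s <= k - h - maxn i j)%N by move: Hs Hk Hj; clear; lia.
      by move: Elo Hhi; rewrite /klen /=; clear; lia.
    have := HZ _ _ _ Hv (ev_chain Hk0 HkD Hv Hlow) Hm'.
    rewrite /ev /ev_s /ev_t subnKC // -!scalemxAl.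
    have -> : (j + s - j = s)%N by lia.
    have -> : (k - h - i - (j + s) = t)%N by lia.
    move=> /eqP; rewrite scaler_eq0 (negPf (ev_c_neq0 Hlow Hv HkD Hm')) /=.
    by move/eqP.
  - by move=> s t; rewrite !act0 !mul0mx.
apply/row_matrixP => i; rewrite rowE row0.
have /(_ 0 0)%N := HS (delta_mx 0 i *m vtx_mx^T).
by rewrite /= -[_ *m vtx_mx^T *m vtx_mx]mulmxA JtJ mulmx1.
Qed.

End Vertices.

(** * Existence of lowest-weight vectors *)

Section LinearAction.
Variables (F : finFieldType) (D : nat).
Local Notation subsp := (subsp F D).
Local Notation N := #|{: subsp}|.
Implicit Types (g : 'M[F]_D) (x y z W : subsp).

Definition gact g x : subsp := mksub (val x *m g).

Lemma gactE g x : (val (gact g x) :=: val x *m g)%MS.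
Proof. exact: mksubE. Qed.

Lemma gact_sub g x y : g \in unitmx -> (val (gact g x) <= val (gact g y))%MS = (val x <= val y)%MS.
Proof. by move=> Hg; rewrite !gactE submxMfree ?row_free_unit. Qed.

Lemma dn_gact g x : g \in unitmx -> dn (gact g x) = dn x.
Proof. by move=> Hg; rewrite /gact dn_mksub mxrankMfree ?row_free_unit. Qed.

Lemma cov_gact g x y : g \in unitmx -> cov (gact g x) (gact g y) = cov x y.
Proof. by move=> Hg; rewrite /cov gact_sub // !dn_gact. Qed.

Lemma da_gact g W x : g \in unitmx -> da (gact g W) (gact g x) = da W x.
Proof.
move=> Hg; have := rank_addW (gact g W) (gact g x); have := rank_addW W x.
have -> : \rank (val (gact g x) + val (gact g W))%MS = \rank (val x + val W)%MS.
  have -> : (val (gact g x) + val (gact g W) :=: (val x + val W)%MS *m g)%MS.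
    by apply: eqmx_trans (eqmx_sym (addsmxMr _ _ _)); apply: adds_eqmx; apply: gactE.
  by rewrite mxrankMfree ?row_free_unit.
by rewrite !dn_gact // => <- /addnI.
Qed.

Lemma upA_gact g W x y : g \in unitmx -> upA (gact g W) (gact g x) (gact g y) = upA W x y.
Proof. by move=> Hg; rewrite /upA cov_gact // !da_gact. Qed.

Lemma upB_gact g W x y : g \in unitmx -> upB (gact g W) (gact g x) (gact g y) = upB W x y.
Proof. by move=> Hg; rewrite /upB cov_gact // !da_gact. Qed.

Lemma gactM g g' x : gact g' (gact g x) = gact (g *m g') x.
Proof.
apply: subsp_eqmx; apply: eqmx_trans (gactE _ _) _.
apply: eqmx_trans _ (eqmx_sym (gactE _ _)).
by rewrite mulmxA; apply: eqmxMr; apply: gactE.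
Qed.

Lemma gact_eq g x y : (val y :=: val x *m g)%MS -> gact g x = y.
Proof. by move=> H; apply: subsp_eqmx; apply: eqmx_trans (gactE _ _) (eqmx_sym H). Qed.

Lemma gact_inj g : g \in unitmx -> injective (gact g).
Proof. by move=> Hg x y E; apply: subsp_eqP; rewrite -(gact_sub _ _ Hg) E. Qed.

Lemma gact_fix g x : g \in unitmx -> (val x *m g <= val x)%MS -> gact g x = x.
Proof.
by move=> Hg H; apply: subsp_eq_rank; rewrite ?dn_gact // gactE.
Qed.

Definition iact g (i : 'I_N) : 'I_N := enum_rank (gact g (sv i)).

Lemma sv_iact g i : sv (iact g i) = gact g (sv i).
Proof. by rewrite /sv enum_rankK. Qed.

Lemma iact_inj g : g \in unitmx -> injective (iact g).
Proof. by move=> Hg i j /enum_rank_inj /(gact_inj Hg) /(@sv_inj F D). Qed.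

Definition pact g (Hg : g \in unitmx) : 'S_N := perm (iact_inj Hg).

Lemma sv_pact g (Hg : g \in unitmx) i : sv (pact Hg i) = gact g (sv i).
Proof. by rewrite permE sv_iact. Qed.

Variable C : numClosedFieldType.

Lemma perm_mx_intertwine (s : 'S_N) (A A' : 'M[C]_N) :
  (A *m perm_mx s = perm_mx s *m A') <-> (forall i j, A i j = A' (s i) (s j)).
Proof.
rewrite -row_permE -[s in _ *m perm_mx s]invgK -col_permE; split.
  by move=> /matrixP H i j; have := H i (s j); rewrite !mxE permK.
by move=> H; apply/matrixP => i j; rewrite !mxE H permKV.
Qed.

Lemma incmx_pact g (Hg : g \in unitmx) (P P' : rel subsp) :
  (forall x y, P' (gact g x) (gact g y) = P x y) ->
  incmx C P *m perm_mx (pact Hg) = perm_mx (pact Hg) *m incmx C P'.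
Proof. by move=> H; apply/perm_mx_intertwine => i j; rewrite !mxE !sv_pact H. Qed.

Section Transport.
Variables (g : 'M[F]_D) (Hg : g \in unitmx) (W : subsp).
Local Notation P := (perm_mx (pact Hg) : 'M[C]_N).

Lemma RA_pact : RA W C *m P = P *m RA (gact g W) C.
Proof. by apply: incmx_pact => x y; apply: upA_gact. Qed.

Lemma RB_pact : RB W C *m P = P *m RB (gact g W) C.
Proof. by apply: incmx_pact => x y; apply: upB_gact. Qed.

Lemma LA_pact : LA W C *m P = P *m LA (gact g W) C.
Proof. by apply: incmx_pact => x y; apply: upA_gact. Qed.

Lemma LB_pact : LB W C *m P = P *m LB (gact g W) C.
Proof. by apply: incmx_pact => x y; apply: upB_gact. Qed.

Lemma act_pact (R R' : 'M[C]_N) n (u : 'rV_N) : R *m P = P *m R' ->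
  iter_act R' n (u *m P) = iter_act R n u *m P.
Proof. by move=> H; elim: n => //= n ->; rewrite -!mulmxA H. Qed.

Lemma mul_pact (u : 'rV[C]_N) i : (u *m P) 0 (pact Hg i) = u 0 i.
Proof. by rewrite -[pact Hg]invgK -col_permE mxE invgK permK. Qed.

Lemma wt_pact a b (u : 'rV[C]_N) : wt W a b u -> wt (gact g W) a b (u *m P).
Proof.
move=> Hu i; rewrite -[i](permKV (pact Hg)) mul_pact => /Hu[<- <-].
by rewrite sv_pact da_gact // dn_gact.
Qed.

Lemma low_pact a b (u : 'rV[C]_N) : low W a b u -> low (gact g W) a b (u *m P).
Proof.
move=> [Hw HA HB]; split; first exact: wt_pact.
  by rewrite -mulmxA -LA_pact mulmxA HA mul0mx.
by rewrite -mulmxA -LB_pact mulmxA HB mul0mx.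
Qed.

Lemma pact_neq0 (u : 'rV[C]_N) : u != 0 -> u *m P != 0.
Proof.
apply: contraNneq => H; apply/eqP/rowP => i.
by rewrite -mul_pact H !mxE.
Qed.

End Transport.
End LinearAction.

Lemma gact_pid (F : finFieldType) D (W : subsp F D) :
  exists2 g : 'M[F]_D, g \in unitmx & gact g (mksub (pid_mx (dn W) : 'M_D)) = W.
Proof.
exists (row_ebase (val W)); first exact: row_ebase_unit.
apply: gact_eq; rewrite -{1}(mulmx_ebase (val W)) -mulmxA.
apply: eqmx_trans (eqmxMfull _ _) _; first by rewrite row_full_unit col_ebase_unit.
by apply: eqmxMr; apply: eqmx_sym; apply: mksubE.
Qed.

Section PowerSupport.
Variables (F : finFieldType) (D : nat) (W : subsp F D) (C : numClosedFieldType).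
Local Notation N := #|{: subsp F D}|.

Definition powmx (R : 'M[C]_N) n : 'M[C]_N := iter n (mulmx^~ R) 1%:M.

Lemma act_powmx (R : 'M[C]_N) n u : iter_act R n u = u *m powmx R n.
Proof. by elim: n => [|n IH] /=; rewrite ?mulmx1 // IH mulmxA. Qed.

Lemma powmx_comm (R M : 'M[C]_N) n : R *m M = M *m R -> powmx R n *m M = M *m powmx R n.
Proof.
move=> H; elim: n => [|n IH] /=; first by rewrite mul1mx mulmx1.
by rewrite -mulmxA H mulmxA IH mulmxA.
Qed.

Lemma powRA_support n i j : powmx (RA W C) n i j != 0 ->
  [/\ (val (sv i) <= val (sv j))%MS, da W (sv j) = (da W (sv i) + n)%N & dn (sv j) = (dn (sv i) + n)%N].
Proof.
elim: n j => [|n IH] j /=; first by rewrite mxE pnatr_b => /eqP ->; rewrite !addn0.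
rewrite mxE => Hs.
case: (pickP (fun l => (powmx (RA W C) n i l != 0) && (RA W C l j != 0))) => [l /andP[/IH[H1 H2 H3]]|H0].
  rewrite mxE pnatr_b => /upAP[_ H4 -> ->]; rewrite H2 H3 !addnS; split=> //.
  exact: submx_trans H1 H4.
by case/eqP: Hs; apply: big1 => l _; have := H0 l; rewrite -negb_or -mulf_eq0 => /negbFE/eqP.
Qed.

Lemma powRB_support n i j : powmx (RB W C) n i j != 0 ->
  [/\ (val (sv i) <= val (sv j))%MS, da W (sv j) = da W (sv i) & dn (sv j) = (dn (sv i) + n)%N].
Proof.
elim: n j => [|n IH] j /=; first by rewrite mxE pnatr_b => /eqP ->; rewrite !addn0.
rewrite mxE => Hs.
case: (pickP (fun l => (powmx (RB W C) n i l != 0) && (RB W C l j != 0))) => [l /andP[/IH[H1 H2 H3]]|H0].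
  rewrite mxE pnatr_b => /upBP[_ H4 -> ->]; rewrite H2 H3 !addnS; split=> //.
  exact: submx_trans H1 H4.
by case/eqP: Hs; apply: big1 => l _; have := H0 l; rewrite -negb_or -mulf_eq0 => /negbFE/eqP.
Qed.

End PowerSupport.

Section CoordinateProjections.
Variables (F : fieldType) (D : nat).
Implicit Types (S T : pred nat).

Definition dS S : 'M[F]_D := diag_mx (\row_s (S s)%:R).

Lemma bool_neq0 (b : bool) : (b%:R != 0 :> F) = b.
Proof. by case: b; rewrite ?oner_eq0 ?eqxx. Qed.

Lemma mul_dS m (A : 'M[F]_(m, D)) S r s : (A *m dS S) r s = A r s * (S s)%:R.
Proof. by rewrite mul_mx_diag !mxE. Qed.

Lemma dS_mul m (A : 'M[F]_(D, m)) S r s : (dS S *m A) r s = (S r)%:R * A r s.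
Proof. by rewrite mul_diag_mx !mxE. Qed.

Lemma sub_dS m (A : 'M[F]_(m, D)) S : (A <= dS S)%MS = (A *m dS S == A).
Proof.
apply/idP/eqP => [/submxP[B ->]|<-]; last exact: submxMl.
rewrite -mulmxA; congr (_ *m _); apply/matrixP => r s; rewrite mul_dS !mxE.
by case: eqP => [->|_]; rewrite ?mulr0n ?mul0r // mulr1n -natrM mulnb andbb.
Qed.

Lemma sub_dSP m (A : 'M[F]_(m, D)) S :
  (forall r s, A r s != 0 -> S s) <-> (A <= dS S)%MS.
Proof.
rewrite sub_dS; split=> [H|/eqP <- r s].
  apply/eqP/matrixP => r s; rewrite mul_dS; have [->|/H ->] := eqVneq (A r s) 0; first by rewrite mul0r.
  by rewrite mulr1.
by rewrite mul_dS; case: (S s); rewrite ?mulr0 ?eqxx.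
Qed.

(** The upper bound is applied to [S] and to its complement; the two ranks add up to at least [D],
    so both bounds are attained. *)
Lemma rank_dS S : \rank (dS S) = (\sum_(s < D) S s)%N.
Proof.
have Hle T : (\rank (dS T) <= \sum_(s < D) T s)%N.
  have -> : dS T = \sum_(s < D) ((T s)%:R *: delta_mx s s : 'M[F]_D).
    rewrite [dS T]matrix_sum_delta; apply: eq_bigr => s _.
    rewrite (bigD1 s) //= big1 ?addr0; first by rewrite !mxE eqxx.
    by move=> t /negPf Ht; rewrite !mxE eq_sym Ht scale0r.
  elim/big_ind2: _ => [|A a B b HA HB|s _]; first by rewrite mxrank0.
    by apply: leq_trans (mxrank_add _ _) _; apply: leq_add.
  by case: (T s); rewrite ?scale1r ?mxrank_delta // scale0r mxrank0.
have H1 := Hle S; have H2 := Hle (predC S).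
have H3 : (D <= \rank (dS S) + \rank (dS (predC S)))%N.
  apply: leq_trans (mxrank_add _ _); rewrite -[X in (X <= _)%N](@mxrank1 F D).
  have -> // : dS S + dS (predC S) = 1%:M.
  apply/matrixP => s t; rewrite !mxE; case: eqP => [->|_]; rewrite ?mulr0n ?addr0 // !mulr1n /=.
  by case: (S t); rewrite ?addr0 ?add0r.
have H4 : (\sum_(s < D) S s + \sum_(s < D) predC S s = D)%N.
  rewrite -big_split /= -[RHS]card_ord -sum1_card; apply: eq_bigr => s _.
  by case: (S s).
lia.
Qed.

End CoordinateProjections.

Lemma sum_itv D a b : (\sum_(s < D) (a <= s < b)%N = minn b D - a)%N.
Proof. by elim: D => [|D IH]; rewrite ?big_ord0 ?big_ord_recr /= ?IH; lia. Qed.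

(** * A lowest-weight vector supported on a unipotent orbit *)

Section Existence.
Variables (F : finFieldType) (D : nat) (C : numClosedFieldType).
Variables (k h i j : nat).
Hypotheses (Hj : (2 * j + h <= k)%N) (Hi : (2 * i + h + k <= D)%N).
Local Notation subsp := (subsp F D).
Local Notation N := #|{: subsp}|.
Local Notation q := #|F|.
Local Notation Q := (#|F|%:R : C).

Definition stdW : subsp := mksub (pid_mx k : 'M[F]_D).
Local Notation W := stdW.

Lemma pid_dS : pid_mx k = dS F D (fun s => (s < k)%N).
Proof.
apply/matrixP => s t; rewrite !mxE; have [->|Hst] := eqVneq s t; first by rewrite eqxx mulr1n.
by rewrite -val_eqE /= in Hst; rewrite (negPf Hst) mulr0n.
Qed.

Lemma stdWE : (val W :=: dS F D (fun s => (s < k)%N))%MS.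
Proof. by rewrite -pid_dS; apply: mksubE. Qed.

Lemma dn_stdW : dn W = k.
Proof. by rewrite /stdW dn_mksub rank_pid_mx //; lia. Qed.

(** [j] coordinates inside [stdW] and [h + i] outside, which is the weight of a lowest vector of
    type [(h, i, j)]. *)
Definition isE s := (s < j)%N || (k <= s < k + h + i)%N.

(* The coordinate subspace of [isE] is paired with coordinates outside it: [j] pairs inside [W],
   [h] pairs across and [i] pairs outside; [theta X] is the trace of [X] against this pairing. *)
Definition sig s := if (s < j)%N then (s + j)%N else if (s < k + h)%N then (s - k + 2 * j)%N else (s + i)%N.

Lemma sig_notE s : isE s -> ~~ isE (sig s).
Proof. by rewrite /isE /sig; move: Hj Hi; do ?case: ifP => ?; lia. Qed.

Lemma sig_lt s : isE s -> (sig s < D)%N.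
Proof. by rewrite /isE /sig; move: Hj Hi; do ?case: ifP => ?; lia. Qed.

Lemma sig_inj s t : isE s -> isE t -> sig s = sig t -> s = t.
Proof. by rewrite /isE /sig; move: Hj Hi; do ?case: ifP => ?; lia. Qed.

Implicit Types X Y : 'M[F]_D.

(** [X] sends the coordinates of [isE] to the others and [stdW] into itself. Hence products vanish,
    the matrices [1%:M + X] form an abelian group with [X] as additive parameter, and this group
    fixes [stdW], so it commutes with the four operators. *)
Definition inN X := [forall s, forall t, (X s t != 0) ==> [&& isE s, ~~ isE t & (s < j)%N ==> (t < k)%N]].

Lemma inNP X : reflect (forall s t, X s t != 0 -> [/\ isE s, ~~ isE t & (s < j)%N -> (t < k)%N]) (inN X).
Proof.
apply: (iffP forallP) => [H s t|H s].
  by have /forallP/(_ t)/implyP := H s => H' /H' /and3P[H1 H2 /implyP H3].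
by apply/forallP => t; apply/implyP => /H[-> -> H3]; apply/implyP.
Qed.

Lemma inND X Y a : inN X -> inN Y -> inN (X + a *: Y).
Proof.
move=> /inNP HX /inNP HY; apply/inNP => s t; rewrite !mxE.
have [->|/HX //] := eqVneq (X s t) 0; rewrite add0r mulf_eq0 negb_or => /andP[_ /HY //].
Qed.

Lemma inN_mul X Y : inN X -> inN Y -> X *m Y = 0.
Proof.
move=> /inNP HX /inNP HY; apply/matrixP => s t; rewrite !mxE big1 // => r _.
have [->|/HX[_ H _]] := eqVneq (X s r) 0; first by rewrite mul0r.
have [->|/HY[H' _ _]] := eqVneq (Y r t) 0; first by rewrite mulr0.
by rewrite H' in H.
Qed.

Lemma inN_unit X : inN X -> 1%:M + X \in unitmx.
Proof.
move=> HX; suff /mulmx1_unit[] : (1%:M + X) *m (1%:M - X) = 1%:M by [].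
by rewrite mulmxBr !mulmxDl !mulmx1 mul1mx (inN_mul HX HX) addr0 addrK.
Qed.

Definition theta X : F := \sum_(s < D) \sum_(t < D) (isE s && (nat_of_ord t == sig s))%:R * X s t.

Lemma thetaD X Y a : theta (X + a *: Y) = theta X + a * theta Y.
Proof.
rewrite /theta mulr_sumr -big_split; apply: eq_bigr => s _ /=.
rewrite mulr_sumr -big_split; apply: eq_bigr => t _ /=; rewrite !mxE; ring.
Qed.

Lemma theta_rank1 (al : 'cV[F]_D) (w : 'rV[F]_D) (s0 t0 : 'I_D) : isE s0 -> t0 = sig s0 :> nat ->
  (forall s t, al s 0 != 0 -> isE s -> w 0 t != 0 -> nat_of_ord t = sig s -> s = s0) ->
  theta (al *m w) = al s0 0 * w 0 t0.
Proof.
move=> Hs0 Ht0 Huniq; rewrite /theta (bigD1 s0) //= (bigD1 t0) //= Hs0 Ht0 eqxx mul1r.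
rewrite !big1 ?addr0 ?mxE ?big_ord1 //.
  move=> s Hs; rewrite big1 // => t _; case: (boolP (_ && _)) => [/andP[H1 /eqP H2]|]; last by rewrite mul0r.
  rewrite mul1r mxE big_ord1; apply/eqP; rewrite mulf_eq0; apply/norP => -[H3 H4].
  by rewrite (Huniq s t) ?eqxx in Hs.
move=> t Ht; case: eqP => [E|]; last by rewrite mul0r.
by move: Ht; rewrite -Ht0 in E; rewrite (val_inj E) eqxx.
Qed.

(* Replaces a nontrivial additive character: it suffices that it is nowhere zero with sum zero. *)
Definition cc (t : F) : C := Q * (t == 0)%:R - 1.

Lemma cc_sum t : \sum_a cc (t + a) = 0.
Proof.
rewrite (reindex_inj (addrI (- t))) /=; under eq_bigr do rewrite addNKr.
rewrite sumrB sumr_const -mulr_sumr (bigD1 0) //= eqxx big1 ?addr0 ?mulr1.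
  by rewrite cardT -cardE subrr.
by move=> a /negPf ->.
Qed.

Definition E0 : subsp := mksub (dS F D isE).
Definition EX X : subsp := gact (1%:M + X) E0.
Definition dlt (x : subsp) : 'rV[C]_N := delta_mx 0 (enum_rank x).

Definition fvec : 'rV[C]_N := \sum_(X | inN X) cc (theta X) *: dlt (EX X).

Lemma dltE x l : dlt x 0 l = (sv l == x)%:R.
Proof.
rewrite mxE eqxx /=; congr (nat_of_bool _)%:R; apply/eqP/eqP => [->|<-].
  by rewrite /sv enum_rankK.
by rewrite /sv enum_valK.
Qed.

Lemma dlt_mul x (Z : 'M[C]_N) l : (dlt x *m Z) 0 l = Z (enum_rank x) l.
Proof. by rewrite -rowE mxE. Qed.

Lemma EX_shift X Y : inN X -> inN Y -> EX (X + Y) = gact (1%:M + Y) (EX X).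
Proof.
move=> HX HY; rewrite /EX gactM; congr (gact _ _).
by rewrite mulmxDr mulmx1 mulmxDl mul1mx (inN_mul HX HY) addr0 addrA.
Qed.

(** Translate the sum by [a *: Y]. Since [Z] commutes with the group and [l] is fixed, the entries
    of [Z] stay the same while [theta] shifts by [a]; averaging over [a] gives zero by [cc_sum].
    [X0] only witnesses that [l] is reached at all. *)
Lemma fvec_vanish (Z : 'M[C]_N) l :
  (forall X (HX : inN X), Z *m perm_mx (pact (inN_unit HX)) = perm_mx (pact (inN_unit HX)) *m Z) ->
  (forall X0, inN X0 -> Z (enum_rank (EX X0)) l != 0 ->
     exists Y, [/\ inN Y, theta Y = 1 & forall a, (val (sv l) *m (a *: Y) <= val (sv l))%MS]) ->
  (fvec *m Z) 0 l = 0.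
Proof.
move=> HZ HY; rewrite /fvec mulmx_suml summxE.
case: (pickP (fun X => inN X && (Z (enum_rank (EX X)) l != 0))) => [X0 /andP[H1 H2]|H0]; last first.
  apply: big1 => X HX; rewrite -scalemxAl mxE dlt_mul; have := H0 X; rewrite HX /= => /negbFE/eqP ->.
  by rewrite mulr0.
have [Y [NY tY fY]] := HY _ H1 H2.
have NaY a : inN (a *: Y) by rewrite -[_ *: _]add0r inND //; apply/inNP => s t; rewrite mxE eqxx.
have Zinv X a : inN X -> Z (enum_rank (EX (X + a *: Y))) l = Z (enum_rank (EX X)) l.
  move=> HX; have /perm_mx_intertwine H := HZ _ (NaY a); rewrite [RHS]H.
  congr (Z _ _); apply: (@sv_inj F D); rewrite sv_pact.
    by rewrite /sv !enum_rankK EX_shift.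
  by rewrite gact_fix ?inN_unit // mulmxDr mulmx1 addmx_sub.
have E a : \sum_(X | inN X) (cc (theta X) *: dlt (EX X) *m Z) 0 l
    = \sum_(X | inN X) cc (theta X + a) * Z (enum_rank (EX X)) l.
  rewrite (reindex_inj (addIr (a *: Y))) /=.
  apply: eq_big => [X|X HX].
    apply/idP/idP => [H|H]; last by apply: inND.
    by rewrite -[X](addrK (a *: Y)) -scaleN1r; apply: inND.
  have NX : inN X by rewrite -[X](addrK (a *: Y)) -scaleN1r; apply: inND.
  by rewrite -scalemxAl mxE dlt_mul Zinv // thetaD tY mulr1.
apply: (mulfI (Q_neq0 F C)); rewrite mulr0.
transitivity (\sum_(a : F) \sum_(X | inN X) cc (theta X + a) * Z (enum_rank (EX X)) l).
  rewrite -(eq_bigr _ (fun a _ => E a)) sumr_const -[RHS]mulr_natl.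
  by congr (_%:R * _); apply: eq_card.
rewrite exchange_big big1 //= => X _.
by rewrite -mulr_suml cc_sum mul0r.
Qed.


Local Notation dE := (dS F D isE).
Local Notation d1 := (dS F D (fun s => (s < j)%N)).
Local Notation dW := (dS F D (fun s => (s < k)%N)).
Local Notation dWC := (dS F D (fun s => (j <= s < k)%N)).

Definition GX X : 'M[F]_D := dE *m (1%:M + X).

Lemma EXE X : (val (EX X) :=: GX X)%MS.
Proof. by apply: eqmx_trans (gactE _ _) _; apply: eqmxMr; apply: mksubE. Qed.

Lemma dE_mul X : inN X -> dE *m X = X.
Proof.
move=> /inNP HX; apply/matrixP => s t; rewrite dS_mul.
by have [->|/HX[-> _ _]] := eqVneq (X s t) 0; rewrite ?mulr0 ?mul1r.
Qed.

Lemma mul_dE X : inN X -> X *m dE = 0.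
Proof.
move=> /inNP HX; apply/matrixP => s t; rewrite mul_dS [RHS]mxE.
by have [->|/HX[_ /negPf -> _]] := eqVneq (X s t) 0; rewrite ?mulr0 ?mul0r.
Qed.

Lemma dSS m (A : 'M[F]_(m, D)) S T : A *m dS F D S *m dS F D T = A *m dS F D (fun s => S s && T s).
Proof. by apply/matrixP => r s; rewrite !mul_dS -mulrA -natrM mulnb. Qed.

Lemma dS_idem S : dS F D S *m dS F D S = dS F D S.
Proof. by apply/eqP; rewrite -sub_dS. Qed.

Lemma GXE X : inN X -> GX X = dE + X.
Proof. by move=> HX; rewrite /GX mulmxDr mulmx1 dE_mul. Qed.

Lemma GX_dE X : inN X -> GX X *m dE = dE.
Proof. by move=> HX; rewrite GXE // mulmxDl dS_idem mul_dE // addr0. Qed.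

Lemma dE_GX X : dE *m GX X = GX X.
Proof. by rewrite /GX mulmxA dS_idem. Qed.

Lemma d1_dE : d1 *m dE = d1.
Proof.
apply/matrixP => r s; rewrite mul_dS !mxE; have [->|_] := eqVneq r s; last by rewrite mulr0n mul0r.
by rewrite mulr1n /isE -natrM mulnb andb_idr // => ->.
Qed.

Lemma dW_X X : inN X -> (dW *m X <= dW)%MS.
Proof.
move=> /inNP HX; apply/sub_dSP => s t; rewrite dS_mul mulf_eq0 negb_or => /andP[H1 /HX[H2 _ H3]].
by apply: H3; move: H1 H2; rewrite bool_neq0 /isE; lia.
Qed.

Lemma gact_stdW X : inN X -> gact (1%:M + X) W = W.
Proof.
move=> HX; apply: gact_fix; first exact: inN_unit.
rewrite (eqmxMr _ stdWE) stdWE mulmxDr mulmx1 addmx_sub //.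
exact: dW_X.
Qed.

Lemma d1_GX_sub X : inN X -> (d1 *m GX X <= val (EX X) :&: val W)%MS.
Proof.
move=> HX; rewrite sub_capmx EXE submxMl stdWE /GX mulmxA d1_dE mulmxDr mulmx1.
have H1 : (d1 <= dW)%MS.
  apply/sub_dSP => r s; rewrite !mxE; have [->|_] := eqVneq r s; last by rewrite mulr0n eqxx.
  by rewrite mulr1n bool_neq0; lia.
rewrite addmx_sub //; apply: submx_trans (dW_X HX).
have -> : d1 = d1 *m dW by apply/esym/eqP; rewrite -sub_dS.
by rewrite -mulmxA submxMl.
Qed.

Lemma cap_GX X : inN X -> (val (EX X) :&: val W <= d1 *m GX X)%MS.
Proof.
move=> HX; apply/rV_subP => u; rewrite sub_capmx EXE stdWE => /andP[/submxP[v Hv]].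
rewrite sub_dS => /eqP HuW.
have Hv' : u *m dE = v *m dE by rewrite Hv -mulmxA GX_dE.
have Hd : v *m dE = v *m dE *m d1.
  rewrite -Hv' -{1}HuW !dSS; apply/rowP => s; rewrite !mul_dS; congr (_ * _%:R).
  by rewrite /isE; case: ltnP => H1; case: ltnP => H2; case: leqP => H3 //=; lia.
by rewrite Hv -{1}dE_GX mulmxA Hd -mulmxA submxMl.
Qed.


Lemma dn_EX X : inN X -> dn (EX X) = (j + h + i)%N.
Proof.
move=> HX; rewrite dn_gact ?inN_unit // dn_mksub rank_dS.
rewrite (eq_bigr (fun s : 'I_D => (0 <= s < j) + (k <= s < k + h + i))%N) => [|s _]; last first.
  by rewrite /isE; case: ltnP => H1; case: leqP => H2; case: ltnP => H3 //=; lia.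
by rewrite big_split (sum_itv D 0 j) (sum_itv D k (k + h + i)) /=; move: Hj Hi; lia.
Qed.

Lemma da_EX X : inN X -> da W (EX X) = j.
Proof.
move=> HX; rewrite /da; have -> : \rank (val (EX X) :&: val W)%MS = \rank (d1 *m GX X).
  by apply/eqP; rewrite eqn_leq !mxrankS ?d1_GX_sub ?cap_GX.
rewrite /GX mulmxA d1_dE mxrankMfree ?row_free_unit ?inN_unit // rank_dS.
by rewrite (sum_itv D 0 j); move: Hj Hi; lia.
Qed.

Lemma fvec_wt : wt W j (h + i) fvec.
Proof.
rewrite /fvec; elim/big_ind: _ => [|u v|X HX]; [exact: wt0|exact: wtD|].
apply: wtZ => l; rewrite dltE pnatr_b => /eqP ->.
by rewrite dn_EX // da_EX // addnA.
Qed.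

(** [w] is a multiple of the coordinate row at [sig s0]. If [s0 < j] this coordinate lies in [stdW];
    otherwise the rows with index below [j] vanish. Either way [stdW] is preserved. *)
Lemma theta_mkY X al (s0 : 'I_D) : inN X -> (GX X *m al) s0 0 != 0 ->
  (s0 < j)%N \/ (forall s : 'I_D, (s < j)%N -> (GX X *m al) s 0 = 0) ->
  exists2 w : 'rV[F]_D, inN (GX X *m al *m w) & theta (GX X *m al *m w) = 1.
Proof.
move=> HX Hs0 Hdisj; set b := GX X *m al in Hs0 Hdisj *.
have bE (s : 'I_D) : b s 0 != 0 -> isE s.
  by rewrite /b -(dE_GX X) -mulmxA dS_mul mulf_eq0 negb_or bool_neq0 => /andP[].
clearbody b.
pose t0 := Ordinal (sig_lt (bE _ Hs0)).
exists ((b s0 0)^-1 *: delta_mx 0 t0).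
  apply/inNP => s t; rewrite mxE big_ord1 !mxE eqxx /= mulf_eq0 negb_or mulf_eq0 negb_or bool_neq0.
  move=> /andP[Hs /andP[_ /eqP ->]]; split; [exact: (bE _ Hs)|exact: (sig_notE (bE _ Hs0))|].
  move=> Hsj; case: Hdisj => [H|/(_ _ Hsj) H]; last by rewrite H eqxx in Hs.
  by rewrite /= /sig H; lia.
rewrite (theta_rank1 (bE _ Hs0) (erefl : t0 = sig s0 :> nat)).
  by rewrite !mxE !eqxx mulr1 mulfV.
move=> s t Hs Es; rewrite !mxE eqxx /= mulf_eq0 negb_or bool_neq0 => /andP[_ /eqP ->] /= E.
by apply: val_inj; apply: (sig_inj Es (bE _ Hs0)); rewrite -E.
Qed.

Lemma GX_idem X : inN X -> GX X *m GX X = GX X.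
Proof. by move=> HX; rewrite -{2}(dE_GX X) mulmxA GX_dE // dE_GX. Qed.

Lemma mul_GX X m p (z : 'M[F]_(m, D)) (al : 'M[F]_(D, p)) :
  inN X -> (z <= GX X)%MS -> z *m (GX X *m al) = z *m al.
Proof. by move=> HX /submxP[B ->]; rewrite mulmxA -[B *m _ *m _]mulmxA GX_idem. Qed.

Lemma not_sub_col m1 m2 (A : 'M[F]_(m1, D)) (B : 'M[F]_(m2, D)) : ~~ (A <= B)%MS ->
  exists2 al : 'cV[F]_D, B *m al = 0 & exists s, (A *m al) s 0 != 0.
Proof.
rewrite submxE => H.
have [[s t]/= Hst] : exists p : 'I_m1 * 'I_D, (A *m cokermx B) p.1 p.2 != 0.
  apply/existsP; apply: contraNT H => /existsPn H; apply/eqP/matrixP => s t.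
  by have /= := H (s, t); rewrite negbK => /eqP ->; rewrite mxE.
exists (col t (cokermx B)); first by rewrite colE mulmxA mulmx_coker mul0mx.
by exists s; rewrite colE mulmxA -colE mxE.
Qed.

(** A space [l] one [upA] step below [EX X0] misses part of [EX X0 :&: W], so some linear form [al]
    vanishes on [l] but not there. The rank-one [Y] built from [al] annihilates [l] and thus fixes
    it. *)
Lemma fvec_LA : fvec *m LA W C = 0.
Proof.
apply/rowP => l; rewrite [RHS]mxE; apply: fvec_vanish => [X HX|X0 HX0].
  by rewrite -{2}(gact_stdW HX) LA_pact.
rewrite mxE pnatr_b /sv enum_rankK -/(sv l) upAE => /andP[Hc].
rewrite /upB Hc /= cov_daB // => Hn.
have {}Hn : ~~ (d1 *m GX X0 <= val (sv l))%MS.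
  by apply: contra Hn; apply: submx_trans; apply: cap_GX.
have [al Hal [s Hs]] := not_sub_col Hn.
rewrite -mulmxA dS_mul mulf_eq0 negb_or bool_neq0 in Hs; case/andP: Hs => Hsj Hs.
have [w Nw tw] := theta_mkY HX0 Hs (or_introl Hsj).
exists (GX X0 *m al *m w); split=> // a.
rewrite -scalemxAr mulmxA mul_GX ?Hal ?mul0mx ?scaler0 ?sub0mx //.
by rewrite -EXE; apply: cov_sub.
Qed.

(** Here [l] contains [EX X0 :&: W], so a form that vanishes on [l] also vanishes there; the rows of
    [Y] with index below [j] are zero and the second alternative of [theta_mkY] applies. *)
Lemma fvec_LB : fvec *m LB W C = 0.
Proof.
apply/rowP => l; rewrite [RHS]mxE; apply: fvec_vanish => [X HX|X0 HX0].
  by rewrite -{2}(gact_stdW HX) LB_pact.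
rewrite mxE pnatr_b /sv enum_rankK -/(sv l) => /andP[Hc].
rewrite cov_daB // => Hsub.
have Hn : ~~ (GX X0 <= val (sv l))%MS.
  rewrite -EXE; apply/negP => H; have : (dn (EX X0) <= dn (sv l))%N := mxrankS H.
  by rewrite (cov_dn Hc) ltnn.
have [al Hal [s Hs]] := not_sub_col Hn.
have [w Nw tw] : exists2 w : 'rV[F]_D, inN (GX X0 *m al *m w) & theta (GX X0 *m al *m w) = 1.
  apply: (theta_mkY HX0 Hs); right=> s' Hs'.
  have /submxP[B HB] := submx_trans (d1_GX_sub HX0) Hsub.
  transitivity ((d1 *m GX X0 *m al) s' 0); first by rewrite -mulmxA dS_mul Hs' mul1r.
  by rewrite HB -mulmxA Hal mulmx0 mxE.
exists (GX X0 *m al *m w); split=> // a.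
rewrite -scalemxAr mulmxA mul_GX ?Hal ?mul0mx ?scaler0 ?sub0mx //.
by rewrite -EXE; apply: cov_sub.
Qed.


Lemma row_mkY (s0 : 'I_D) (w : 'rV[F]_D) (t0 : 'I_D) : isE s0 -> t0 = sig s0 :> nat -> w 0 t0 != 0 ->
  (forall t, w 0 t != 0 -> ~~ isE t /\ ((s0 < j)%N -> (t < k)%N)) ->
  exists al : 'cV[F]_D, inN (al *m w) /\ theta (al *m w) = 1.
Proof.
move=> Hs0 Ht0 Hw Hsupp; exists ((w 0 t0)^-1 *: delta_mx s0 0); split.
  apply/inNP => s t; rewrite mxE big_ord1 mxE mxE eqxx andbT mulf_eq0 negb_or mulf_eq0 negb_or bool_neq0.
  by move=> /andP[/andP[_ /eqP ->] /Hsupp[H1 H2]].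
rewrite (theta_rank1 Hs0 Ht0); first by rewrite mxE mxE !eqxx mulr1 mulVf.
by move=> s t; rewrite mxE mxE eqxx andbT mulf_eq0 negb_or bool_neq0 => /andP[_ /eqP ->].
Qed.

Lemma exists_coord (A : 'M[F]_D) (S T : pred nat) : (A <= dS F D S)%MS ->
  ~~ (A <= dS F D T)%MS ->
  exists w : 'rV[F]_D, [/\ (w <= A)%MS, (forall t, w 0 t != 0 -> S t) &
    exists t0, [/\ w 0 t0 != 0, S t0 & ~~ T t0]].
Proof.
move=> /sub_dSP HS Hn.
have [[r t]/= /andP[H1 H2]] : exists p : 'I_D * 'I_D, (A p.1 p.2 != 0) && ~~ T p.2.
  apply/existsP; apply: contraNT Hn => /existsPn H; apply/sub_dSP => r t Hrt.
  by have := H (r, t); rewrite /= Hrt negbK.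
exists (row r A); split; first exact: row_sub.
  by move=> t'; rewrite mxE => /HS.
by exists t; rewrite mxE; split=> //; apply: HS H1.
Qed.

Lemma sig_preim_low t : (j <= t < 2 * j + h)%N -> exists2 s, isE s & sig s = t.
Proof.
move=> Ht; have [H|H] := ltnP t (2 * j).
  exists (t - j)%N; rewrite /isE /sig; move: Hj Hi Ht H; first by lia.
  by case: ifP; [lia|case: ifP; lia].
exists (t - 2 * j + k)%N; rewrite /isE /sig; move: Hj Hi Ht H; first by lia.
by case: ifP; [lia|case: ifP; lia].
Qed.

Lemma sub_addmul (A : 'M[F]_D) (al : 'cV[F]_D) (w : 'rV[F]_D) a : (w <= A)%MS ->
  (A *m (a *: (al *m w)) <= A)%MS.
Proof. by move=> Hw; rewrite -scalemxAr mulmxA scalemx_sub // mulmx_sub. Qed.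

(** A space [y] reached by so many steps contains more independent vectors on the coordinates from
    [j] to [k - 1] than there are such coordinates outside the image of [sig]. So some [w] in [y] is
    nonzero at a [sig s0], and [Y = al *m w], with row space inside [y], fixes [y]. *)
Lemma fvec_RA : iter_act (RA W C) (k - 2 * j - h).+1 fvec = 0.
Proof.
rewrite act_powmx; apply/rowP => l; rewrite [RHS]mxE; apply: fvec_vanish => [X HX|X0 HX0].
  by apply: powmx_comm; rewrite RA_pact gact_stdW.
move=> /powRA_support[]; rewrite [sv (enum_rank _)]enum_rankK da_EX //.
move: (sv l) => y Hxy Hda _.
set U := (val y :&: val W)%MS; pose U' := (U :&: dWC)%MS.
have HU' : (k - 2 * j - h < \rank U')%N.
  have := mxrank_sum_cap U dWC; rewrite -/U' -[\rank U]/(da W y) Hda.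
  have : (\rank (U + dWC)%MS <= k)%N.
    rewrite -[X in (_ <= X)%N]dn_stdW; apply: mxrankS; rewrite addsmx_sub capmxSr stdWE.
    apply/sub_dSP => r s; rewrite !mxE; have [->|_] := eqVneq r s; last by rewrite mulr0n eqxx.
    by rewrite mulr1n bool_neq0 => /andP[].
  rewrite rank_dS sum_itv; move: Hj Hi; clear; lia.
have Hn : ~~ (U' <= dS F D (fun s => (2 * j + h <= s < k)%N))%MS.
  apply/negP => /mxrankS; rewrite rank_dS sum_itv leqNgt => /negP; apply.
  by move: HU' Hj Hi; clear; lia.
have [w [HwU Hw [t0 [Ht0 Ht1 Ht2]]]] := exists_coord (capmxSr _ _ : (U' <= dWC)%MS) Hn.
have [|s0 Hs0 Es0] := @sig_preim_low t0; first by move: Ht1 Ht2; clear; lia.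
have Hs0D : (s0 < D)%N by move: Hs0 Hj Hi; rewrite /isE; clear; lia.
have [|al [Nal tal]] := @row_mkY (Ordinal Hs0D) w t0 Hs0 (esym Es0) Ht0.
  by move=> t /Hw; rewrite /isE; move: Hj Hi; clear; lia.
exists (al *m w); split=> // a; apply: sub_addmul.
by apply: submx_trans HwU _; apply: submx_trans (capmxSl _ _) (capmxSl _ _).
Qed.

(** The same count on the coordinates outside [isE]. Those inside [stdW] do not help [y]: since [da]
    has not grown, [y :&: W] equals [EX X0 :&: W], which has no nonzero vector supported off
    [isE]. *)
Lemma fvec_RB : iter_act (RB W C) (D - k - h - 2 * i).+1 fvec = 0.
Proof.
rewrite act_powmx; apply/rowP => l; rewrite [RHS]mxE; apply: fvec_vanish => [X HX|X0 HX0].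
  by apply: powmx_comm; rewrite RB_pact gact_stdW.
move=> /powRB_support[]; rewrite [sv (enum_rank _)]enum_rankK da_EX // dn_EX //.
move: (sv l) => y Hxy Hda Hdn.
pose dC := dS F D (fun s => ~~ isE s); pose U' := (val y :&: dC)%MS.
have HU' : (D - k - h - 2 * i < \rank U')%N.
  have := mxrank_sum_cap (val y) dC; rewrite -/U' -/(dn y) Hdn.
  have : (\rank (val y + dC)%MS <= D)%N by exact: rank_leq_col.
  have -> : \rank dC = (D - (j + h + i))%N.
    rewrite rank_dS.
    rewrite (eq_bigr (fun s : 'I_D => (j <= s < k) + (k + h + i <= s < D))%N) => [|s _]; last first.
      by rewrite /isE; move: (ltn_ord s) Hj; clear; lia.
    by rewrite big_split (sum_itv D j k) (sum_itv D (k + h + i) D) /=; move: Hj Hi; clear; lia.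
  by move: Hj Hi; clear; lia.
pose T s := (j <= s < k)%N || (k + h + 2 * i <= s < D)%N.
have Hn : ~~ (U' <= dS F D T)%MS.
  apply/negP => HT.
  have Hcap : (U' :&: dWC)%MS = 0.
    apply/eqP/rowV0P => u; rewrite !sub_capmx => /andP[/andP[Huy HuC] Hu].
    have : (u <= val y :&: val W)%MS.
      rewrite sub_capmx Huy stdWE; apply: submx_trans Hu _.
      apply/sub_dSP => r s; rewrite !mxE; have [->|_] := eqVneq r s; last by rewrite mulr0n eqxx.
      by rewrite mulr1n bool_neq0 => /andP[].
    have : (val (EX X0) :&: val W :=: val y :&: val W)%MS.
      apply/eqmxP; have [_ <-] := mxrank_leqif_eq (capmxS Hxy (submx_refl (val W))).
      by rewrite -/(da W _) -/(da W _) Hda da_EX.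
    move=> <- /submx_trans /(_ (cap_GX HX0)) /submxP[v Hv].
    have H0 : u *m dE = 0.
      apply/rowP => s; rewrite mul_dS [RHS]mxE; move: HuC; rewrite sub_dS => /eqP <-.
      by rewrite mul_dS; case: (isE s); rewrite /= ?(mulr0, mul0r).
    have H1 : v *m d1 = 0.
      by move: H0; rewrite Hv -[v *m _ *m dE]mulmxA -[d1 *m GX X0 *m dE]mulmxA GX_dE // d1_dE.
    by rewrite Hv mulmxA H1 mul0mx.
  have := mxrank_sum_cap U' dWC; rewrite Hcap mxrank0 addn0.
  have : (\rank (U' + dWC)%MS <= \rank (dS F D T))%N.
    apply: mxrankS; rewrite addsmx_sub HT.
    apply/sub_dSP => r s; rewrite !mxE; have [->|_] := eqVneq r s; last by rewrite mulr0n eqxx.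
    by rewrite mulr1n bool_neq0 /T => ->.
  rewrite !rank_dS sum_itv.
  rewrite (eq_bigr (fun s : 'I_D => (j <= s < k) + (k + h + 2 * i <= s < D))%N) => [|s _]; last first.
    by rewrite /T; move: Hj; clear; lia.
  rewrite big_split (sum_itv D j k) (sum_itv D (k + h + 2 * i) D) /=; move: HU' Hj Hi; clear; lia.
have [w [HwU Hw [t0 [Ht0 Ht1 Ht2]]]] := exists_coord (capmxSr _ _ : (U' <= dC)%MS) Hn.
have Hs0D : (t0 - i < D)%N by move: (ltn_ord t0); clear; lia.
have Ht : (k + h + i <= t0 < k + h + 2 * i)%N.
  by move: Ht1 Ht2 (ltn_ord t0) Hj Hi; rewrite /isE /T; clear; lia.
have [|||al [Nal tal]] := @row_mkY (Ordinal Hs0D) w t0 _ _ Ht0.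
- by rewrite /isE /=; move: Ht Hj Hi; clear; lia.
- by rewrite /sig /=; move: Ht Hj Hi; clear; do ?case: ifP => ?; lia.
- by move=> t /Hw Ht'; split=> //=; move: Ht Hj Hi; clear; lia.
exists (al *m w); split=> // a; apply: sub_addmul.
by apply: submx_trans HwU (capmxSl _ _).
Qed.

Lemma fvec_neq0 : fvec != 0.
Proof.
apply/negP => /eqP /rowP /(_ (enum_rank E0)); rewrite [RHS]mxE /fvec summxE.
have N0 : inN 0 by apply/inNP => s t; rewrite mxE eqxx.
rewrite (bigD1 0) //= big1 ?addr0 => [|X /andP[HX X0]].
  rewrite mxE dltE [sv _]enum_rankK /EX addr0 gact_fix ?unitmx1 ?mulmx1 // eqxx mulr1.
  have -> : theta 0 = 0.
    by rewrite /theta big1 // => s _; rewrite big1 // => t _; rewrite mxE mulr0.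
  by rewrite /cc eqxx mulr1; apply/eqP; apply: Q1_neq0.
rewrite mxE dltE [sv _]enum_rankK; case: eqP => [E|]; last by rewrite mulr0.
case/eqP: X0; have : (GX X <= dE)%MS by rewrite -EXE -E mksubE.
rewrite sub_dS GX_dE // GXE // => /eqP E'.
by apply: (addrI dE); rewrite addr0 -E'.
Qed.

End Existence.

Lemma lowest_exists (F : finFieldType) (D : nat) (W : subsp F D) (C : numClosedFieldType) h i j :
  (2 * j + h <= dn W)%N -> (2 * i + h + dn W <= D)%N ->
  exists u : 'rV[C]_#|{: subsp F D}|, lowest W h i j u /\
    forall s, iter_act (RA W C) s u = 0 -> (dn W < s + 2 * j + h)%N.
Proof.
move=> Hj Hi; have [g Hg EW] := gact_pid W; set k := dn W in Hj Hi EW *.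
pose f := fvec F D C k h i j *m perm_mx (pact Hg) : 'rV[C]_#|{: subsp F D}|.
have Hlow : low (stdW F D k) j (h + i) (fvec F D C k h i j).
  by split; [apply: fvec_wt|apply: fvec_LA|apply: fvec_LB].
have HEW : gact g (stdW F D k) = W by exact: EW.
pose Kp u := [/\ low W j (h + i) u, iter_act (RA W C) (k - 2 * j - h).+1 u = 0
  & iter_act (RB W C) (D - k - h - 2 * i).+1 u = 0].
have Kf : Kp f.
  split; first by rewrite -[W]HEW; apply: low_pact.
    have H := RA_pact C Hg (stdW F D k); rewrite HEW in H.
    by rewrite (act_pact _ _ H) fvec_RA ?mul0mx.
  have H := RB_pact C Hg (stdW F D k); rewrite HEW in H.
  by rewrite (act_pact _ _ H) fvec_RB ?mul0mx.
have Hf0 : f != 0 by apply: pact_neq0; apply: fvec_neq0.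
(* The second alternative does not depend on the vector, so closure under combinations is immediate;
   [low_ind] then extracts an eigenvector from [f] because [f] is nonzero. *)
pose S (u : 'rV[C]_#|{: subsp F D}|) := u = 0 \/
  exists u : 'rV[C]_#|{: subsp F D}|, lowest W h i j u /\
    forall s, iter_act (RA W C) s u = 0 -> (k < s + 2 * j + h)%N.
have : S f; last by case=> // E; rewrite E eqxx in Hf0.
apply: (@low_ind F D W C j (h + i) Kp S) Kf.
- by move=> u [].
- move=> c u v [Lu Au Bu] [Lv Av Bv]; split.
  + by apply: lowD => //; apply: lowZ.
  + by rewrite actD actZ Au Av scaler0 addr0.
  + by rewrite actD actZ Bu Bv scaler0 addr0.
- move=> u [Lu Au Bu]; split; first exact: low_cM.
  + by have [Hw _ _] := Lu; rewrite -(act_RA_cM _ Hw) Au mul0mx.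
  + by rewrite -act_RB_cM Bu mul0mx.
- by move=> c u v [->|H]; [move=> [->|H]; [left; rewrite scaler0 addr0|right]|right].
- by left.
move=> u mu [Lu Au Bu] Hu Hmu; right.
have [h' [i' [Eb Hl HA HB]]] := eig_lowest Lu Hu Hmu.
(* The truncations give [h <= h'] and [h + 2 * i <= h' + 2 * i']; together with [h + i = h' + i']
   both become equalities. *)
have H1 := HA _ Au; have H2 := HB _ Bu.
have [_ _ _ [_ _ H3 H4]] := Hl.
have Eh : h' = h by move: H1 H2 H3 H4 Hj Hi Eb; rewrite -/k; clear; lia.
have Ei : i' = i by move: Eb; rewrite Eh; clear; lia.
by subst h' i'; exists u.
Qed.

(** * Isomorphism classes of the modules *)

Section KindIso.
Variables (F : finFieldType) (C : numClosedFieldType) (D k : nat).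
Hypothesis HkD : (2 * k <= D)%N.
Local Notation Q := (#|F|%:R : C).
Local Notation lo := (klo D k).
Local Notation len := (klen D k).
Local Notation al := (kal Q D k).
Local Notation be := (kbe Q D k).
Local Notation Q0 := (QX_neq0 F C).
Implicit Types t : kind.

(* Isomorphism of the corresponding modules. *)
Definition kiso t t' := [/\ lo t = lo t', len t = len t',
  forall m, (m < len t)%N -> al t (lo t + m) = al t' (lo t + m) &
  forall m, (m.+1 < len t)%N -> be t (lo t + m) = be t' (lo t + m)].

Lemma kiso_refl t : kiso t t.
Proof. by []. Qed.

Lemma chain_kiso n (A B : 'M[C]_n) delta t t' e : kiso t t' ->
  chain A B delta lo len al be t e -> chain A B delta lo len al be t' e.
Proof.
move=> [Hlo Hlen Hal Hbe] He m; rewrite -Hlen -Hlo => Hm; have [H1 H2] := He m Hm.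
split=> //; rewrite H2 Hal //; congr (_ + _ + _).
by case: m Hm {H1 H2} => [|m'] Hm //; rewrite Hbe.
Qed.

Lemma kbe_neq0 t m : kvalid D k t -> (m.+1 < len t)%N -> be t (lo t + m) != 0.
Proof.
case: t => [[h i] j]; rewrite /kvalid /klen /klo /kbe /= => /and3P[H1 H2 H3] Hm.
set a := (maxn _ _ + m)%N.
have Ha : (j <= a)%N /\ (i - (D - 2 * k) <= a)%N by rewrite /a; move: Hm; clear; lia.
have Ha' : (a < k - h - maxn i j)%N by rewrite /a; move: Hm; clear; lia.
clearbody a; case: Ha => Ha1 Ha2.
have N1 n : (0 < n)%N -> Q ^+ n - 1 != 0 by case: n => // n _; apply: QX1_neq0.
have N2 x y : (y < x)%N -> Q ^+ x - Q ^+ y != 0.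
  by move=> H; rewrite subr_eq0; apply/eqP => /(@QX_inj F C) E; rewrite E ltnn in H.
rewrite !mulf_neq0 ?Q0 ?invr_eq0 ?expf_neq0 ?Q1_neq0 ?N1 ?N2 //; move: Ha1 Ha2 Ha' H1 H2 H3 HkD; clear; lia.
Qed.

Lemma kmaxP t m : (m < len t)%N -> (lo t + m <= k)%N.
Proof. by rewrite /klen; lia. Qed.

(** For [x <= y] the difference of the two sides factors as [(Q ^+ y - Q ^+ x) * (Q ^+ d.+1 - 1)];
    the bound [x + y < M] excludes the mirror solution [y = M - x]. *)
Lemma pow_sum_inj M x y : (x + y < M)%N -> Q ^+ x + Q ^+ (M - x) = Q ^+ y + Q ^+ (M - y) -> x = y.
Proof.
wlog Hxy : x y / (x <= y)%N => [H Hm E|Hm].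
  by have [H1|/ltnW H1] := leqP x y; [apply: H|apply/esym; apply: H => //; rewrite addnC].
have [d Hd] : exists d, M = (x + y + d.+1)%N by exists (M - x - y).-1; lia.
have -> : (M - x = y + d.+1)%N by lia.
have -> : (M - y = x + d.+1)%N by lia.
rewrite !exprD => E.
have : (Q ^+ y - Q ^+ x) * (Q ^+ d.+1 - 1) = 0.
  move: E; move: (Q ^+ x) (Q ^+ y) (Q ^+ d.+1) => X Y Z E.
  by transitivity (X + Y * Z - (Y + X * Z)); [ring|rewrite E subrr].
move/eqP; rewrite mulf_eq0 (negPf (QX1_neq0 F C d)) orbF subr_eq0 => /eqP.
by move/(@QX_inj F C).
Qed.

(** What is left of [kal] once the terms depending on [a] alone and the common denominator are
    removed. *)
Definition kcore t a : C := Q ^+ (k - a) * kS Q D k t - (Q + 1) * Q ^+ (2 * (k - a) - t.1.1).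

Lemma kal_core t a : al t a = (kcore t a - Q ^+ (k - a) * (Q ^+ a + Q ^+ (D - 2 * k + a).+1)) / (Q - 1) ^+ 2
  - (Q ^+ k - 1) / (Q - 1).
Proof. by rewrite /kal /kcore; congr (_ / _ - _); ring. Qed.

Lemma kal_eq t t' a : (al t a = al t' a) <-> (kcore t a = kcore t' a).
Proof.
have N : ((Q - 1) ^+ 2)^-1 != 0 by rewrite invr_eq0 expf_neq0 ?Q1_neq0.
rewrite !kal_core; split=> [|-> //].
by move/(addIr _)/(mulIf N)/(addIr _).
Qed.

Lemma kcore_sep1 t t' a : t.1.1 = t'.1.1 -> kcore t a = kcore t' a -> kS Q D k t = kS Q D k t'.
Proof. by rewrite /kcore => -> /(addIr _)/(mulfI (Q0 _)). Qed.

(** [kcore t a - Q * kcore t a.+1] eliminates [kS] and leaves [Q ^+ (2 * (k - a.+1) - h)] times the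
    nonzero constant [- (Q + 1) * Q * (Q - 1)]; the bounds keep the exponent from truncating. *)
Lemma kcore_sep2 t t' a : (a.+1 + t.1.1 <= k)%N -> (a.+1 + t'.1.1 <= k)%N ->
  kcore t a = kcore t' a -> kcore t a.+1 = kcore t' a.+1 -> t.1.1 = t'.1.1.
Proof.
rewrite /kcore; move: t.1.1 t'.1.1 (kS _ _ _ t) (kS _ _ _ t') => h h' S S' H1 H2.
have -> : (k - a = (k - a.+1).+1)%N by lia.
set n := (k - a.+1)%N.
have -> : (2 * n.+1 - h = (2 * n - h).+2)%N by lia.
have -> : (2 * n.+1 - h' = (2 * n - h').+2)%N by lia.
rewrite !exprS; move=> E1 E2.
have E3 : (Q + 1) * Q * (Q - 1) * (Q ^+ (2 * n - h) - Q ^+ (2 * n - h')) = 0.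
  move: (Q ^+ n) (Q ^+ (2 * n - h)) (Q ^+ (2 * n - h')) E1 E2 => x y z E1 E2.
  transitivity ((Q * x * S' - (Q + 1) * (Q * (Q * z))) - (Q * x * S - (Q + 1) * (Q * (Q * y)))
    + Q * (x * S - (Q + 1) * y) - Q * (x * S' - (Q + 1) * z)); first by ring.
  by rewrite E1 E2 subrr add0r subrr.
have N : Q + 1 != 0 by rewrite gt_eqF // addr_gt0 ?Q_gt0 ?ltr01.
move/eqP: E3; rewrite !mulf_eq0 (negPf N) (negPf (Q_neq0 F C)) (negPf (Q1_neq0 F C)) /= subr_eq0.
by move=> /eqP/(@QX_inj F C); lia.
Qed.

Lemma kS_sep_j h i j j' : (2 * j + h <= k)%N -> (2 * j' + h <= k)%N ->
  kS Q D k (h, i, j) = kS Q D k (h, i, j') -> j = j'.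
Proof.
rewrite /kS /= => H1 H2 /(addIr _)/(addIr _) E.
apply: (@pow_sum_inj (k - h).+1); first by lia.
by rewrite !subSn 1?addrC; [rewrite E addrC| lia | lia].
Qed.

Lemma kS_sep_i h i i' j : (2 * i + h + k <= D)%N -> (2 * i' + h + k <= D)%N ->
  kS Q D k (h, i, j) = kS Q D k (h, i', j) -> i = i'.
Proof.
rewrite /kS /= -!addrA => H1 H2 /(addrI _)/(addrI _) E.
apply: (@pow_sum_inj (D - k - h).+1); first by lia.
by rewrite !subSn 1?addrC; [rewrite E addrC| lia | lia].
Qed.


Lemma klen_gt0 t : kvalid D k t -> (0 < len t)%N.
Proof. by case: t => [[h i] j]; rewrite /kvalid /klen /klo /=; move: HkD; clear; lia. Qed.

Lemma sep_len2 t t' : lo t = lo t' -> len t = len t' ->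
  (forall m, (m < len t)%N -> al t (lo t + m) = al t' (lo t + m)) -> (1 < len t)%N ->
  t.1.1 = t'.1.1 /\ kS Q D k t = kS Q D k t'.
Proof.
move=> Hlo Hlen Hal Hm.
have E0 := Hal 0%N (ltnW Hm); have E1 := Hal 1%N Hm.
rewrite addn0 in E0; rewrite addn1 in E1.
move/kal_eq: E0 => E0; move/kal_eq: E1 => E1.
have Eh : t.1.1 = t'.1.1.
  apply: (@kcore_sep2 t t' (lo t)) => //; move: Hlo Hlen Hm; rewrite /klen; clear; lia.
by split=> //; apply: kcore_sep1 E0.
Qed.

Lemma klen1_le h i j : kvalid D k (h, i, j) -> len (h, i, j) = 1%N -> (i <= j)%N -> (k = h + 2 * j)%N.
Proof. by rewrite /kvalid /klen /klo /=; clear; lia. Qed.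

(** With two diagonal entries [h] and [kS] are known, the range of weights pins [i] or [j], and [kS]
    gives the other. With a single weight, [i <= j] makes that weight equal to [j] and gives
    [k = h + 2 * j], so only [i] is left for [kS]. *)
Lemma kind_sep_lt t t' : (2 * k < D)%N -> kvalid D k t -> kvalid D k t' ->
  (len t = 1%N -> t.1.2 <= t.2)%N -> (len t' = 1%N -> t'.1.2 <= t'.2)%N ->
  lo t = lo t' -> len t = len t' ->
  (forall m, (m < len t)%N -> al t (lo t + m) = al t' (lo t + m)) -> t = t'.
Proof.
move=> Hlt Ht Ht' H1 H1' Hlo Hlen Hal; have H0 := klen_gt0 Ht.
have [Hm|Hm] := ltnP 1 (len t).
  have [] := sep_len2 Hlo Hlen Hal Hm; clear Hal H1 H1'.
  move: t t' Ht Ht' Hlo Hlen Hm {H0} => [[h i] j] [[h' i'] j'] /= Ht Ht' Hlo Hlen Hm Eh ES; subst h'.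
  have [Ei|Ej] : i = i' \/ j = j'.
    by move: Hlo Hlen Hm Ht Ht' Hlt; rewrite /klen /klo /kvalid /=; clear; lia.
    rewrite -Ei in ES *; congr (_, _, _); apply: kS_sep_j ES; move: Ht Ht'; rewrite /kvalid /=; clear; lia.
  rewrite -Ej in ES *; congr (_, _, _); apply: kS_sep_i ES; move: Ht Ht'; rewrite /kvalid /=; clear; lia.
have E1 : len t = 1%N by apply/eqP; rewrite eqn_leq Hm H0.
have E0 := Hal 0%N H0; rewrite addn0 in E0; move/kal_eq: E0 => E0.
rewrite E1 in Hlen; have {}H1 := H1 E1; have {}H1' := H1' (esym Hlen); clear Hal H0 Hm.
move: t t' Ht Ht' Hlo Hlen E1 E0 H1 H1' => [[h i] j] [[h' i'] j'] /= Ht Ht' Hlo Hlen E1 E0 H1 H1'.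
have Ej : j = j' by move: Hlo H1 H1'; rewrite /klo /=; clear; lia.
have Eh : h = h'.
  by have := klen1_le Ht E1 H1; have := klen1_le Ht' (esym Hlen) H1'; move: Ej; clear; lia.
rewrite -Eh -Ej in E0 *; have ES := @kcore_sep1 (h, i, j) (h, i', j) _ (erefl h) E0.
congr (_, _, _); rewrite -Ej -Eh in Ht'.
apply: kS_sep_i ES; move: Ht Ht'; rewrite /kvalid /=; clear; lia.
Qed.

(** Now the lowest weight is [maxn i j], that is [i]; the length then gives [h], and [kS] gives
    [j]. *)
Lemma kind_sep_eq t t' : (2 * k = D)%N -> kvalid D k t -> kvalid D k t' ->
  (t.2 <= t.1.2)%N -> (t'.2 <= t'.1.2)%N -> lo t = lo t' -> len t = len t' ->
  (forall m, (m < len t)%N -> al t (lo t + m) = al t' (lo t + m)) -> t = t'.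
Proof.
move=> Heq Ht Ht' H1 H1' Hlo Hlen Hal; have H0 := klen_gt0 Ht.
have [Eh ES] : t.1.1 = t'.1.1 /\ kS Q D k t = kS Q D k t'.
  have [Hm|Hm] := ltnP 1 (len t); first exact: sep_len2.
  have Eh : t.1.1 = t'.1.1.
    move: t t' Ht Ht' Hlo Hlen Hm H0 H1 H1' Heq {Hal} => [[h i] j] [[h' i'] j'].
    by rewrite /kvalid /klen /klo /=; clear; lia.
  split=> //; have := Hal 0%N H0; rewrite addn0 => /kal_eq; exact: kcore_sep1.
move: t t' Ht Ht' Hlo Hlen Eh ES H1 H1' {H0 Hal} => [[h i] j] [[h' i'] j'] /= Ht Ht' Hlo Hlen Eh ES H1 H1'.
have Ei : i = i'.
  by move: Hlo Hlen Ht Ht' Eh H1 H1' Heq; rewrite /kvalid /klen /klo /=; clear; lia.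
rewrite -Eh -Ei in ES Ht' *; congr (_, _, _).
by apply: kS_sep_j ES; move: Ht Ht'; rewrite /kvalid /=; clear; lia.
Qed.

Lemma kiso_len1 t t' : lo t = lo t' -> len t = 1%N -> len t' = 1%N ->
  kcore t (lo t) = kcore t' (lo t) -> kiso t t'.
Proof.
move=> Hlo H1 H1' Hc; split=> //; first by rewrite H1 H1'.
  by move=> m; rewrite H1; case: m => // _; rewrite addn0; apply/kal_eq.
by move=> m; rewrite H1.
Qed.

Lemma kind_cover_lt t : (2 * k < D)%N -> kvalid D k t -> exists t', [/\ kvalid D k t', kiso t t' &
  [\/ (1 < len t')%N, (t'.1.2 < t'.2)%N | exists2 j, (2 * j <= k)%N & t' = (k - 2 * j, j, j)%N]].
Proof.
case: t => [[h i] j] Hlt Hv; have H0 := klen_gt0 Hv.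
have [Hm|Hm] := ltnP 1 (len (h, i, j)); first by exists (h, i, j); split; [by []|exact: kiso_refl|by constructor 1].
have E1 : len (h, i, j) = 1%N by apply/eqP; rewrite eqn_leq Hm H0.
have [Hij|Hij] := ltnP i j; first by exists (h, i, j); split; [by []|exact: kiso_refl|by constructor 2].
have [Hije|Hije] := leqP (i - j) (D - 2 * k).
  (* Type II. As [k = h + i + j], the terms of [kS] in [Q ^+ i] cancel against the last term of
     [kcore]; the entry depends on the weight [j] alone, so [i] may be moved to [j]. *)
  exists (k - 2 * j, j, j)%N; have E : (k = h + i + j)%N.
    by move: E1 Hij Hije Hv; rewrite /kvalid /klen /klo /=; clear; lia.
  have Elo : lo (h, i, j) = j by move: Hij Hije; rewrite /klo /=; clear; lia.
  split; last by constructor 3; exists j => //; move: E Hij; clear; lia.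
    by move: E Hij HkD; rewrite /kvalid /=; clear; lia.
  apply: kiso_len1 => //; rewrite ?Elo /klen /klo /=; [lia|lia|].
  have [d Hd] : exists d, D = (2 * k + d)%N by exists (D - 2 * k)%N; move: HkD; clear; lia.
  rewrite /kcore /kS /=.
  have -> : (k - h - j = i)%N by lia.
  have -> : (D - k - h - i = d + j)%N by lia.
  have -> : (2 * (k - j) - h = k - j + i)%N by lia.
  have -> : (k - (k - 2 * j) - j = j)%N by lia.
  have -> : (D - k - (k - 2 * j) - j = d + j)%N by lia.
  have -> : (2 * (k - j) - (k - 2 * j) = k - j + j)%N by lia.
  rewrite !exprS !exprD; ring.
have [a Ea] : exists a, i = (a + (D - 2 * k))%N by exists (i - (D - 2 * k))%N; lia.
have E : (k + (D - 2 * k) = h + 2 * i)%N.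
  by move: E1 Hij Hije Hv; rewrite /kvalid /klen /klo /=; clear; lia.
have Elo : lo (h, i, j) = a by move: Hij Hije Ea; rewrite /klo /=; clear; lia.
(* Type III. The single weight is [a = i - (D - 2 * k)], which exceeds [j]; the same cancellation
   makes the entry agree with that of the type whose second index is [j] and whose third is [a]. *)
exists (k - 2 * a, j, a)%N; split; last by constructor 2; rewrite /=; lia.
  by move: E Ea Hije HkD; rewrite /kvalid /=; clear; lia.
have [d Hd] : exists d, D = (2 * k + d)%N by exists (D - 2 * k)%N; move: HkD; clear; lia.
have Ed : (D - 2 * k = d)%N by lia.
rewrite Ed in Ea E Hije.
apply: kiso_len1 => //; rewrite ?Elo /klen /klo /= ?Ed; [lia|lia|].
have [p Hp] : exists p, (a = j + p)%N by exists (a - j)%N; lia.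
rewrite /kcore /kS /=.
have -> : (k - h - j = i + p)%N by lia.
have -> : (D - k - h - i = i)%N by lia.
have -> : (2 * (k - a) - h = k - a + i)%N by lia.
have -> : (k - (k - 2 * a) - a = a)%N by lia.
have -> : (D - k - (k - 2 * a) - j = i + p)%N by lia.
have -> : (2 * (k - a) - (k - 2 * a) = k - a + a)%N by lia.
rewrite !exprS !exprD; ring.
Qed.

(** For [D = 2 * k], exchanging [i] and [j] swaps the two pairs in [kS] and permutes the factors of
    [kbe]. *)
Lemma kind_cover_eq t : (2 * k = D)%N -> kvalid D k t ->
  exists t', [/\ kvalid D k t', kiso t t' & (t'.2 <= t'.1.2)%N].
Proof.
case: t => [[h i] j] Heq Hv.
have [Hij|Hij] := leqP j i; first by exists (h, i, j).
exists (h, j, i); split; [by move: Hv Heq; rewrite /kvalid /=; clear; lia| |exact: ltnW].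
have Ed : (D - 2 * k = 0)%N by lia.
have Ek : (D - k = k)%N by lia.
have Elo : lo (h, i, j) = lo (h, j, i) by rewrite /klo /= Ed !subn0 maxnC.
have Elen : len (h, i, j) = len (h, j, i) by rewrite /klen Elo /= maxnC.
split=> // m Hm.
  apply/kal_eq; rewrite /kcore /kS /= Ek; ring.
rewrite /kbe /= Ed !add0n.
set a := (lo _ + m)%N.
have -> : (k - h - a = k - a - h)%N by lia.
ring.
Qed.

Lemma inP_kvalid h i j : inP D k h i j = kvalid D k (h, i, j).
Proof. by rewrite /inP /kvalid /=; lia. Qed.

Lemma bsize_klen h i j : kvalid D k (h, i, j) -> bsize D k h i j = len (h, i, j).
Proof. by rewrite /bsize /minT /kvalid /klen /klo /=; lia. Qed.

Lemma inP0_len h i j : kvalid D k (h, i, j) ->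
  (minT D k i j == h%:Z + (maxn i j)%:Z) = (len (h, i, j) == 1%N).
Proof. by rewrite /minT /kvalid /klen /klo /=; lia. Qed.

(** The defining equation of [inP0] says that the module is one-dimensional on the vertices; as
    [0 <= D - 2 * k], the ranges of types II and III together amount to [j <= i]. *)
Lemma merged_kind h i j : kvalid D k (h, i, j) ->
  (inP0II D k h i j || inP0III D k h i j) = (len (h, i, j) == 1%N) && (j <= i)%N.
Proof.
move=> Hv; rewrite /inP0II /inP0III /inP0 inP_kvalid Hv inP0_len // -andb_orr; congr (_ && _).
by move: HkD; clear; lia.
Qed.

Lemma mem_Pk t : (t \in Pk D k) = kvalid D k t.
Proof.
case: t => [[h i] j]; rewrite mem_filter -[X in X && _]/(inP D k h i j) inP_kvalid andb_idr // => Hv.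
apply/flattenP; exists [seq (h, i', j') | i' <- iota 0 D.+1, j' <- iota 0 D.+1].
  by apply/mapP; exists h; rewrite // mem_iota; move: Hv HkD; rewrite /kvalid /=; clear; lia.
apply/allpairsP; exists (i, j); rewrite !mem_iota; split=> //;
  by move: Hv HkD; rewrite /kvalid /=; clear; lia.
Qed.

End KindIso.

Lemma uniq_flatten_map (T S : eqType) (s : seq T) (f : T -> seq S) (g : S -> T) : uniq s ->
  (forall x, x \in s -> uniq (f x)) -> (forall x y, x \in s -> y \in f x -> g y = x) ->
  uniq (flatten (map f s)).
Proof.
elim: s => //= x s IH /andP[Hx Hs] Hf Hg.
rewrite cat_uniq Hf ?mem_head //= IH //; first last.
- by move=> y z Hy; apply: Hg; rewrite in_cons Hy orbT.
- by move=> y Hy; apply: Hf; rewrite in_cons Hy orbT.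
rewrite andbT; apply/hasPn => y /flattenP[_ /mapP[z Hz ->] Hy]; apply/negP => Hy'.
have E1 := Hg x y (mem_head _ _) Hy'.
have E2 : g y = z by apply: (Hg z y) => //; rewrite in_cons Hz orbT.
by rewrite -E1 E2 Hz in Hx.
Qed.

Lemma uniq_Pk D k : uniq (Pk D k).
Proof.
apply: filter_uniq; apply: (@uniq_flatten_map _ _ _ _ (fun t => t.1.1)); first exact: iota_uniq.
  move=> h _; apply: allpairs_uniq; rewrite ?iota_uniq //.
  by move=> [i j] [i' j'] _ _ /= [-> ->].
by move=> h t _ /allpairsP[[i j] [_ _ ->]].
Qed.

Lemma map_eq_nseq (T : eqType) S (s : seq T) (f : T -> S) c :
  (forall x, x \in s -> f x = c) -> map f s = nseq (size s) c.
Proof.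
elim: s => //= x s IH H; rewrite H ?mem_head // IH // => y Hy.
by apply: H; rewrite in_cons Hy orbT.
Qed.

(** * Eigenvalues of the dual adjacency operator *)

Section DualEigenvalues.
Variables (F : finFieldType) (C : numClosedFieldType) (D k : nat).
Local Notation Q := (#|F|%:R : C).
Local Notation qq := (qq F C).

Lemma qq_sqr : qq ^+ 2 = Q.
Proof. exact: sqrtCK. Qed.

Lemma qq_neq0 : qq != 0.
Proof. by rewrite sqrtC_eq0 Q_neq0. Qed.

Lemma qq_diff_neq0 n : (0 < n)%N -> qq ^+ n - qq ^- n != 0.
Proof.
case: n => // n _; rewrite subr_eq0; apply/eqP => E.
have : Q ^+ n.+1 = 1.
  by rewrite -qq_sqr -exprM mulnC exprM expr2 {2}E mulfV // expf_neq0 // qq_neq0.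
by move/(@QX_inj F C _ 0).
Qed.

Lemma qnum_neq0 n : (0 < n)%N -> qnum F C n != 0.
Proof.
move=> Hn; rewrite mulf_neq0 ?invr_eq0 ?qq_diff_neq0 //.
by have := @qq_diff_neq0 1 isT; rewrite !expr1.
Qed.

(** [dualval] is an affine function of [Q ^+ d] with nonzero slope. *)
Lemma dualval_inj a b : (0 < k)%N -> (2 * k <= D)%N -> dualval F D k C a = dualval F D k C b -> a = b.
Proof.
move=> Hk HkD; rewrite /dualval.
have N1 : qnum F C D.-1 / (qq - qq^-1) != 0.
  by rewrite mulf_neq0 ?qnum_neq0 ?invr_eq0 //; [lia|have := @qq_diff_neq0 1 isT; rewrite !expr1].
have N2 : qnum F C D / (qnum F C k * qnum F C (D - k)) != 0.
  apply: mulf_neq0; first by apply: qnum_neq0; lia.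
  by rewrite invr_eq0; apply: mulf_neq0; apply: qnum_neq0; lia.
move=> /(mulfI N1)/(addIr _)/(addIr _)/(mulfI N2).
have E d : qq ^ (D%:Z + 2 * (d%:Z - k%:Z)) = qq ^ (D%:Z - 2 * k%:Z) * Q ^+ d.
  rewrite -qq_sqr -exprM -[qq ^+ (2 * d)]/(qq ^ (2 * d)%N%:Z) -expfzDr ?qq_neq0 //.
  by congr (_ ^ _); lia.
rewrite !E => /(mulfI (expfz_neq0 _ qq_neq0)); exact: QX_inj.
Qed.

End DualEigenvalues.

(** * Assembly of the two cases *)

Section Assembly.
Variables (F : finFieldType) (D : nat) (W : subsp F D) (C : numClosedFieldType).
Local Notation k := (dn W).
Local Notation Q := (#|F|%:R : C).
Hypotheses (Hk0 : (0 < k)%N) (HkD : (2 * k <= D)%N).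

(** [ts] is a transversal of the isomorphism classes: the third hypothesis gives at most one
    representative per class, the fourth at least one. *)
Lemma Terw_iso (ts : seq kind) : uniq ts -> (forall t, t \in ts -> kvalid D k t) ->
  (forall t t', t \in ts -> t' \in ts -> klo D k t = klo D k t' -> klen D k t = klen D k t' ->
    (forall m, (m < klen D k t)%N -> kal Q D k t (klo D k t + m) = kal Q D k t' (klo D k t + m)) ->
    t = t') ->
  (forall t, kvalid D k t -> exists2 t', t' \in ts & kiso F C D k t t') ->
  alg_iso (@Terw F D k C (val W)) (@blockdiag C (map (klen D k) ts)).
Proof.
move=> Hu Hv Hsep Hcov.
apply: (@chain_alg_iso C _ k (adjA F D k C) (dualA k C (val W)) (dualval F D k C) kind
  (klo D k) (klen D k) (kal Q D k) (kbe Q D k) (0, 0, 0)%N ts Hu Hsep).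
- by move=> t m Ht; apply: kbe_neq0 => //; apply: Hv.
- by move=> t m _; apply: kmaxP.
- by move=> a b _ _; apply: dualval_inj.
- move=> [[h i] j] /Hv Ht; have [H1 H2 _] := and3P Ht.
  have [u [Hlow HA]] := lowest_exists C H1 H2.
  exists (fun m => ev W h i j u m *m vtx_mx W C); split; first exact: ev_chain.
  by move=> m Hm; apply: evJ_neq0.
- move=> Z HZ; apply: (kchain_full Hk0 HkD) => t e m Ht He Hm.
  have [t' Ht' Hiso] := Hcov _ Ht.
  by apply: (HZ t' e m Ht' (chain_kiso Hiso He)); case: Hiso => _ <-.
Qed.

Lemma Terw_iso_lt : (2 * k < D)%N -> alg_iso (@Terw F D k C (val W)) (@blockdiag C (sizes_i D k)).
Proof.
move=> Hlt.
pose rep j : kind := (k - 2 * j, j, j)%N.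
pose ts1 := [seq rep j | j <- iota 0 (k./2).+1].
pose unm (t : kind) := ~~ (inP0II D k t.1.1 t.1.2 t.2 || inP0III D k t.1.1 t.1.2 t.2).
pose ts2 := [seq t <- Pk D k | unm t].
have rep_valid j : (2 * j <= k)%N -> kvalid D k (rep j).
  by rewrite /kvalid /rep /=; move: HkD; clear; lia.
have rep_len j : (2 * j <= k)%N -> klen D k (rep j) = 1%N.
  by rewrite /klen /klo /rep /=; clear; lia.
have in1 t : t \in ts1 -> exists2 j, (2 * j <= k)%N & t = rep j.
  by move=> /mapP[j]; rewrite mem_iota => Hj ->; exists j => //; lia.
have unmE t : kvalid D k t -> unm t = ~~ ((klen D k t == 1%N) && (t.2 <= t.1.2)%N).
  by case: t => [[h i] j] Hv; rewrite /unm merged_kind.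
have in2 t : (t \in ts2) = kvalid D k t && ~~ ((klen D k t == 1%N) && (t.2 <= t.1.2)%N).
  rewrite mem_filter mem_Pk // andbC; case Hv: (kvalid D k t) => //=; exact: unmE.
have -> : sizes_i D k = map (klen D k) (ts1 ++ ts2).
  rewrite map_cat /sizes_i; congr (_ ++ _).
    rewrite -map_comp -[X in nseq X _](size_iota 0); apply/esym/map_eq_nseq => j.
    by rewrite mem_iota => Hj /=; rewrite rep_len //; lia.
  apply/eq_in_map => -[[h i] j]; rewrite in2 => /andP[Hv _]; exact: bsize_klen.
apply: Terw_iso.
- rewrite cat_uniq; apply/and3P; split.
  + rewrite map_inj_uniq ?iota_uniq // => x y; rewrite /rep => -[_ -> _] //.
  + apply/hasPn => t; rewrite in2 => /andP[_ Ht]; apply: contra Ht => /in1[j Hj ->].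
    by rewrite rep_len // leqnn.
  + exact: filter_uniq (uniq_Pk _ _).
- move=> t; rewrite mem_cat => /orP[/in1[j Hj ->]|]; first exact: rep_valid.
  by rewrite in2 => /andP[].
- have Hts t : t \in ts1 ++ ts2 -> kvalid D k t /\ (klen D k t = 1%N -> (t.1.2 <= t.2)%N).
    rewrite mem_cat => /orP[/in1[j Hj ->]|]; first by split; [apply: rep_valid|].
    by rewrite in2 => /andP[Hv Hn]; split=> // E; rewrite E eqxx /= -ltnNge in Hn; apply: ltnW.
  by move=> t t' /Hts[Hv1 Hl1] /Hts[Hv2 Hl2]; apply: kind_sep_lt.
- move=> t Ht; have [t' [Hv' Hiso Hc]] := kind_cover_lt F C HkD Hlt Ht.
  exists t' => //; rewrite mem_cat.
  case: Hc => [Hl|Hij|[j Hj Ej]].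
  + by rewrite in2 Hv' gtn_eqF ?orbT.
  + by rewrite in2 Hv' [(_ <= _)%N]leqNgt Hij andbF orbT.
  + by apply/orP; left; rewrite Ej; apply/mapP; exists j => //; rewrite mem_iota; move: Hj; clear; lia.
Qed.

(** For [j <= i] the block size depends on [h] and [i] only; the [i.+1] choices of [j] account for
    the [i + 1] equal summands. *)
Lemma Terw_iso_eq : (2 * k = D)%N -> alg_iso (@Terw F D k C (val W)) (@blockdiag C (sizes_ii D)).
Proof.
move=> Heq; have Ek : D./2 = k by rewrite -[RHS]doubleK -mul2n Heq.
pose ts : seq kind := flatten [seq flatten [seq [seq (h, i, j) | j <- iota 0 i.+1]
   | i <- iota 0 ((D - 2 * h) %/ 4).+1] | h <- iota 0 (D./2).+1].
have ints (t : kind) : t \in ts <-> [/\ (t.1.1 <= k)%N, (4 * t.1.2 + 2 * t.1.1 <= D)%N & (t.2 <= t.1.2)%N].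
  case: t => [[h i] j]; split.
    move=> /flattenP[_ /mapP[h' Hh ->]] /flattenP[_ /mapP[i' Hi ->]] /mapP[j' Hj [-> -> ->]] /=.
    by move: Hh Hi Hj; rewrite !mem_iota Ek; clear -Heq; split; lia.
  move=> /= [H1 H2 H3]; apply/flattenP; eexists; first by apply/mapP; exists h; last reflexivity;
    rewrite mem_iota Ek; lia.
  apply/flattenP; eexists; first by apply/mapP; exists i; last reflexivity; rewrite mem_iota; lia.
  by apply/mapP; exists j => //; rewrite mem_iota; lia.
have tsv t : t \in ts -> kvalid D k t /\ (t.2 <= t.1.2)%N.
  by move/ints; case: t => [[h i] j] /= [H1 H2 H3]; rewrite /kvalid /=; move: Heq H1 H2 H3; clear; lia.
have -> : sizes_ii D = map (klen D k) ts.
  rewrite /sizes_ii /ts map_flatten -map_comp; congr flatten; apply/eq_in_map => h Hh.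
  rewrite -[RHS]/(map (klen D k) (flatten [seq [seq (h, i, j) | j <- iota 0 i.+1]
    | i <- iota 0 ((D - 2 * h) %/ 4).+1])).
  rewrite map_flatten -map_comp; congr flatten; apply/eq_in_map => i Hi.
  rewrite -[RHS]/(map (klen D k) [seq (h, i, j) | j <- iota 0 i.+1]).
  rewrite -[X in nseq X _](size_iota 0) -map_comp; apply/esym/map_eq_nseq => j Hj.
  move: Hh Hi Hj; rewrite !mem_iota Ek /klen /klo /=; move: Heq; clear; lia.
apply: Terw_iso.
- apply: (@uniq_flatten_map _ _ _ _ (fun t : kind => t.1.1)); first exact: iota_uniq.
    move=> h _; apply: (@uniq_flatten_map _ _ _ _ (fun t : kind => t.1.2)); first exact: iota_uniq.
      by move=> i _; rewrite map_inj_uniq ?iota_uniq // => j j' [].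
    by move=> i t _ /mapP[j _ ->].
  by move=> h t _ /flattenP[_ /mapP[i _ ->]] /mapP[j _ ->].
- by move=> t /tsv[].
- by move=> t t' /tsv[Hv1 Hl1] /tsv[Hv2 Hl2]; apply: kind_sep_eq.
- move=> t Ht; have [t' [Hv' Hiso Hl]] := kind_cover_eq F C HkD Heq Ht.
  exists t' => //; apply/ints; move: Hv' Hl; case: (t') => [[h i] j]; rewrite /kvalid /=.
  by move: Heq; clear; split; lia.
Qed.

End Assembly.

Unset Implicit Arguments.

Theorem mainTheorem20 (C : numClosedFieldType) (F : finFieldType) (D k : nat)
    (x0 : 'M[F]_D) :
  (1 <= k)%N -> (2 * k <= D)%N -> x0 \in Lk F D k ->
  ((2 * k < D)%N ->
     alg_iso (@Terw F D k C x0) (@blockdiag C (sizes_i D k))) /\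
  ((2 * k = D)%N ->
     alg_iso (@Terw F D k C x0) (@blockdiag C (sizes_ii D))).
Proof.
move=> Hk HkD; rewrite inE => /andP[Hx /eqP Ek]; subst k.
pose W : subsp F D := exist _ x0 Hx.
by split=> H; [apply: (@Terw_iso_lt F D W C)|apply: (@Terw_iso_eq F D W C)].
Qed.
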